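(* Let $U$ satisfy the two-well condition, let $\nu>0$, and let $Y(t)=S+X(t)$, $X(t)=(\Psi(t),\Pi(t))$, be the solution of $\dot\psi=\pi$, $\dot\pi=\psi''+F(\psi)$ with initial data $Y(0)=S+X_0$ satisfying $$\|X_0\|_{E_{5/2+\nu}}\le d_0<\infty .$$ Then $$\|\Psi(t)\|_{L^2_{5/2+\nu}}\le C(d_0)(1+t)^{4+\nu},\qquad t>0 .$$
   Context: Potential and kink. $U:\mathbb R\to\mathbb R$ is smooth and even, $F=-U'$. Two-well condition: for some $a,m>0$ and $k=7$, $U(\psi)>0$ for $\psi\neq\pm a$, and $U(\psi)=\frac{m^2}{2}(\psi\mp a)^2+O(|\psi\mp a|^{2k})$ as $\psi\to\pm a$. The kink $s(x)$ is the odd nonconstant finite-energy solution of $s''-U'(s)=0$ with $s(0)=0$, $s(x)\to\pm a$ as $x\to\pm\infty$; $S=(s,0)$. Spaces. All functions of $x$ are odd. $H^l_\sigma$ is the space of odd functions with finite norm $\sum_{i=0}^l\|(1+|x|)^\sigma\psi^{(i)}\|_{L^2}$, $L^2_\sigma=H^0_\sigma$; $E_\sigma=H^1_\sigma\oplus L^2_\sigma$ with sum norm, $E=E_0$. For every $Y_0\in\mathcal E=S+E$ the Cauchy problem for the system has a unique solution $Y\in C(\mathbb R,\mathcal E)$. The constant $C(d_0)$ depends on $d_0$ (and on $U$, $\nu$), not on $t$ or on the particular $X_0$. *)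

(* Defs.v *)
From HB Require Import structures.
From mathcomp Require Export all_boot all_order all_algebra.
From mathcomp Require Export all_classical all_reals all_analysis.
Export numFieldNormedType.Exports.
Export Order.TTheory GRing.Theory Num.Theory.

Set Implicit Arguments.
Unset Strict Implicit.
Unset Printing Implicit Defensive.

Local Open Scope ring_scope.
Local Open Scope classical_set_scope.

Section Defs.
Context {R : realType}.
Implicit Types (U s f g phi : R -> R) (sigma a m : R).

Local Notation mu := (@lebesgue_measure R).

Definition smooth f := forall (n : nat) (x : R), derivable (derive1n n f) x 1.

Definition two_well (k : nat) U a m : Prop :=
  [/\ 0 < a, 0 < m,
      forall x, x != a -> x != - a -> 0 < U x,
      (fun x => U x - m ^+ 2 / 2 * (x - a) ^+ 2) =O_ (nbhs a)
        (fun x => `|x - a| ^+ (2 * k)) &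
      (fun x => U x - m ^+ 2 / 2 * (x + a) ^+ 2) =O_ (nbhs (- a))
        (fun x => `|x + a| ^+ (2 * k))].

(* The equation is [s'' - U'(s) = 0]; the energy is the integral of
   [s'^2 / 2 + U(s)]. *)
Definition kink U a s : Prop :=
  [/\ forall x, derivable s x 1 /\ derivable (derive1 s) x 1,
      forall x, derive1n 2 s x - derive1 U (s x) = 0,
      (\int[mu]_x ((derive1 s x) ^+ 2 / 2 + U (s x))%:E < +oo)%E,
      (forall x, s (- x) = - s x) /\ (exists x y, s x <> s y) &
      [/\ s 0 = 0, s x @[x --> +oo] --> a & s x @[x --> -oo] --> - a]].

(* Elements of the function spaces below are represented by Borel functions
   [R -> R]; two functions that agree almost everywhere represent the same
   element, so oddness and initial values are only required almost
   everywhere. *)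

Definition test_function phi : Prop :=
  smooth phi /\ exists M : R, forall x, M < `|x| -> phi x = 0.

Definition is_weak_derivative f g : Prop :=
  [/\ locally_integrable setT f, locally_integrable setT g &
      forall phi, test_function phi ->
        \int[mu]_x (f x * derive1 phi x) = - \int[mu]_x (g x * phi x)].

(* Determined up to almost-everywhere equality when [f] has a weak derivative,
   and the zero function otherwise. *)
Definition weak_derivative f : R -> R :=
  xget (cst 0) [set g | is_weak_derivative f g].

(* The sum over [0 <= i <= l] of the [L^2] norms of
   [(1 + |x|)^sigma * f^(i)]. *)
Definition Hnorm (l : nat) sigma f : \bar R :=
  (\sum_(i < l.+1) Lnorm mu 2%:E
     (fun x : R => ((1 + `|x|) `^ sigma * iter i weak_derivative f x)%:E))%E.

Definition in_H (l : nat) sigma f : Prop :=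
  [/\ measurable_fun setT f,
      {ae mu, forall x, f (- x) = - f x},
      forall i : nat, (i < l)%N -> exists g,
        is_weak_derivative (iter i weak_derivative f) g &
      (Hnorm l sigma f < +oo)%E].

Definition state : Type := ((R -> R) * (R -> R))%type.

Definition Enorm sigma (X : state) : \bar R :=
  (Hnorm 1 sigma X.1 + Hnorm 0 sigma X.2)%E.

Definition in_E sigma (X : state) : Prop :=
  in_H 1 sigma X.1 /\ in_H 0 sigma X.2.

Definition kink_state s : state := (s, cst 0).

(* [Y] belongs to [C(R, S + E)], has [Y(0) = Y0], and satisfies
   [psi' = pi], [pi' = psi_xx + F(psi)], [F = - U'], in the sense of
   distributions in [x]: both equations hold after pairing with an arbitrary
   test function of [x]. *)
Definition is_solution U s (Y : R -> state) (Y0 : state) : Prop :=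
  let S := kink_state s in
  let F := fun x : R => - derive1 U x in
  [/\ forall t, in_E 0 (Y t - S),
      forall t0, Enorm 0 (Y t - Y t0) @[t --> t0] --> 0%E,
      (Y 0).1 = Y0.1 %[ae mu] /\ (Y 0).2 = Y0.2 %[ae mu] &
      forall phi, test_function phi -> forall t : R,
        is_derive t 1 (fun t' => \int[mu]_x ((Y t').1 x * phi x) : R)
                      (\int[mu]_x ((Y t).2 x * phi x)) /\
        is_derive t 1 (fun t' => \int[mu]_x ((Y t').2 x * phi x) : R)
                      (\int[mu]_x ((Y t).1 x * derive1n 2 phi x) +
                       \int[mu]_x (F ((Y t).1 x) * phi x))].

End Defs.

Arguments state : clear implicits.

(* Main.v *)
(** The solution enters only through finite propagation of the local energy
    [e = (pi^2 + psi_x^2) / 2 + U(psi)], which is nonnegative because [U] is. On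
    an interval [I], the energy at time [t] is at most the energy at time 0 on the
    [t]-neighbourhood of [I]; since [psi_t = pi], Minkowski's inequality gives
    [int_I (psi(t) - psi(0))^2 <= 2 t^2 int_{I + [-t, t]} e(0)].
    The weighted initial energy [int (1 + |x|)^(2 sigma) e(0)] is finite: [U] is
    quadratic at its wells and the kink tends to them exponentially. Summing over
    unit intervals [I], on whose [t]-neighbourhoods the weight [(1 + |x|)^sigma]
    varies by a factor [O((1 + t)^sigma)] and which cover each point [O(1 + t)]
    times, gives [||Psi(t) - Psi(0)||^2 = O(t^2 (1 + t)^(2 sigma + 1))], that is
    the exponent [sigma + 3/2 = 4 + nu].

    Solutions are only distributional and of finite energy. The energy inequality
    is derived from the transport form [(d_t - c d_x) (pi + c psi_x) = - U'(psi)],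
    [c = 1] or [-1]: tested against translated test functions it yields
    right differentiability in [L^2] along characteristics, hence a nonpositive
    upper right Dini derivative of the energy in the shrinking interval
    [[p + t, q - t]]. *)

From HB Require Import structures.
Require Import Defs.
From mathcomp Require Import measurable_realfun.
From mathcomp Require Import ring lra.

Set Implicit Arguments.
Unset Strict Implicit.
Unset Printing Implicit Defensive.

Local Open Scope ring_scope.
Local Open Scope classical_set_scope.

(** Everything known about a solution is scalar: its pairings with test functions are differentiable
    in time. The energy argument needs norms. The bridge is duality ([ii_sqr_le_test]), combined in
    [weak_mean_value] with the scalar mean value theorem for each test function separately. The
    momentum and the slope need not have time derivatives in L2, so the energy density cannot be
    differentiated at a fixed point. Only [pi + c d], followed along its own characteristic, can:
    its derivative is the continuous function [- V (psi)]. The two combinations are shifted in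
    opposite directions, and the interval shrinks at unit speed exactly so that both shifts stay
    inside the old interval; boundary terms never have to be computed. The nonlinearity is
    controlled only where the field is bounded, hence the passage to the continuous representative
    [psi], which a one-dimensional Sobolev bound makes continuous in time locally uniformly in x.
    The constant depends on [d0] also through the potential: [U] at the perturbed kink is estimated
    with a constant valid for perturbations up to [2 * d0], the sup bound that the initial norm
    provides. *)

Section calculus.
Context {R : realType}.
Implicit Types (f g : R -> R) (x : R).

Lemma is_derive_val_eq f x (d d' : R) :
  is_derive x 1 f d -> d = d' -> is_derive x 1 f d'.
Proof. by move=> H <-. Qed.

Lemma is_derive_powr f n x (df : R) : is_derive x 1 f df ->
  is_derive x 1 (fun y => f y ^+ n) (n%:R * f x ^+ n.-1 * df).
Proof. by move=> H; have := is_deriveX n H; rewrite exprfctE. Qed.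

Lemma is_derive_mulr f g x (df dg : R) : is_derive x 1 f df ->
  is_derive x 1 g dg -> is_derive x 1 (fun y => f y * g y) (f x * dg + df * g x).
Proof. by move=> Hf Hg; have := is_deriveM Hf Hg; rewrite /GRing.scale /= (mulrC (g x)). Qed.

End calculus.

(** * Smooth functions *)

Section smoothness.
Context {R : realType}.
Implicit Types (f g : R -> R).

(** [smooth] asks for all orders at once, which leaves nothing to induct on for products. Counting
    orders gives an induction on [n] with the functions generalised, in which Leibniz' rule uses one
    order less of the functions and of their derivatives. *)
Definition differentiable_upto n f := forall k, (k < n)%N ->
  forall x, derivable (derive1n k f) x 1.

Lemma differentiable_uptoS n f :
  differentiable_upto n.+1 f <->
  (forall x, derivable f x 1) /\ differentiable_upto n (derive1 f).
Proof.
have E k : derive1n k (derive1 f) = derive1n k.+1 f by rewrite /derive1n -iterSr.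
split=> [H|[H0 H] [|k] kn x].
- split; first by move=> x; apply: (H 0%N).
  by move=> k kn x; rewrite E; apply: H.
- exact: H0.
- by rewrite -E; apply: H.
Qed.

Lemma smoothP f : smooth f <-> forall n, differentiable_upto n f.
Proof.
split=> [H n k kn x|H n x]; first exact: H.
exact: (H n.+1).
Qed.

Lemma smooth_derivable f : smooth f -> forall x, derivable f x 1.
Proof. by move=> fs x; exact: (fs 0%N). Qed.

Lemma smooth_derive1 f : smooth f -> smooth (derive1 f).
Proof.
by move=> /smoothP fs; apply/smoothP => n; case: (proj1 (differentiable_uptoS n f) (fs _)).
Qed.

Lemma smooth_antiderivative f g : (forall x : R, is_derive x 1 f (g x)) ->
  smooth g -> smooth f.
Proof.
move=> fg gs; apply/smoothP => -[//|n]; apply/differentiable_uptoS; split.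
  by move=> x; case: (fg x).
have -> : derive1 f = g by apply/funext => x; rewrite derive1E; case: (fg x).
by move/smoothP : gs.
Qed.

Lemma derivable_continuous f : (forall x, derivable f x 1) -> continuous f.
Proof. by move=> fd x; apply/differentiable_continuous/derivable1_diffP. Qed.

Lemma smooth_continuous f : smooth f -> continuous f.
Proof. by move=> /smooth_derivable; exact: derivable_continuous. Qed.

Lemma differentiable_uptoD n f g : differentiable_upto n f ->
  differentiable_upto n g -> differentiable_upto n (f \+ g).
Proof.
elim: n f g => [f g _ _ k //|n IH] f g /differentiable_uptoS[df Hf] /differentiable_uptoS[dg Hg].
apply/differentiable_uptoS; split.
  by move=> x; exact: derivableD.
have -> : derive1 (f \+ g) = derive1 f \+ derive1 g.
  apply/funext => x; rewrite derive1E.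
  have [_ ->] := is_deriveD (derivableP (df x)) (derivableP (dg x)).
  by rewrite -!derive1E.
exact: IH.
Qed.

Lemma differentiable_uptoW n f :
  differentiable_upto n.+1 f -> differentiable_upto n f.
Proof. by move=> H k kn; apply: H; rewrite ltnS ltnW. Qed.

Lemma differentiable_uptoM n f g : differentiable_upto n f ->
  differentiable_upto n g -> differentiable_upto n (fun x => f x * g x).
Proof.
elim: n f g => [f g _ _ k //|n IH] f g Hf0 Hg0.
have /differentiable_uptoS[df Hf] := Hf0.
have /differentiable_uptoS[dg Hg] := Hg0.
have dfg (x : R) : is_derive x 1 (fun x => f x * g x)
    (f x * derive1 g x + derive1 f x * g x).
  by rewrite !derive1E; apply: is_derive_mulr; exact/derivableP.
apply/differentiable_uptoS; split; first by move=> x; case: (dfg x).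
have -> : derive1 (fun x => f x * g x) =
    (fun x => f x * derive1 g x) \+ (fun x => derive1 f x * g x).
  by apply/funext => x; rewrite derive1E; case: (dfg x).
have Hf' := differentiable_uptoW Hf0.
have Hg' := differentiable_uptoW Hg0.
by apply: differentiable_uptoD; [exact: (IH f _ Hf' Hg)|exact: (IH _ g Hf Hg')].
Qed.

Lemma differentiable_upto_cst n (c : R) : differentiable_upto n (cst c).
Proof.
elim: n c => [c k //|n IH] c; apply/differentiable_uptoS; split; first by move=> x; exact: derivable_cst.
have -> : derive1 (cst c) = cst 0 :> (R -> R).
  by apply/funext => x; rewrite derive1_cst.
exact: IH.
Qed.

Lemma derivable_comp_affine f (b c : R) x : derivable f (b * x + c) 1 ->
  is_derive x 1 (fun x => f (b * x + c)) (b * derive1 f (b * x + c)).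
Proof.
move=> df.
have dfi : is_derive (b * x + c) 1 f (derive1 f (b * x + c)).
  by rewrite derive1E; split.
have da : is_derive x 1 (fun x => b * x + c) b.
  have -> : (fun x => b * x + c) = (b \*: (@id R)) \+ cst c by apply/funext.
  have : is_derive x 1 ((b \*: (@id R)) \+ cst c) (b *: 1 + 0) by apply: is_deriveD.
  by rewrite addr0 /GRing.scale /= mulr1.
have := @is_derive1_comp R f (fun x => b * x + c) x _ _ dfi da.
by rewrite mulrC.
Qed.

Lemma differentiable_upto_affine n f (b c : R) : differentiable_upto n f ->
  differentiable_upto n (fun x => f (b * x + c)).
Proof.
elim: n f => [f _ k //|n IH] f /differentiable_uptoS[df Hf].
apply/differentiable_uptoS; split.
  by move=> x; case: (derivable_comp_affine (df (b * x + c))).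
have -> : derive1 (fun x => f (b * x + c)) = (fun x => cst b x * derive1 f (b * x + c)).
  apply/funext => x; rewrite derive1E.
  by have [_ ->] := derivable_comp_affine (df (b * x + c)).
by apply: differentiable_uptoM; [exact: differentiable_upto_cst|exact: IH].
Qed.

Lemma smoothD f g : smooth f -> smooth g -> smooth (f \+ g).
Proof. by move=> /smoothP ? /smoothP ?; apply/smoothP => n; exact: differentiable_uptoD. Qed.

Lemma smoothM f g : smooth f -> smooth g -> smooth (fun x => f x * g x).
Proof. by move=> /smoothP ? /smoothP ?; apply/smoothP => n; exact: differentiable_uptoM. Qed.

Lemma smooth_cst (c : R) : smooth (cst c).
Proof. by apply/smoothP => n; exact: differentiable_upto_cst. Qed.

Lemma smooth_affine f (b c : R) : smooth f -> smooth (fun x => f (b * x + c)).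
Proof. by move=> /smoothP ?; apply/smoothP => n; exact: differentiable_upto_affine. Qed.

End smoothness.

(** * Smooth bumps approximating the indicator of an interval from below *)

Section bump.
Context {R : realType}.

(** The exponent [k] makes the family closed under differentiation: the derivative of x^(-k)
    exp(-1/x) combines the members k + 1 and k + 2, so all members are smooth by one induction. The
    classical exp(-1/x) is [flat 0]. *)
Definition flat (k : nat) (x : R) : R :=
  if 0 < x then x^-1 ^+ k * expR (- x^-1) else 0.

Lemma flat_ge0 k x : 0 <= flat k x.
Proof.
rewrite /flat; case: ifPn => // x0.
by rewrite mulr_ge0 ?expR_ge0// exprn_ge0// invr_ge0 ltW.
Qed.

(** From exp(y) >= y^(k+1) / (k+1)! at y = 1/x. A linear bound for every [k] is what
    differentiability at 0 consumes. *)
Lemma flat_le k (x : R) : 0 < x -> flat k x <= (k.+1)`!%:R * x.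
Proof.
move=> x0; rewrite /flat x0 expRN.
have y0 : 0 < x^-1 by rewrite invr_gt0.
have := expR_ge1Dxn k (ltW y0).
move=> H; have {}H : x^-1 ^+ k.+1 / (k.+1)`!%:R <= expR x^-1.
  by apply: le_trans H; rewrite lerDr.
rewrite ler_pdivrMr ?expR_gt0//.
apply: (@le_trans _ _ ((k.+1)`!%:R * x * (x^-1 ^+ k.+1 / (k.+1)`!%:R))).
  have f0 : (k.+1)`!%:R != 0 :> R by rewrite pnatr_eq0 -lt0n fact_gt0.
  rewrite exprS [leRHS](_ : _ = (x * x^-1) * ((k.+1)`!%:R / (k.+1)`!%:R) * x^-1 ^+ k); last by ring.
  by rewrite !divff ?gt_eqF// !mul1r.
by apply: ler_wpM2l => //; rewrite mulr_ge0// ltW.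
Qed.

Lemma is_derive_flat k (x : R) :
  is_derive x 1 (flat k) (- k%:R * flat k.+1 x + flat k.+2 x).
Proof.
have [x0|x0|->] := ltgtP x 0.
- apply: (@near_eq_is_derive _ _ _ (cst 0)).
    near=> y.
    have y0 : y < 0 by near: y; exact: lt_nbhsl.
    by rewrite /flat ltNge (ltW y0).
  by rewrite /flat ltNge (ltW x0) /= mulr0 addr0; exact: is_derive_cst.
- have xN0 : x != 0 by rewrite gt_eqF.
  apply: (@near_eq_is_derive _ _ _ (fun x : R => x^-1 ^+ k * expR (- x^-1))).
    near=> y.
    have y0 : 0 < y by near: y; exact: lt_nbhsr.
    by rewrite /flat y0.
  have dV : is_derive x 1 (fun y : R => y^-1) (- (x ^- 2)).
    apply: is_derive_eq; first exact: (@is_deriveV R id x 1 1 xN0 (is_derive_id x 1)).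
    by rewrite /GRing.scale /= mulr1.
  have dk : is_derive x 1 (fun y : R => y^-1 ^+ k) (- k%:R * x^-1 ^+ k.+1).
    case: k => [|k].
      by rewrite (_ : (fun _ => _) = cst 1) // oppr0 mul0r; exact: is_derive_cst.
    apply: is_derive_eq; first exact: (is_derive_powr k.+1 dV).
    by rewrite /= -exprVn !exprS; ring.
  have de : is_derive x 1 (fun y : R => expR (- y^-1)) (x ^- 2 * expR (- x^-1)).
    have dN : is_derive x 1 (fun y : R => - y^-1) (x ^- 2).
      by rewrite -(opprK (x ^- 2)); exact: is_deriveN.
    by rewrite mulrC; exact: (@is_derive1_comp R expR (fun y : R => - y^-1) x _ _ (is_derive_expR _) dN).
  apply: (is_derive_val_eq (is_derive_mulr dk de)).
  by rewrite /flat x0 /= -exprVn !exprS; ring.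
- have -> : - k%:R * flat k.+1 0 + flat k.+2 0 = 0.
    by rewrite /flat ltxx mulr0 addr0.
  (* For h > 0 the difference quotient at 0 is [flat k.+1 h], which tends to 0 by [flat_le]; for h <
     0 it vanishes. *)
  suff C : h^-1 *: (flat k (h + 0) - flat k 0) @[h --> 0^'] --> (0 : R).
    have C' : h^-1 *: ((flat k \o shift 0) (h *: 1) - flat k 0) @[h --> 0^'] --> (0 : R).
      by move: C; under eq_fun do rewrite -[X in flat k (X + _)]mulr1.
    split; first by apply/cvg_ex; exists 0.
    exact/cvg_lim.
  apply/cvgrPdist_le => e e0.
  near=> h.
  have -> : flat k 0 = 0 by rewrite /flat ltxx.
  rewrite subr0 addr0 sub0r normrN.
  have [h0|h0] := leP h 0; first by rewrite /flat ltNge h0 /= scaler0 normr0 ltW.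
  have -> : h^-1 *: flat k h = flat k.+1 h.
    by rewrite /flat h0 /GRing.scale /= exprS mulrA.
  rewrite ger0_norm ?flat_ge0//.
  apply: le_trans (flat_le _ h0) _.
  rewrite mulrC -ler_pdivlMr ?ltr0n ?fact_gt0//.
  rewrite -[h]gtr0_norm//.
  near: h; apply: dnbhs0_le.
  by rewrite divr_gt0// ltr0n fact_gt0.
Unshelve. all: by end_near. Qed.

Lemma smooth_flat k : smooth (flat k).
Proof.
apply/smoothP => n; elim: n k => [k j //|n IH] k.
apply/differentiable_uptoS; split.
  by move=> x; case: (is_derive_flat k x).
have -> : derive1 (flat k) = (fun x => cst (- k%:R) x * flat k.+1 x) \+ flat k.+2.
  by apply/funext => x; rewrite derive1E; case: (is_derive_flat k x).
apply: differentiable_uptoD => //.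
by apply: differentiable_uptoM => //; exact: differentiable_upto_cst.
Qed.

Lemma flat0_le1 x : flat 0 x <= 1.
Proof.
rewrite /flat; case: ifPn => // x0.
by rewrite expr0 mul1r expR_le1 oppr_le0 invr_ge0 ltW.
Qed.

Lemma flat0_gt0 x : (0 < flat 0 x) = (0 < x).
Proof. by rewrite /flat; case: ifPn; rewrite ?ltxx// expr0 mul1r expR_gt0. Qed.

(** Scaling by [n.+1] steepens the two edges while the support and the range [0, 1] stay fixed; the
    bumps tend pointwise to the indicator of the open interval under a fixed dominating function.
    The arguments have the form b x + c to match [smooth_affine]. *)
Definition bump (p q : R) (n : nat) (x : R) : R :=
  flat 0 (n.+1%:R * x + (- (n.+1%:R * p))) * flat 0 ((- n.+1%:R) * x + n.+1%:R * q).

Lemma smooth_bump p q n : smooth (bump p q n).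
Proof.
exact: (smoothM (@smooth_affine R (flat 0) _ _ (@smooth_flat 0))
                (@smooth_affine R (flat 0) _ _ (@smooth_flat 0))).
Qed.

Lemma bump_ge0 p q n x : 0 <= bump p q n x.
Proof. by rewrite mulr_ge0 ?flat_ge0. Qed.

Lemma bump_le1 p q n x : bump p q n x <= 1.
Proof. by rewrite mulr_ile1 ?flat_ge0 ?flat0_le1. Qed.

Lemma bump_gt0 p q n x : (0 < bump p q n x) = (p < x < q).
Proof.
rewrite /bump.
have -> : (p < x) = (0 < flat 0 (n.+1%:R * x + (- (n.+1%:R * p)))).
  by rewrite flat0_gt0 -mulrBr pmulr_rgt0 ?subr_gt0.
have -> : (x < q) = (0 < flat 0 ((- n.+1%:R) * x + n.+1%:R * q)).
  by rewrite flat0_gt0 addrC mulNr -mulrBr pmulr_rgt0 ?subr_gt0.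
have := flat_ge0 0 (n.+1%:R * x + (- (n.+1%:R * p))).
have := flat_ge0 0 ((- n.+1%:R) * x + n.+1%:R * q).
rewrite !le_eqVlt => /predU1P[<-|b0] /predU1P[<-|a0].
- by rewrite mul0r ltxx.
- by rewrite mulr0 ltxx andbF.
- by rewrite mul0r ltxx.
- by rewrite mulr_gt0// a0 b0.
Qed.

Lemma bump_eq0 p q n x : ~~ (p < x < q) -> bump p q n x = 0.
Proof.
rewrite -(bump_gt0 p q n) -leNgt => H.
by apply/eqP; rewrite eq_le H bump_ge0.
Qed.

Lemma flat0_cvg (b : R) : 0 < b -> flat 0 (n.+1%:R * b) @[n --> \oo] --> (1 : R).
Proof.
move=> b0.
have -> : (fun n : nat => flat 0 (n.+1%:R * b)) = (fun n => expR (- (b^-1 * n.+1%:R^-1))).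
  by apply/funext => n; rewrite /flat mulr_gt0// expr0 mul1r invfM mulrC.
suff : (fun n => expR (- (b^-1 * n.+1%:R^-1))) @ \oo --> expR (- (b^-1 * (0 : R))).
  by rewrite mulr0 oppr0 expR0.
apply: continuous_cvg; first exact: continuous_expR.
by apply: cvgN; apply: cvgM; [exact: cvg_cst|exact: cvg_harmonic].
Qed.

Lemma bump_cvg (p q : R) x : p < x < q -> bump p q n x @[n --> \oo] --> (1 : R).
Proof.
move=> /andP[px xq]; rewrite -(mulr1 1); apply: cvgM.
  under eq_fun do rewrite -mulrBr.
  by apply: flat0_cvg; rewrite subr_gt0.
under eq_fun do rewrite addrC mulNr -mulrBr.
by apply: flat0_cvg; rewrite subr_gt0.
Qed.

End bump.

(** * Integrals over segments; locally integrable and locally square integrable functions *)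

Section local_integrals.
Context {R : realType}.
Implicit Types (f g h : R -> R) (p q r c : R).

Local Notation mu := (@lebesgue_measure R).

Lemma ae_mono (P Q : R -> Prop) : (forall x, P x -> Q x) ->
  {ae mu, forall x, P x} -> {ae mu, forall x, Q x}.
Proof. by move=> PQ; apply: negligibleS => x /= nQ Px; apply: nQ; exact: PQ. Qed.

Lemma ae_and (P Q : R -> Prop) : {ae mu, forall x, P x} ->
  {ae mu, forall x, Q x} -> {ae mu, forall x, P x /\ Q x}.
Proof.
move=> aP aQ; apply: negligibleS (negligibleU aP aQ) => x /= nPQ.
by have [Px|] := pselect (P x); [right=> Qx; exact: nPQ|left].
Qed.

(** Equivalent to [locally_integrable setT], with segments in place of arbitrary compact sets, so
    that it serves directly as the side condition of the rules for [ii]. *)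
Definition L1loc f := measurable_fun setT f /\
  forall p q, mu.-integrable `[p, q] (EFin \o f).

(** Reversed endpoints give 0, not the opposite sign. Hence monotonicity in the interval holds
    without ordering its endpoints, while [ii_cat] needs [p <= r] and [r <= q]. *)
Definition ii p q f : R := \int[mu]_(x in `[p, q]) f x.

Lemma L1loc_meas f : L1loc f -> measurable_fun setT f.
Proof. by case. Qed.

Lemma L1loc_dom g f : measurable_fun setT f -> L1loc g ->
  (forall x, `|f x| <= g x) -> L1loc f.
Proof.
move=> mf [mg ig] fg; split => // p q.
apply: (@le_integrable _ _ _ mu _ _ _ (EFin \o g)) => //.
- by apply/measurable_EFinP; exact: measurable_funTS.
- by move=> x _ /=; rewrite lee_fin (le_trans (fg x))// ler_norm.
Qed.

Lemma eq_L1loc f g : f =1 g -> L1loc f -> L1loc g.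
Proof. by move=> /funext ->. Qed.

Lemma L1locD f g : L1loc f -> L1loc g -> L1loc (fun x => f x + g x).
Proof.
move=> [mf If] [mg Ig]; split; first exact: measurable_funD.
move=> p q; exact: (integrableD _ (If p q) (Ig p q)).
Qed.

Lemma L1locZ c f : L1loc f -> L1loc (fun x => c * f x).
Proof.
move=> [mf If]; split; first exact: measurable_funM.
move=> p q; exact: (@integrableZl _ _ _ mu `[p, q]%classic (measurable_itv _) c _ (If p q)).
Qed.

Lemma L1locN f : L1loc f -> L1loc (fun x => - f x).
Proof. by move=> /(L1locZ (-1)); apply: eq_L1loc => x; rewrite mulN1r. Qed.

Lemma L1locB f g : L1loc f -> L1loc g -> L1loc (fun x => f x - g x).
Proof. by move=> If /L1locN Ig; exact: L1locD. Qed.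

Lemma L1loc_norm f : L1loc f -> L1loc (fun x => `|f x|).
Proof.
move=> [mf If]; split; first exact: measurableT_comp.
by move=> p q; have /integrable_abse := If p q.
Qed.

Lemma L1loc_continuous f : continuous f -> L1loc f.
Proof.
move=> cf; split; first exact: continuous_measurable_fun.
move=> p q; apply: continuous_compact_integrable; first exact: segment_compact.
exact: continuous_subspaceT.
Qed.

Lemma L1loc_cst c : L1loc (fun=> c).
Proof. by apply: L1loc_continuous => x; exact: cvg_cst. Qed.

Lemma L1loc_indic (A : set R) f : measurable A -> L1loc f ->
  L1loc (fun x => f x * \1_A x).
Proof.
move=> mA If; apply: (L1loc_dom _ (L1loc_norm If)).
  by apply: measurable_funM => //; case: If.
by move=> x; rewrite normrM ler_piMr// indicE; case: (x \in A); rewrite ?normr1 ?normr0 ?ler01.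
Qed.

Lemma iiD p q f g : L1loc f -> L1loc g ->
  ii p q (fun x => f x + g x) = ii p q f + ii p q g.
Proof. by move=> [_ If] [_ Ig]; rewrite /ii RintegralD. Qed.

Lemma iiB p q f g : L1loc f -> L1loc g ->
  ii p q (fun x => f x - g x) = ii p q f - ii p q g.
Proof. by move=> [_ If] [_ Ig]; rewrite /ii RintegralB. Qed.

Lemma iiZ p q c f : L1loc f -> ii p q (fun x => c * f x) = c * ii p q f.
Proof. by move=> [_ If]; rewrite /ii RintegralZl. Qed.

Lemma iiN p q f : L1loc f -> ii p q (fun x => - f x) = - ii p q f.
Proof. by move=> If; rewrite -mulN1r -iiZ//; congr ii; apply/funext => x; rewrite mulN1r. Qed.

Lemma eq_ii p q f g : (forall x, p <= x <= q -> f x = g x) -> ii p q f = ii p q g.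
Proof.
move=> fg; apply: eq_Rintegral => x; rewrite inE/= in_itv/= => H; exact: fg.
Qed.

Lemma ii_ge0 p q f : (forall x, p <= x <= q -> 0 <= f x) -> 0 <= ii p q f.
Proof. by move=> f0; apply: Rintegral_ge0 => x /=; rewrite in_itv/=; exact: f0. Qed.

Lemma le_ii p q f g : L1loc f -> L1loc g ->
  (forall x, p <= x <= q -> f x <= g x) -> ii p q f <= ii p q g.
Proof.
move=> [_ If] [_ Ig] fg; apply: le_Rintegral => // x /=.
Qed.

Lemma ae_eq_ii_in p q f g : measurable_fun setT f -> measurable_fun setT g ->
  {ae mu, forall x, p <= x <= q -> f x = g x} -> ii p q f = ii p q g.
Proof.
move=> mf mg fg; rewrite /ii /Rintegral; congr fine.
apply: ae_eq_integral => //; try by apply/measurable_EFinP; exact: measurable_funTS.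
by apply: ae_mono fg => x /= H; rewrite in_itv/= => /H ->.
Qed.

Lemma L1loc_max f g : L1loc f -> L1loc g -> L1loc (fun x => Num.max (f x) (g x)).
Proof.
move=> If Ig; apply: (@L1loc_dom (fun x => `|f x| + `|g x|)).
- by apply: measurable_maxr; [case: If|case: Ig].
- by apply: L1locD; exact: L1loc_norm.
- by move=> x; rewrite /Order.max; case: ifP => _; rewrite (lerDl, lerDr).
Qed.

(** Replacing [g] by max(f, g), which agrees with it almost everywhere on the segment, turns an
    inequality up to a null set into a pointwise one. *)
Lemma ae_le_ii p q f g : L1loc f -> L1loc g ->
  {ae mu, forall x, p <= x <= q -> f x <= g x} -> ii p q f <= ii p q g.
Proof.
move=> If Ig fg; have Im := L1loc_max If Ig.
have -> : ii p q g = ii p q (fun x => Num.max (f x) (g x)).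
  apply: ae_eq_ii_in; [by case: Ig|by case: Im|].
  by apply: ae_mono fg => x /= H /H fgx; rewrite max_r.
by apply: le_ii => // x _; rewrite le_max lexx.
Qed.

Lemma le_norm_ii p q f : L1loc f -> `|ii p q f| <= ii p q (fun x => `|f x|).
Proof. by move=> [_ If]; exact: le_normr_Rintegral. Qed.

Lemma ii_cst p q c : p <= q -> ii p q (fun=> c) = c * (q - p).
Proof.
move=> pq; rewrite /ii Rintegral_cst//= lebesgue_measure_itv/= lte_fin.
move: pq; rewrite le_eqVlt => /predU1P[->|->]; first by rewrite ltxx subrr.
by rewrite -EFinD.
Qed.

Lemma ii_empty p q f : q <= p -> ii p q f = 0.
Proof.
rewrite le_eqVlt => /predU1P[->|pq].
  by rewrite /ii set_itv1 Rintegral_set1.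
by rewrite /ii set_itv_ge ?Rintegral_set0// bnd_simp -ltNge.
Qed.

Lemma ii_cat r p q f : L1loc f -> p <= r -> r <= q ->
  ii p q f = ii p r f + ii r q f.
Proof.
move=> [_ If] pr rq; apply/eqP; rewrite addrC -subr_eq; apply/eqP.
rewrite /ii Rintegral_itvB ?bnd_simp//.
rewrite Rintegral_itv_obnd_cbnd//; apply: integrableS (If r q) => //.
by apply: subset_itvr; rewrite bnd_simp.
Qed.

Lemma ii_subset p q p' q' f : L1loc f -> (forall x, 0 <= f x) ->
  p' <= p -> q <= q' -> ii p q f <= ii p' q' f.
Proof.
move=> If f0 pp qq; have [pq|qp] := leP p q; last first.
  by rewrite (ii_empty _ (ltW qp)) ii_ge0.
rewrite (ii_cat If pp (le_trans pq qq)) (ii_cat If pq qq) addrCA lerDl.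
by rewrite addr_ge0// ii_ge0.
Qed.

Lemma measurable_fun_shift f c : measurable_fun setT f ->
  measurable_fun setT (fun x : R => f (x + c)).
Proof.
move=> mf; apply: (measurableT_comp mf).
by apply: measurable_funD => //; exact: measurable_cst.
Qed.

(** The image measure agrees with Lebesgue measure on half-open intervals, hence on all measurable
    sets by uniqueness. *)
Lemma lebesgue_measure_shift c (A : set R) : measurable A ->
  mu ((fun x => x + c) @^-1` A) = mu A.
Proof.
move=> mA.
have mc : measurable_fun setT (fun x : measurableTypeR R => x + c : measurableTypeR R).
  by apply: measurable_funD => //; exact: measurable_cst.
pose phi : {mfun measurableTypeR R >-> measurableTypeR R} :=
  HB.pack (fun x : measurableTypeR R => x + c : measurableTypeR R) (isMeasurableFun.Build _ _ _ _ _ mc).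
pose nu := pushforward mu phi.
have nuE : forall X, ocitv X -> mu X = nu X.
  move=> X [[a b] _ <-]; rewrite /nu /pushforward /=.
  have -> : (fun x => x + c) @^-1` `]a, b] = `]a - c, b - c]%classic.
    by apply/seteqP; split => x /=; rewrite !in_itv/= ltrBlDr lerBrDr.
  rewrite !lebesgue_measure_itv/= !lte_fin ltrD2r; case: ifP => // _.
  by rewrite -!EFinD; congr (_%:E); ring.
by rewrite (@lebesgue_measure_unique R nu nuE A mA).
Qed.

Lemma integral_shift p q c (f : R -> \bar R) : measurable_fun setT f ->
  (forall x, 0 <= f x)%E ->
  (\int[mu]_(x in `[p, q]) f (x + c)%R = \int[mu]_(x in `[(p + c)%R, (q + c)%R]) f x)%E.
Proof.
move=> mf f0.
have mc : measurable_fun setT (fun x : measurableTypeR R => x + c : measurableTypeR R).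
  by apply: measurable_funD => //; exact: measurable_cst.
pose phi : {mfun measurableTypeR R >-> measurableTypeR R} :=
  HB.pack (fun x : measurableTypeR R => x + c : measurableTypeR R) (isMeasurableFun.Build _ _ _ _ _ mc).
have := @ge0_integral_pushforward _ _ _ _ R phi mc mu `[p + c, q + c]%classic f (measurable_itv _) (measurable_funTS mf) (fun y _ => f0 y).
have -> : phi @^-1` `[p + c, q + c] = `[p, q]%classic.
  by apply/seteqP; split => x /=; rewrite !in_itv/= !lerD2r.
move=> <-; apply: eq_measure_integral => A mA _.
by rewrite /pushforward; exact: (lebesgue_measure_shift c mA).
Qed.

Lemma L1loc_shift f c : L1loc f -> L1loc (fun x => f (x + c)).
Proof.
move=> [mf If]; split; first exact: measurable_fun_shift.
move=> p q; apply/integrableP; split.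
  by apply/measurable_EFinP/measurable_funTS; exact: measurable_fun_shift.
have /integrableP[_] := If (p + c) (q + c).
rewrite -(@integral_shift p q c (fun x => `|(f x)%:E|)%E)//.
by apply: measurableT_comp => //; exact/measurable_EFinP.
Qed.

Lemma ii_shift p q c f : L1loc f ->
  ii p q (fun x => f (x + c)) = ii (p + c) (q + c) f.
Proof.
move=> If; have [mf _] := If.
have H g : L1loc g -> (forall x, 0 <= g x) ->
    ii p q (fun x => g (x + c)) = ii (p + c) (q + c) g.
  move=> [mg _] g0; rewrite /ii /Rintegral; congr fine.
  by apply: (@integral_shift p q c (EFin \o g)) => //; exact/measurable_EFinP.
(* The change of variables is known for nonnegative integrands; [f] is the difference of the
   nonnegative functions |f| + f and |f|. *)
have Ip : L1loc (fun x => `|f x| + f x) by apply: L1locD => //; exact: L1loc_norm.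
have In := L1loc_norm If.
have E g : f =1 (fun x => (`|f x| + f x) - `|f x|) by move=> x; ring.
have Ep := H _ Ip; have En := H _ In.
have -> : ii p q (fun x => f (x + c)) =
    ii p q (fun x => (`|f (x + c)| + f (x + c)) - `|f (x + c)|).
  by apply: eq_ii => x _; ring.
have -> : ii (p + c) (q + c) f = ii (p + c) (q + c) (fun x => (`|f x| + f x) - `|f x|).
  by apply: eq_ii => x _; ring.
rewrite !iiB //; first last.
- exact: (L1loc_shift _ In).
- exact: (L1loc_shift _ Ip).
rewrite Ep ?En// => x; by rewrite -lerBlDr sub0r -normrN ler_norm.
Qed.

Definition L2loc f := measurable_fun setT f /\ L1loc (fun x => f x ^+ 2).

Lemma L2loc_meas f : L2loc f -> measurable_fun setT f.
Proof. by case. Qed.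

Lemma L2loc_sqr f : L2loc f -> L1loc (fun x => f x ^+ 2).
Proof. by case. Qed.

Lemma eq_L2loc f g : f =1 g -> L2loc f -> L2loc g.
Proof. by move=> /funext ->. Qed.

Lemma L2loc_mul f g : L2loc f -> L2loc g -> L1loc (fun x => f x * g x).
Proof.
move=> [mf If] [mg Ig]; apply: (L1loc_dom _ (L1locD If Ig)).
  exact: measurable_funM.
move=> x; rewrite ler_norml; have := sqr_ge0 (f x - g x); have := sqr_ge0 (f x + g x).
by move=> ? ?; apply/andP; split; nra.
Qed.

Lemma L2locD f g : L2loc f -> L2loc g -> L2loc (fun x => f x + g x).
Proof.
move=> If Ig; split; first by apply: measurable_funD; exact: L2loc_meas.
have := L1locD (L1locD (L2loc_sqr If) (L1locZ 2 (L2loc_mul If Ig))) (L2loc_sqr Ig).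
by apply: eq_L1loc => x; ring.
Qed.

Lemma L2locZ c f : L2loc f -> L2loc (fun x => c * f x).
Proof.
move=> If; split; first by apply: measurable_funM => //; exact: L2loc_meas.
by have := L1locZ (c ^+ 2) (L2loc_sqr If); apply: eq_L1loc => x; ring.
Qed.

Lemma L2locN f : L2loc f -> L2loc (fun x => - f x).
Proof. by move=> /(L2locZ (-1)); apply: eq_L2loc => x; ring. Qed.

Lemma L2locB f g : L2loc f -> L2loc g -> L2loc (fun x => f x - g x).
Proof. by move=> If /L2locN; exact: L2locD. Qed.

Lemma L2loc_continuous f : continuous f -> L2loc f.
Proof.
move=> cf; split; first exact: continuous_measurable_fun.
by apply: L1loc_continuous => x; apply: (cvgM (cf x) (cf x)).
Qed.

Lemma L2loc_shift f c : L2loc f -> L2loc (fun x => f (x + c)).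
Proof.
move=> [mf If]; split; first exact: measurable_fun_shift.
exact: (L1loc_shift c If).
Qed.

Lemma L2loc_L1loc f : L2loc f -> L1loc f.
Proof.
move=> If; have C1 : L2loc (fun=> 1) by apply: L2loc_continuous => x; exact: cvg_cst.
by have := L2loc_mul If C1; apply: eq_L1loc => x; rewrite mulr1.
Qed.

(** Young's inequality with a free weight: the expansions below take [e] proportional to the time
    step, while the value 1 meets the form of [ii_sqr_le_test]. *)
Lemma ii_amgm p q e f g : 0 < e -> L2loc f -> L2loc g ->
  ii p q (fun x => f x * g x) <=
  e / 2 * ii p q (fun x => f x ^+ 2) + (2 * e)^-1 * ii p q (fun x => g x ^+ 2).
Proof.
move=> e0 If Ig; rewrite -!iiZ; [|exact: L2loc_sqr..].
rewrite -iiD; [|by apply: L1locZ; exact: L2loc_sqr..].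
apply: le_ii; first exact: L2loc_mul.
  by apply: L1locD; apply: L1locZ; exact: L2loc_sqr.
move=> x _; rewrite -subr_ge0.
have -> : e / 2 * f x ^+ 2 + (2 * e)^-1 * g x ^+ 2 - f x * g x =
  e / 2 * (f x - e^-1 * g x) ^+ 2 by field; rewrite gt_eqF.
by rewrite mulr_ge0 ?sqr_ge0// divr_ge0// ltW.
Qed.

Lemma ii_sqrD p q f g : L2loc f -> L2loc g ->
  ii p q (fun x => (f x + g x) ^+ 2) <=
  2 * ii p q (fun x => f x ^+ 2) + 2 * ii p q (fun x => g x ^+ 2).
Proof.
move=> If Ig; rewrite -!iiZ; [|exact: L2loc_sqr..].
rewrite -iiD; [|by apply: L1locZ; exact: L2loc_sqr..].
apply: le_ii; first exact: (L2loc_sqr (L2locD If Ig)).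
  by apply: L1locD; apply: L1locZ; exact: L2loc_sqr.
by move=> x _; have := sqr_ge0 (f x - g x); nra.
Qed.

Lemma ii_sqr_ge0 p q f : 0 <= ii p q (fun x => f x ^+ 2).
Proof. by apply: ii_ge0 => x _; exact: sqr_ge0. Qed.

(** With L the length, m the integral of [f] and S that of its square, the integral of (L f - m)^2
    equals L (L S - m^2) and is nonnegative. *)
Lemma ii_cauchy p q f : p <= q -> L2loc f ->
  ii p q f ^+ 2 <= (q - p) * ii p q (fun x => f x ^+ 2).
Proof.
move=> pq If; have I1 := L2loc_L1loc If; have I2 := L2loc_sqr If.
set m := ii p q f; set S := ii p q _; set L := q - p.
have L0 : 0 <= L by rewrite subr_ge0.
have : 0 <= ii p q (fun x => (L * f x - m) ^+ 2) by exact: ii_sqr_ge0.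
have -> : ii p q (fun x => (L * f x - m) ^+ 2) =
    ii p q (fun x => L ^+ 2 * f x ^+ 2 + ((- 2 * L * m) * f x + m ^+ 2)).
  by apply: eq_ii => x _; ring.
have I3 := L1locZ (- 2 * L * m) I1.
rewrite iiD; [|exact: L1locZ|exact: (L1locD I3 (L1loc_cst _))].
rewrite iiD //; last exact: L1loc_cst.
rewrite ii_cst // (iiZ _ _ _ I2) (iiZ _ _ _ I1) -/m -/S -/L.
have -> : L ^+ 2 * S + (- 2 * L * m * m + m ^+ 2 * L) = L * (L * S - m ^+ 2) by ring.
move: L0; rewrite le_eqVlt => /predU1P[L0 _|L0].
  rewrite -L0 mul0r /m ii_empty; first by rewrite expr0n.
  by rewrite -subr_ge0 -opprB -/L -L0 oppr0.
by rewrite pmulr_rge0// subr_ge0.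
Qed.

End local_integrals.

(** * Passage to the limit under the integral *)

Section limits.
Context {R : realType}.
Implicit Types (f g h : R -> R) (p q r c : R).

Local Notation mu := (@lebesgue_measure R).

Lemma EFin_ii p q f : L1loc f ->
  (ii p q f)%:E = (\int[mu]_(x in `[p, q]) (f x)%:E)%E.
Proof.
move=> [_ If]; rewrite /ii /Rintegral fineK//.
have H := If p q; exact: integrable_fin_num.
Qed.

Lemma ii_dominated p q (f_ : nat -> R -> R) f g :
  (forall n, measurable_fun setT (f_ n)) -> measurable_fun setT f -> L1loc g ->
  {ae mu, forall x, p <= x <= q -> f_ n x @[n --> \oo] --> f x} ->
  (forall n x, p <= x <= q -> `|f_ n x| <= g x) ->
  ii p q (f_ n) @[n --> \oo] --> ii p q f.
Proof.
move=> mf_ mf [_ Ig] cf bf.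
have [|||||H1 _ H2] := @dominated_convergence _ _ _ mu `[p, q]%classic (measurable_itv _)
  (fun n => EFin \o f_ n) (EFin \o f) (EFin \o g).
- by move=> n; apply/measurable_EFinP; apply: measurable_funTS; exact: mf_.
- by apply/measurable_EFinP; exact: measurable_funTS.
- apply: ae_mono cf => x /=; rewrite in_itv/= => H xpq.
  by apply: cvg_EFin; [exact: nearW|exact: H].
- exact: Ig.
- apply: aeW => x n /=; rewrite in_itv/= => xpq.
  by rewrite lee_fin; exact: bf.
apply: fine_cvg; rewrite /ii /Rintegral fineK //.
exact: integrable_fin_num.
Qed.

(** Serves where no dominating function is at hand: the squared averages of an L2 function over
    finer and finer partitions. *)
Lemma ii_fatou p q (f_ : nat -> R -> R) f (A : R) :
  (forall n, L1loc (f_ n)) -> (forall n x, 0 <= f_ n x) -> L1loc f ->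
  {ae mu, forall x, p <= x <= q -> f_ n x @[n --> \oo] --> f x} ->
  (forall n, ii p q (f_ n) <= A) -> ii p q f <= A.
Proof.
move=> If_ f0 If cf fA; have [mf If'] := If.
have Hn n : (\int[mu]_(x in `[p, q]) (f_ n x)%:E <= A%:E)%E.
  by rewrite -EFin_ii// lee_fin; exact: fA.
have := @fatou _ _ _ mu `[p, q]%classic (measurable_itv _) (fun n => EFin \o f_ n) _ _.
move=> /(_ (fun n => (measurable_EFinP _ _).2 (measurable_funTS (L1loc_meas (If_ n))))).
move=> /(_ (fun n x _ => f0 n x)) H.
have E : (\int[mu]_(x in `[p, q]) (f x)%:E =
    \int[mu]_(x in `[p, q]) limn_einf (fun n => (EFin \o f_ n) x))%E.
  apply: ae_eq_integral => //.
  - by apply/measurable_EFinP; exact: measurable_funTS.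
  - rewrite /limn_einf; apply: measurableT_comp => //.
    apply: (measurable_fun_limn_esup (f := fun n => (\- (EFin \o f_ n))%E)) => n.
    apply: measurableT_comp => //.
    by apply/measurable_EFinP; apply: measurable_funTS; exact: L1loc_meas.
  - apply: ae_mono cf => x /=; rewrite in_itv/= => Hx xpq.
    have C : (EFin \o f_ n) x @[n --> \oo] --> (f x)%:E.
      by apply: cvg_EFin; [exact: nearW|exact: Hx].
    rewrite is_cvg_limn_einfE; last by apply/cvg_ex; eexists; exact: C.
    by apply/esym/cvg_lim.
rewrite -lee_fin EFin_ii// E.
apply: le_trans H _.
rewrite limn_einf_lim; apply: lime_le; first exact: is_cvg_einfs.
apply: nearW => n; apply: le_trans (Hn n).
by apply: ereal_inf_lbound; exists n => /=.
Qed.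

Lemma ae_neq c : {ae mu, forall x, x != c}.
Proof.
have N : mu.-negligible [set c].
  by apply/negligibleP; [exact: measurable_set1|exact: lebesgue_measure_set1].
by apply: negligibleS N => x /= /negP; rewrite negbK => /eqP.
Qed.

Lemma ii_bump_cvg p q h : L1loc h ->
  ii p q (fun x => h x * bump p q n x) @[n --> \oo] --> ii p q h.
Proof.
move=> Ih.
have mb n : measurable_fun setT (@bump R p q n).
  apply: continuous_measurable_fun; apply: smooth_continuous.
  exact: smooth_bump.
apply: (@ii_dominated _ _ _ _ (fun x => `|h x|)).
- by move=> n; apply: measurable_funM => //; case: Ih.
- by case: Ih.
- exact: L1loc_norm.
- apply: ae_mono (ae_and (ae_neq p) (ae_neq q)) => x [xp xq] /andP[px qx].
  rewrite -[X in _ --> X]mulr1; apply: cvgM; first exact: cvg_cst.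
  by apply: bump_cvg; rewrite !lt_neqAle px qx xq eq_sym xp.
- move=> n x _; rewrite normrM ler_piMr//.
  by rewrite ger0_norm ?bump_ge0 ?bump_le1.
Qed.

Lemma ii_support p q p' q' f : L1loc f -> p <= p' -> q' <= q ->
  (forall x, ~~ (p' < x < q') -> f x = 0) -> ii p q f = ii p' q' f.
Proof.
move=> If pp qq f0.
have Z u v : (forall x, u <= x <= v -> ~~ (p' < x < q')) -> ii u v f = 0.
  move=> H; rewrite (@eq_ii R u v f (fun=> 0 * 0)); last first.
    by move=> x /H /f0 ->; rewrite mulr0.
  by rewrite iiZ ?mul0r//; exact: L1loc_cst.
have [pq|qp] := leP p' q'.
  rewrite (ii_cat If pp (le_trans pq qq)) (ii_cat If pq qq).
  rewrite (Z p p') ?add0r ?(Z q' q) ?addr0//.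
    by move=> x /andP[H _]; rewrite negb_and -!leNgt H orbT.
  by move=> x /andP[_ H]; rewrite negb_and -!leNgt H.
rewrite (ii_empty _ (ltW qp)) Z// => x _.
by apply/negP => /andP[H1 H2]; have := lt_trans H1 H2; rewrite ltNge (ltW qp).
Qed.

End limits.

(** * Test functions adapted to a partition *)

Section partition.
Context {R : realType}.
Implicit Types (f g h : R -> R) (p q r c : R).

Local Notation mu := (@lebesgue_measure R).

Lemma iiM_bump_sum p q N (c : nat -> R) (b : nat -> R -> R) h :
  L2loc h -> (forall i, L2loc (b i)) ->
  ii p q (fun x => h x * \sum_(i < N) c i * b i x) =
  \sum_(i < N) c i * ii p q (fun x => h x * b i x) /\
  L2loc (fun x => \sum_(i < N) c i * b i x).
Proof.
move=> Ih Ib; elim: N => [|N [IH1 IH2]].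
  rewrite big_ord0; split.
    rewrite (@eq_ii R p q _ (fun=> 0 * 0)).
      by rewrite iiZ ?mul0r//; exact: L1loc_cst.
    by move=> x _; rewrite big_ord0 !mulr0.
  apply: (@eq_L2loc R (fun=> 0)); first by move=> x; rewrite big_ord0.
  by apply: L2loc_continuous => x; exact: cvg_cst.
split.
  rewrite big_ord_recr /= -IH1 -iiZ; last exact: L2loc_mul.
  rewrite -iiD; [|exact: L2loc_mul|by apply: L1locZ; exact: L2loc_mul].
  by apply: eq_ii => x _; rewrite big_ord_recr /=; ring.
apply: (@eq_L2loc R (fun x => \sum_(i < N) c i * b i x + c N * b N x)).
  by move=> x; rewrite big_ord_recr.
by apply: L2locD => //; exact: L2locZ.
Qed.

Lemma sqr_sum_disjoint N (f : nat -> R) :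
  (forall i j, (i < N)%N -> (j < N)%N -> i != j -> f i * f j = 0) ->
  (\sum_(i < N) f i) ^+ 2 = \sum_(i < N) f i ^+ 2.
Proof.
move=> f0; rewrite expr2 big_distrl /=; apply: eq_bigr => i _.
rewrite big_distrr /= (bigD1 i)//= big1 ?addr0 -?expr2// => j ji.
by apply: f0 => //; rewrite eq_sym.
Qed.

Lemma smooth_sum N (c : nat -> R) (b : nat -> R -> R) :
  (forall i, smooth (b i)) -> smooth (fun x => \sum_(i < N) c i * b i x).
Proof.
move=> sb; elim: N => [|N IH].
  have -> : (fun x => \sum_(i < 0) c i * b i x) = cst 0.
    by apply/funext => x; rewrite big_ord0.
  exact: smooth_cst.
have -> : (fun x => \sum_(i < N.+1) c i * b i x) =
    (fun x => \sum_(i < N) c i * b i x) \+ (fun x => cst (c N) x * b N x).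
  by apply/funext => x; rewrite big_ord_recr.
exact: (smoothD IH (smoothM (@smooth_cst R (c N)) (sb N))).
Qed.

Lemma cvgn_sum N (u : nat -> nat -> R) (l : nat -> R) :
  (forall i, (i < N)%N -> u i n @[n --> \oo] --> l i) ->
  \sum_(i < N) u i n @[n --> \oo] --> \sum_(i < N) l i.
Proof.
elim: N => [|N IH] H.
  by under eq_fun do rewrite big_ord0; rewrite big_ord0; exact: cvg_cst.
under eq_fun do rewrite big_ord_recr; rewrite big_ord_recr /=.
by apply: cvgD; [apply: IH => i iN; apply: H; rewrite ltnS ltnW|exact: H].
Qed.

Lemma L2loc_bump p q n : L2loc (@bump R p q n).
Proof. by apply: L2loc_continuous; apply: smooth_continuous; exact: smooth_bump. Qed.

Lemma ii_partition p d N f : L1loc f -> 0 <= d ->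
  ii p (p + N%:R * d) f =
  \sum_(i < N) ii (p + i%:R * d) (p + i.+1%:R * d) f.
Proof.
move=> If d0; elim: N => [|N IH]; first by rewrite big_ord0 mul0r addr0 ii_empty.
rewrite big_ord_recr /= -IH; apply: ii_cat => //.
  by rewrite lerDl mulr_ge0.
by rewrite lerD2l ler_wpM2r// ler_nat.
Qed.

(** The test function is the sum of c_i times the bump on cell i. Bumps on different cells have
    disjoint supports, so its square integral is at most the sum of c_i^2 d; as the bumps sharpen,
    its pairing with [h] tends to the left-hand side. *)
Lemma partition_test_le p d N h (A : R) (c : nat -> R) : 0 < d -> L2loc h ->
  (forall phi, test_function phi ->
     (forall x, ~~ (p < x < p + N%:R * d) -> phi x = 0) ->
     ii p (p + N%:R * d) (fun x => h x * phi x) <=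
     A / 2 + ii p (p + N%:R * d) (fun x => phi x ^+ 2) / 2) ->
  \sum_(i < N) c i * ii (p + i%:R * d) (p + i.+1%:R * d) h <=
  A / 2 + (\sum_(i < N) c i ^+ 2 * d) / 2.
Proof.
move=> d0 Ih H; pose P i := p + i%:R * d; rewrite -/(P N) in H.
pose b n i := @bump R (P i) (P i.+1) n.
have PS i : P i <= P i.+1 by rewrite lerD2l ler_wpM2r// ?ler_nat// ltW.
have Pm i j : (i <= j)%N -> P i <= P j.
  by move=> ij; rewrite lerD2l ler_wpM2r// ?ler_nat// ltW.
have P0 : P 0 = p by rewrite /P mul0r addr0.
have Ib n i : L2loc (b n i) by exact: L2loc_bump.
have b0 n i x : ~~ (P i < x < P i.+1) -> b n i x = 0 by exact: bump_eq0.
have key n : \sum_(i < N) c i * ii p (P N) (fun x => h x * b n i x) <=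
    A / 2 + (\sum_(i < N) c i ^+ 2 * d) / 2.
  have [<- I2] := iiM_bump_sum p (P N) N c Ih (Ib n).
  apply: le_trans (H _ _ _) _.
  - split; first by apply: smooth_sum => i; exact: smooth_bump.
    exists (`|p| + `|P N|) => x Hx; apply: big1 => i _.
    rewrite b0 ?mulr0//; apply/negP => /andP[x1 x2].
    move: Hx; rewrite ltNge => /negP; apply.
    have {}x1 : p < x by rewrite -P0 (le_lt_trans _ x1)// Pm.
    have {}x2 : x < P N by rewrite (lt_le_trans x2)// Pm.
    by rewrite ler_norml; apply/andP; split;
      have := ler_norm (- p); have := ler_norm (P N); have := normr_ge0 p;
      have := normr_ge0 (P N); rewrite normrN; lra.
  - move=> x Hx; apply: big1 => i _; rewrite b0 ?mulr0//.
    apply: contra Hx => /andP[x1 x2].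
    by rewrite -{1}P0 (le_lt_trans _ x1) ?Pm//= (lt_le_trans x2)// Pm.
  - rewrite lerD2l ler_wpM2r ?invr_ge0//.
    have E : ii p (P N) (fun x => (\sum_(i < N) c i * b n i x) ^+ 2) =
        ii p (P N) (fun x => \sum_(i < N) c i ^+ 2 * b n i x ^+ 2).
      apply: eq_ii => x _; rewrite (@sqr_sum_disjoint N (fun i => c i * b n i x)).
        by apply: eq_bigr => i _; rewrite exprMn.
      move=> i j iN jN ij.
      have [bi|/b0 ->] := boolP (P i < x < P i.+1); last by rewrite mulr0 mul0r.
      have [bj|/b0 ->] := boolP (P j < x < P j.+1); last by rewrite !mulr0.
      exfalso; move: bi bj => /andP[i1 i2] /andP[j1 j2].
      move: ij; rewrite neq_ltn => /orP[ij|ij].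
        by have := lt_le_trans i2 (Pm _ _ ij); rewrite ltNge (ltW j1).
      by have := lt_le_trans j2 (Pm _ _ ij); rewrite ltNge (ltW i1).
    rewrite E {E}.
    have I1 i : L1loc (fun x => b n i x ^+ 2) by exact: L2loc_sqr.
    have E M : ii p (P N) (fun x => \sum_(i < M) c i ^+ 2 * b n i x ^+ 2) =
        \sum_(i < M) c i ^+ 2 * ii p (P N) (fun x => b n i x ^+ 2) /\
        L1loc (fun x => \sum_(i < M) c i ^+ 2 * b n i x ^+ 2).
      elim: M => [|M [IH1 IH2]].
        rewrite big_ord0; split.
          rewrite (@eq_ii R _ _ _ (fun=> 0 * 0)).
            by rewrite iiZ ?mul0r//; exact: L1loc_cst.
          by move=> x _; rewrite big_ord0 mulr0.
        apply: (@eq_L1loc R (fun=> 0)); first by move=> x; rewrite big_ord0.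
        exact: L1loc_cst.
      split.
        rewrite big_ord_recr /= -IH1 -iiZ// -iiD//; last exact: L1locZ.
        by apply: eq_ii => x _; rewrite big_ord_recr.
      apply: (@eq_L1loc R (fun x => \sum_(i < M) c i ^+ 2 * b n i x ^+ 2
                            + c M ^+ 2 * b n M x ^+ 2)).
        by move=> x; rewrite big_ord_recr.
      by apply: L1locD => //; exact: L1locZ.
    rewrite (E N).1; apply: ler_sum => i _; rewrite ler_wpM2l ?sqr_ge0//.
    rewrite (@ii_support R p (P N) (P i) (P i.+1)) //; last 3 first.
    + by rewrite -{1}P0 Pm.
    + by rewrite Pm.
    + by move=> x /b0 ->; rewrite expr0n.
    have -> : d = 1 * (P i.+1 - P i) by rewrite /P -[i.+1%:R]natr1; ring.
    rewrite -ii_cst//; apply: le_ii => //; first exact: L1loc_cst.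
    by move=> x _; rewrite expr_le1// ?bump_ge0 ?bump_le1.
have C : \sum_(i < N) c i * ii p (P N) (fun x => h x * b n i x) @[n --> \oo] -->
    \sum_(i < N) c i * ii (P i) (P i.+1) h.
  apply: (@cvgn_sum N (fun i n => c i * ii p (P N) (fun x => h x * b n i x))
    (fun i => c i * ii (P i) (P i.+1) h)) => i iN.
  apply: cvgM; first exact: cvg_cst.
  under eq_fun => n.
    rewrite (@ii_support R p (P N) (P i) (P i.+1)); last 4 first.
    - exact: L2loc_mul.
    - by rewrite -{1}P0 Pm.
    - by rewrite Pm.
    - by move=> x /b0 ->; rewrite mulr0.
    over.
  by apply: ii_bump_cvg; exact: L2loc_L1loc.
rewrite -(cvg_lim _ C) //; apply: limr_le; first by apply/cvg_ex; eexists; exact: C.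
exact: nearW.
Qed.

(** Taking c_i to be the mean of [h] on cell i makes both sums of [partition_test_le] equal to the
    same S, and S <= A/2 + S/2 gives S <= A. *)
Lemma partition_average_le p d N h (A : R) : 0 < d -> L2loc h ->
  (forall phi, test_function phi ->
     (forall x, ~~ (p < x < p + N%:R * d) -> phi x = 0) ->
     ii p (p + N%:R * d) (fun x => h x * phi x) <=
     A / 2 + ii p (p + N%:R * d) (fun x => phi x ^+ 2) / 2) ->
  \sum_(i < N) (ii (p + i%:R * d) (p + i.+1%:R * d) h) ^+ 2 / d <= A.
Proof.
move=> d0 Ih H.
have := partition_test_le (fun i => ii (p + i%:R * d) (p + i.+1%:R * d) h / d) d0 Ih H.
set S := \sum_(i < N) _ / d.
have -> : \sum_(i < N) ii (p + i%:R * d) (p + i.+1%:R * d) h / d *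
    ii (p + i%:R * d) (p + i.+1%:R * d) h = S.
  by apply: eq_bigr => i _; ring.
have -> : \sum_(i < N) (ii (p + i%:R * d) (p + i.+1%:R * d) h / d) ^+ 2 * d = S.
  by apply: eq_bigr => i _; field; rewrite gt_eqF.
by move=> ?; lra.
Qed.

End partition.

(** * From averages and pairings back to L2 norms *)

Section averages.
Context {R : realType}.
Implicit Types (f g h : R -> R) (p q r c : R).

Local Notation mu := (@lebesgue_measure R).

Lemma L1loc_locally_integrable f : L1loc f <-> locally_integrable setT f.
Proof.
split=> [[mf If]|[mf _ If]].
  split=> //; first exact: openT.
  move=> K _ cK; have [M [Mr HM]] := compact_bounded cK.
  have KM : K `<=` `[- (M + 1), M + 1]%classic.
    move=> x /HM; move=> /(_ (M + 1)); rewrite ltrDl ltr01 => /(_ isT) /=.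
    by rewrite in_itv/= ler_norml.
  have /integrableP[mM IM] := If (- (M + 1)) (M + 1).
  apply: le_lt_trans IM; apply: ge0_subset_integral => //.
  - exact: compact_measurable.
  - apply/measurable_EFinP; apply: measurableT_comp => //; exact: measurable_funTS.
split=> // p q; apply/integrableP; split.
  by apply/measurable_EFinP; exact: measurable_funTS.
by apply: If => //; exact: segment_compact.
Qed.

(** Lebesgue differentiation along nicely shrinking sets. The intervals only have to contain [x], at
    any position, which covers both one-sided intervals and the cell of a partition around [x]. *)
Lemma ae_average_cvg (lo : R -> nat -> R) (e : nat -> R) f :
  (forall n, 0 < e n) -> e n @[n --> \oo] --> 0 ->
  (forall x n, lo x n <= x <= lo x n + e n) -> L1loc f ->
  {ae mu, forall x, (e n)^-1 * ii (lo x n) (lo x n + e n) f @[n --> \oo] --> f x}.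
Proof.
move=> e0 e_cvg lox If.
pose E x n := `[lo x n, lo x n + e n]%classic.
have muE x n : mu (E x n) = (e n)%:E.
  rewrite /E lebesgue_measure_itv/= lte_fin ltrDl e0.
  by rewrite -EFinD; congr (_%:E); ring.
have hE x : nicely_shrinking x (E x).
  split; first by move=> n; exact: measurable_itv.
  have e2 n : 0 < 2 * e n by rewrite mulr_gt0.
  (* The ball of radius [2 * e n] contains the interval even when [x] is one of its endpoints, and
     has 4 times its measure. *)
  exists (4, fun n => PosNum (e2 n)); split => //=.
  - rewrite -(mulr0 2); apply: cvgM => //; exact: cvg_cst.
  - move=> n y; rewrite /E /= in_itv/= => /andP[y1 y2]; rewrite /ball/=.
    have /andP[x1 x2] := lox x n; have := e0 n.
    by rewrite ltr_norml => ?; apply/andP; split; lra.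
  - move=> n; rewrite lebesgue_measure_ball ?muE; last by rewrite ltW.
    by rewrite -EFinM lee_fin; have := e0 n; rewrite -mulr_natl; lra.
have lf := (L1loc_locally_integrable f).1 If.
apply: ae_mono (lebesgue_differentiation lf) => x lx.
have := nice_lebesgue_differentiation hE lf lx.
move=> /fine_cvg; apply: cvg_trans; apply: near_eq_cvg; apply: nearW => n /=.
by rewrite muE inver gt_eqF// -EFin_ii.
Qed.

End averages.

Section duality.
Context {R : realType}.
Implicit Types (f g h : R -> R) (p q r c : R).

Local Notation mu := (@lebesgue_measure R).

(* The test-function inequality with [phi] close to the averages of [h] over a
   uniform partition bounds the square integral of these averages, which tend
   to [h] almost everywhere. *)
Lemma ii_sqr_le_test p q h (A : R) : p < q -> L2loc h ->
  (forall phi, test_function phi ->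
     (forall x, ~~ (p < x < q) -> phi x = 0) ->
     ii p q (fun x => h x * phi x) <= A / 2 + ii p q (fun x => phi x ^+ 2) / 2) ->
  ii p q (fun x => h x ^+ 2) <= A.
Proof.
move=> pq Ih H.
pose e (n : nat) : R := (q - p) / n.+1%:R.
have e0 n : 0 < e n by rewrite divr_gt0 ?subr_gt0.
have qE n : q = p + n.+1%:R * e n.
  by rewrite /e mulrCA divff ?pnatr_eq0// mulr1 addrC subrK.
(* Left end of the cell containing [x]. Left of [p] the value [x] is a filler that keeps [lox] true
   everywhere. *)
pose lo x n := if 0 <= x - p then p + (Num.truncn ((x - p) / e n))%:R * e n else x.
have e_cvg : e n @[n --> \oo] --> 0.
  rewrite -(mulr0 (q - p)); apply: cvgM; first exact: cvg_cst.
  exact: cvg_harmonic.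
have tr x n : 0 <= x - p -> (Num.truncn ((x - p) / e n))%:R * e n <= x - p <
    (Num.truncn ((x - p) / e n)).+1%:R * e n.
  move=> xp; have : 0 <= (x - p) / e n by rewrite divr_ge0// ltW.
  by move=> /truncn_itv; rewrite ler_pdivlMr// ltr_pdivrMr.
have lox x n : lo x n <= x <= lo x n + e n.
  rewrite /lo; case: ifPn => [xp|_]; last by rewrite lexx lerDl ltW.
  have /andP[t1 t2] := tr x n xp; move: t2; rewrite -natr1 => t2.
  by apply/andP; split; lra.
pose P n (i : nat) := p + i%:R * e n.
have PS n i : P n i <= P n i.+1 by rewrite lerD2l ler_wpM2r// ?ler_nat// ltW.
have Pm n i j : (i <= j)%N -> P n i <= P n j.
  by move=> ij; rewrite lerD2l ler_wpM2r// ?ler_nat// ltW.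
pose av n i := (e n)^-1 * ii (P n i) (P n i.+1) h.
(* Half-open cells make the indicators disjoint, so that [f n] equals the squared average on each
   cell. *)
pose ind n i (x : R) : R := \1_(`[P n i, P n i.+1[%classic) x.
pose f n x := \sum_(i < n.+1) av n i ^+ 2 * ind n i x.
have Iind n i : L1loc (ind n i).
  apply: (@eq_L1loc R (fun x => 1 * ind n i x)); first by move=> x; rewrite mul1r.
  by apply: L1loc_indic => //; exact: L1loc_cst.
have fE n i x : (i < n.+1)%N -> P n i <= x < P n i.+1 -> f n x = av n i ^+ 2.
  move=> iN xi; rewrite /f (bigD1 (Ordinal iN))//= {1}/ind indicE.
  rewrite mem_set/= ?in_itv//= mulr1 big1 ?addr0// => j ji.
  rewrite /ind indicE memNset ?mulr0//= in_itv/= => /andP[j1 j2].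
  move: xi => /andP[i1 i2].
  have : (nat_of_ord j != i)%N by apply: contra ji => /eqP ?; apply/eqP/val_inj.
  rewrite neq_ltn => /orP[lt|lt].
    by have := lt_le_trans j2 (Pm n _ _ lt); rewrite ltNge i1.
  by have := lt_le_trans i2 (Pm n _ _ lt); rewrite ltNge j1.
have If n : L1loc (f n).
  suff : forall N, L1loc (fun x => \sum_(i < N) av n i ^+ 2 * ind n i x) by apply.
  elim=> [|N IH].
    apply: (@eq_L1loc R (fun=> 0)); last exact: L1loc_cst.
    by move=> x; rewrite big_ord0.
  apply: (@eq_L1loc R (fun x => \sum_(i < N) av n i ^+ 2 * ind n i x + av n N ^+ 2 * ind n N x)).
    by move=> x; rewrite big_ord_recr.
  by apply: L1locD => //; exact: L1locZ.
apply: (@ii_fatou R p q f (fun x => h x ^+ 2) A).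
- exact: If.
- by move=> n x; apply: sumr_ge0 => i _; rewrite mulr_ge0 ?sqr_ge0.
- exact: L2loc_sqr.
- have C0 := ae_average_cvg e0 e_cvg lox (L2loc_L1loc Ih).
  apply: ae_mono (ae_and (ae_neq q) C0) => x [xq C] /andP[px qx].
  have {qx xq}qx : x < q by rewrite lt_neqAle xq.
  rewrite expr2; suff -> : f ^~ x = (fun n => ((e n)^-1 * ii (lo x n) (lo x n + e n) h) *
    ((e n)^-1 * ii (lo x n) (lo x n + e n) h)) by exact: (cvgM C C).
  apply/funext => n.
  have xp : 0 <= x - p by rewrite subr_ge0.
  have /andP[t1 t2] := tr x n xp.
  have kn : (Num.truncn ((x - p) / e n) < n.+1)%N.
    rewrite -(ltr_nat R) -(ltr_pM2r (e0 n)); apply: (le_lt_trans t1).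
    by rewrite ltrBlDl -qE.
  rewrite (fE _ _ _ kn); last first.
    by rewrite /P -lerBrDl t1 -ltrBlDl t2.
  rewrite /lo xp /av expr2; set k := Num.truncn _.
  have -> : P n k.+1 = p + k%:R * e n + e n by rewrite /P -natr1; ring.
  by [].
- move=> n.
  have H' : forall phi : R -> R, test_function phi ->
     (forall x, ~~ (p < x < p + n.+1%:R * e n) -> phi x = 0) ->
     ii p (p + n.+1%:R * e n) (fun x => h x * phi x) <=
     A / 2 + ii p (p + n.+1%:R * e n) (fun x => phi x ^+ 2) / 2.
    by rewrite -qE.
  apply: le_trans (partition_average_le (e0 n) Ih H').
  rewrite [in leLHS](qE n) (ii_partition p n.+1 (If n) (ltW (e0 n))).
  apply: ler_sum => i _; rewrite -/(P n i) -/(P n i.+1).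
  have -> : ii (p + i%:R * e n) (p + i.+1%:R * e n) h ^+ 2 / e n =
      av n i ^+ 2 * (P n i.+1 - P n i).
    by rewrite /av /P -[i.+1%:R]natr1; field; rewrite gt_eqF.
  rewrite -ii_cst//; apply: ae_le_ii => //; first exact: L1loc_cst.
  apply: ae_mono (ae_neq (P n i.+1)) => x xP /andP[x1 x2].
  by rewrite (fE n i)// x1 lt_neqAle xP x2.
Qed.

End duality.

(** * Mean value inequality from weak time derivatives *)

Section weak_mean_value.
Context {R : realType}.
Implicit Types (f g h phi : R -> R) (p q r c : R).

Local Notation mu := (@lebesgue_measure R).

Lemma L2loc_test phi : test_function phi -> L2loc phi.
Proof. by case=> /smooth_continuous + _; exact: L2loc_continuous. Qed.

Lemma Rintegral_support p q f phi : (forall x, ~~ (p <= x <= q) -> phi x = 0) ->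
  \int[mu]_x (f x * phi x) = ii p q (fun x => f x * phi x).
Proof.
move=> phi0; rewrite /ii [RHS]Rintegral_mkcond; apply: eq_Rintegral => x _.
rewrite patchE; case: ifPn => //; rewrite notin_setE /= in_itv/= => /negP H.
by rewrite phi0 ?mulr0.
Qed.

Lemma Rintegral_test p q f phi : (forall x, ~~ (p < x < q) -> phi x = 0) ->
  \int[mu]_x (f x * phi x) = ii p q (fun x => f x * phi x).
Proof.
move=> phi0; apply: Rintegral_support => x H; apply: phi0.
by apply: contra H => /andP[H1 H2]; rewrite !ltW.
Qed.

(** For each test function the scalar mean value theorem gives an intermediate time that depends on
    the test function. The bound [A] holds at all times, so Young's inequality gives an estimate
    uniform over test functions, and duality turns it into a norm bound. *)
Lemma weak_mean_value (W G : R -> R -> R) p q d (A : R) : p < q -> 0 < d ->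
  L2loc (W 0) -> L2loc (W d) ->
  (forall t, 0 <= t <= d -> L2loc (G t)) ->
  (forall phi, test_function phi -> (forall x, ~~ (p < x < q) -> phi x = 0) ->
     forall t : R, 0 <= t <= d -> is_derive t 1 (fun t => ii p q (fun x => W t x * phi x))
       (ii p q (fun x => G t x * phi x))) ->
  (forall t, 0 <= t <= d -> ii p q (fun x => G t x ^+ 2) <= A) ->
  ii p q (fun x => (W d x - W 0 x) ^+ 2) <= d ^+ 2 * A.
Proof.
move=> pq d0 I0 Id IG dW HA.
apply: ii_sqr_le_test => //; first exact: L2locB.
move=> phi tphi phi0; have Iphi := L2loc_test tphi.
have dphi := dW phi tphi phi0.
pose k t := ii p q (fun x => W t x * phi x).
have [t] : exists2 t, t \in `]0, d[%R & k d - k 0 = ii p q (fun x => G t x * phi x) * (d - 0).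
  apply: (@MVT _ k (fun t => ii p q (fun x => G t x * phi x))) => //.
    by move=> x; rewrite in_itv/= => /andP[x0 xd]; apply: dphi; rewrite !ltW.
  apply: derivable_within_continuous => x; rewrite in_itv/= => xd.
  by have [] := dphi x xd.
rewrite in_itv/= => /andP[t0 td]; have tI : 0 <= t <= d by rewrite !ltW.
have -> : ii p q (fun x => (W d x - W 0 x) * phi x) = k d - k 0.
  rewrite /k -iiB; [|exact: L2loc_mul..].
  by apply: eq_ii => x _; ring.
move=> ->; rewrite subr0 mulrC -iiZ; last by apply: L2loc_mul => //; exact: IG.
have -> : ii p q (fun x => d * (G t x * phi x)) = ii p q (fun x => (d * G t x) * phi x).
  by apply: eq_ii => x _; ring.
have IdG : L2loc (fun x => d * G t x) by apply: L2locZ; exact: IG.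
apply: le_trans (ii_amgm p q ltr01 IdG Iphi) _.
have -> : ii p q (fun x => (d * G t x) ^+ 2) = d ^+ 2 * ii p q (fun x => G t x ^+ 2).
  rewrite -iiZ; last by apply: L2loc_sqr; exact: IG.
  by apply: eq_ii => x _; ring.
have : d ^+ 2 * ii p q (fun x => G t x ^+ 2) <= d ^+ 2 * A.
  by apply: ler_wpM2l; [exact: sqr_ge0|exact: HA].
by rewrite mulr1; lra.
Qed.

End weak_mean_value.

(** * Primitives of locally square integrable functions *)

Section primitives.
Context {R : realType}.
Implicit Types (f g h phi : R -> R) (p q r c : R).

Local Notation mu := (@lebesgue_measure R).

(** Absolute continuity with derivative [g], encoded by the integral identity so that nothing
    pointwise is asked of [g]. The restriction [x <= y] matches the value 0 of [ii] for reversed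
    endpoints. *)
Definition primitive f g := forall x y, x <= y -> f y - f x = ii x y g.

Lemma primitive_sqr_le f g x y : L2loc g -> primitive f g -> x <= y ->
  (f y - f x) ^+ 2 <= (y - x) * ii x y (fun z => g z ^+ 2).
Proof. by move=> Ig fg xy; rewrite fg//; exact: ii_cauchy. Qed.

Lemma primitive_hoelder f g p q x y : L2loc g -> primitive f g ->
  p <= x <= q -> p <= y <= q ->
  (f y - f x) ^+ 2 <= `|y - x| * ii p q (fun z => g z ^+ 2).
Proof.
move=> Ig fg; have I2 := L2loc_sqr Ig.
wlog xy : x y / x <= y => [hw px py|/andP[px xq] /andP[py yq]].
  have [xy|/ltW yx] := leP x y; first exact: hw.
  by rewrite distrC -sqrrN opprB; apply: hw.
rewrite ger0_norm ?subr_ge0//.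
apply: le_trans (primitive_sqr_le Ig fg xy) _.
rewrite ler_wpM2l ?subr_ge0//; apply: ii_subset => // z; exact: sqr_ge0.
Qed.

Lemma primitive_continuous f g : L2loc g -> primitive f g -> continuous f.
Proof.
move=> Ig fg x; apply/cvgrPdist_le => e e0.
pose K := ii (x - 1) (x + 1) (fun z => g z ^+ 2) + 1.
have K0 : 0 < K by rewrite ltr_wpDl// ii_sqr_ge0.
near=> y.
have y1 : `|x - y| < 1 by near: y; apply: cvgr_dist_lt => //; exact: cvg_id.
have y2 : `|x - y| < e ^+ 2 / K.
  by near: y; apply: cvgr_dist_lt; [exact: cvg_id|rewrite divr_gt0// exprn_gt0].
rewrite -(@ler_pXn2r _ 2)// ?nnegrE ?(ltW e0)// real_normK ?num_real//.
have xI : x - 1 <= x <= x + 1 by apply/andP; split; lra.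
have yI : x - 1 <= y <= x + 1.
  by move: y1; rewrite ltr_norml => /andP[? ?]; apply/andP; split; lra.
apply: le_trans (primitive_hoelder Ig fg yI xI) _.
apply: (@le_trans _ _ (`|x - y| * K)).
  by rewrite ler_wpM2l// lerDl.
by rewrite -ler_pdivlMr// ltW.
Unshelve. all: by end_near. Qed.

(** Sobolev embedding in dimension one: f(x)^2 <= 2 f(y)^2 + 2 (f(y) - f(x))^2 is integrated over y
    in [x, x + 1], the increment being bounded by Cauchy-Schwarz. *)
Lemma primitive_sup f g x : L2loc g -> primitive f g ->
  f x ^+ 2 <= 2 * ii x (x + 1) (fun z => f z ^+ 2) +
              2 * ii x (x + 1) (fun z => g z ^+ 2).
Proof.
move=> Ig fg; have I2 := L2loc_sqr Ig.
have If : L2loc f by apply: L2loc_continuous; exact: primitive_continuous fg.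
set B := ii x (x + 1) (fun z => g z ^+ 2).
have x1 : x <= x + 1 by rewrite lerDl.
have -> : f x ^+ 2 = ii x (x + 1) (fun=> f x ^+ 2).
  by rewrite ii_cst// addrC addKr mulr1.
have -> : 2 * B = ii x (x + 1) (fun=> 2 * B).
  by rewrite ii_cst// (addrC x) addrK mulr1.
rewrite -iiZ -?iiD; [|apply: L1locZ|exact: L1loc_cst|]; try exact: L2loc_sqr.
apply: le_ii; first exact: L1loc_cst.
  by apply: L1locD; [apply: L1locZ; exact: L2loc_sqr|exact: L1loc_cst].
move=> y /andP[xy yx1].
have xI : x <= x <= x + 1 by rewrite lexx.
have yI : x <= y <= x + 1 by rewrite xy.
have := primitive_hoelder Ig fg xI yI.
rewrite ger0_norm ?subr_ge0// -/B => H.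
have B0 : 0 <= B by exact: ii_sqr_ge0.
have : (y - x) * B <= B by rewrite ler_piMl//; lra.
have := sqr_ge0 (f y + (f y - f x)).
nra.
Qed.

End primitives.

(** * Weak derivatives and their continuous primitives *)

Section weak_derivatives.
Context {R : realType}.
Implicit Types (f g h phi psi : R -> R) (p q r c : R).

Local Notation mu := (@lebesgue_measure R).

Lemma is_derive_ii psi p (x : R) : continuous psi -> p < x ->
  is_derive x 1 (fun y => ii p y psi) (psi x).
Proof.
move=> cpsi px; have [_ Ipsi] := L1loc_continuous cpsi.
have x1 : x < x + 1 by rewrite ltrDl.
have [H1 H2] := continuous_FTC1_closed x1 (Ipsi p (x + 1)) px (cpsi x).
by rewrite derive1E in H2; exact: (DeriveDef H1 H2).
Qed.

Lemma ii_eq0 p q f : (forall x, p <= x <= q -> f x = 0) -> ii p q f = 0.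
Proof.
move=> f0; rewrite (@eq_ii R p q f (fun=> 0 * 0)).
  by rewrite iiZ ?mul0r//; exact: L1loc_cst.
by move=> x /f0 ->; rewrite mulr0.
Qed.

(** Zero mean makes the antiderivative vanish to the right of the support. Integration starts at
    [p - 1] because [is_derive_ii] requires a point strictly to the right of the base point. *)
Lemma test_antiderivative p q psi : smooth psi -> p <= q ->
  (forall x, ~~ (p < x < q) -> psi x = 0) -> ii p q psi = 0 ->
  let F x := ii (p - 1) x psi in
  [/\ test_function F, forall x : R, is_derive x 1 F (psi x) &
      forall x, ~~ (p < x < q) -> F x = 0].
Proof.
move=> spsi pq psi0 int0 F; have cpsi := smooth_continuous spsi.
have Ipsi := L1loc_continuous cpsi.
have Fp x : x <= p -> F x = 0.
  move=> xp; apply: ii_eq0 => y /andP[_ yx]; apply: psi0.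
  by rewrite negb_and -leNgt (le_trans yx xp).
have Fq x : q <= x -> F x = 0.
  move=> qx; rewrite /F (@ii_cat _ p) ?lerBlDr ?lerDl ?(le_trans pq qx)//.
  rewrite -/(F p) Fp// add0r (@ii_cat _ q)// int0 add0r.
  apply: ii_eq0 => y /andP[qy _]; apply: psi0.
  by rewrite negb_and -!leNgt qy orbT.
have F0 x : ~~ (p < x < q) -> F x = 0.
  by rewrite negb_and -!leNgt => /orP[/Fp|/Fq].
have dF (x : R) : is_derive x 1 F (psi x).
  have [px|xp] := ltP (p - 1) x; first exact: is_derive_ii.
  have xp' : x < p by rewrite (le_lt_trans xp)// ltrBlDr ltrDl.
  rewrite psi0; last by rewrite negb_and -leNgt (ltW xp').
  apply: (@near_eq_is_derive R R R (cst 0)).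
  near=> y; rewrite /= Fp//.
  by apply: ltW; near: y; exact: lt_nbhsl.
split; [|exact: dF|exact: F0]; split; first exact: (smooth_antiderivative dF).
exists (`|p| + `|q|) => x Hx; apply: F0; apply/negP => /andP[x1 x2].
move: Hx; rewrite ltNge => /negP; apply; rewrite ler_norml.
by apply/andP; split;
  have := ler_norm (- p); have := ler_norm q; have := normr_ge0 p;
  have := normr_ge0 q; rewrite normrN; lra.
Unshelve. all: by end_near. Qed.

(** The test function is the antiderivative of a bump at [p] minus its translate at [q]: it climbs
    over [p, p + e], stays constant up to [q], and descends over [q, q + e]. Its plateau height
    tends to [e] as the bumps fill their intervals, which produces e times the integral of [g]. Each
    ramp costs one error term; the second unit in the factor 2 comes from extending the integral of
    [g] from [p + e, q] to [p, q]. *)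
Lemma weak_derivative_average f g p q e : is_weak_derivative f g ->
  0 < e -> p + e < q ->
  `| ii p (p + e) f - ii q (q + e) f + e * ii p q g | <=
  2 * e * ii p (p + e) (fun x => `|g x|) + e * ii q (q + e) (fun x => `|g x|).
Proof.
move=> [/L1loc_locally_integrable If /L1loc_locally_integrable Ig fg] e0 pq.
have Ig' := L1loc_norm Ig.
have pe : p <= p + e by rewrite lerDl ltW.
have qe : q <= q + e by rewrite lerDl ltW.
pose b n x : R := bump p (p + e) n x.
pose b' n x : R := bump q (q + e) n x.
have peq : p + e <= q + e by rewrite lerD2r (le_trans pe)// ltW.
have sb n : smooth (b n) by exact: smooth_bump.
have sb' n : smooth (b' n) by exact: smooth_bump.
have b'E n x : b' n x = b n (x + (p - q)).
  rewrite /b' /b /bump; congr (flat 0 _ * flat 0 _); ring.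
have cb n : continuous (b n) by exact: smooth_continuous.
have cb' n : continuous (b' n) by exact: smooth_continuous.
have Ib n : L1loc (b n) by exact: L1loc_continuous.
have Ib' n : L1loc (b' n) by exact: L1loc_continuous.
pose c n := ii p (p + e) (b n).
have c'E n : ii q (q + e) (b' n) = c n.
  have -> : ii q (q + e) (b' n) = ii q (q + e) (fun x => b n (x + (p - q))).
    by apply: eq_ii => x _; exact: b'E.
  rewrite (ii_shift _ _ _ (Ib n)) /c.
  have -> : q + (p - q) = p by ring.
  by have -> : q + e + (p - q) = p + e by ring.
have b0 n x : ~~ (p < x < p + e) -> b n x = 0 by exact: bump_eq0.
have b0' n x : ~~ (q < x < q + e) -> b' n x = 0 by exact: bump_eq0.
pose psi n x := b n x - b' n x.
have pq' : p < q by rewrite (le_lt_trans _ pq).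
have spsi n : smooth (psi n).
  have -> : psi n = b n \+ (fun x => cst (-1) x * b' n x).
    by apply/funext => x; rewrite /psi /= mulN1r.
  exact: (smoothD (sb n) (smoothM (@smooth_cst R (-1)) (sb' n))).
have psi0 n x : ~~ (p < x < q + e) -> psi n x = 0.
  rewrite negb_and -!leNgt => /orP[H|H]; rewrite /psi b0 ?b0' ?subrr//
    negb_and -!leNgt ?H ?orbT//.
    by rewrite (le_trans H (ltW pq')).
  by rewrite (le_trans _ H) ?orbT// (le_trans (ltW pq)).
have cE n : c n = ii p (q + e) (b n).
  exact: (esym (ii_support (Ib n) (lexx p) peq (@b0 n))).
have cE' n : c n = ii p (q + e) (b' n).
  by rewrite -c'E; exact: (esym (ii_support (Ib' n) (ltW pq') (lexx _) (@b0' n))).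
have int0 n : ii p (q + e) (psi n) = 0 by rewrite iiB// -cE -cE' subrr.
have pqe : p <= q + e by rewrite (le_trans (ltW pq')).
pose F n x := ii (p - 1) x (psi n).
have HF n := test_antiderivative (spsi n) pqe (psi0 n) (int0 n).
have Fpsi n : derive1 (F n) = psi n.
  by apply/funext => x; rewrite derive1E; have [_ dF _] := HF n; case: (dF x).
have key n : ii p (q + e) (fun x => f x * psi n x) = - ii p (q + e) (fun x => g x * F n x).
  have [tF _ F0] := HF n; have := fg (F n) tF.
  by rewrite Fpsi (Rintegral_test f (psi0 n)) (Rintegral_test g F0).
have pp1 : p - 1 <= p by rewrite lerBlDr lerDl.
have Z1 n : ii (p - 1) p (b n) = 0.
  by apply: ii_eq0 => y /andP[_ H]; rewrite b0// negb_and -leNgt H.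
have Z2 n x : x <= q -> ii (p - 1) x (b' n) = 0.
  by move=> xq; apply: ii_eq0 => y /andP[_ H]; rewrite b0'// negb_and -leNgt (le_trans H xq).
have bI n x y : x <= y -> 0 <= ii x y (b n) <= y - x.
  move=> xy; rewrite ii_ge0/=; last by move=> z _; exact: bump_ge0.
  rewrite -[leRHS]mul1r -ii_cst//; apply: le_ii => //; first exact: L1loc_cst.
  by move=> z _; exact: bump_le1.
have cI n : 0 <= c n <= e.
  by have := bI n p (p + e) pe; have -> : p + e - p = e by ring.
have F1 n x : p <= x <= p + e -> 0 <= F n x <= e.
  move=> /andP[px xe]; rewrite /F iiB// Z2 ?subr0; last by rewrite (le_trans xe) ?ltW.
  rewrite (ii_cat (Ib n) pp1 px) Z1 add0r.
  have /andP[-> H] := bI n _ _ px.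
  by rewrite (le_trans H)// lerBlDr addrC.
have bfull n x : p + e <= x -> ii (p - 1) x (b n) = c n.
  move=> ex; rewrite (ii_cat (Ib n) pp1 (le_trans pe ex)) Z1 add0r.
  rewrite (ii_cat (Ib n) pe ex) -/(c n) [X in _ + X]ii_eq0 ?addr0//.
  by move=> y /andP[H _]; rewrite b0// negb_and -!leNgt H orbT.
have F2 n x : p + e <= x <= q -> F n x = c n.
  by move=> /andP[px xq]; rewrite /F iiB// Z2// subr0 bfull.
have F3 n x : q <= x <= q + e -> 0 <= F n x <= e.
  move=> /andP[qx xe]; rewrite /F iiB// bfull; last by rewrite (le_trans (ltW pq) qx).
  have p1q : p - 1 <= q by rewrite (le_trans pp1)// ltW.
  rewrite (ii_cat (Ib' n) p1q qx) Z2// add0r.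
  have H1 : ii q x (b' n) <= c n.
    rewrite -c'E; apply: ii_subset => // y; exact: bump_ge0.
  have H2 : 0 <= ii q x (b' n) by apply: ii_ge0 => y _; exact: bump_ge0.
  by have /andP[? ?] := cI n; apply/andP; split; lra.
have IgF n : L1loc (fun x => g x * F n x).
  have [tF _ _] := HF n.
  apply: (@L1loc_dom _ (fun x => e * `|g x|)); last first.
  - move=> x; rewrite normrM mulrC ler_wpM2r//.
    have [|H] := boolP (p < x < q + e); last first.
      have [_ _ F0] := HF n.
      have -> : F n x = 0 by exact: F0.
      by rewrite normr0 ltW.
    move=> /andP[/ltW x1 /ltW x2].
    have [xe|/ltW xe] := leP x (p + e).
      by have /andP[? ?] := F1 n x (introT andP (conj x1 xe)); rewrite ger0_norm.
    have [xq|/ltW xq] := leP x q.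
      by rewrite F2 ?xe//; have /andP[? ?] := cI n; rewrite ger0_norm.
    by have /andP[? ?] := F3 n x (introT andP (conj xq x2)); rewrite ger0_norm.
  - exact: L1locZ.
  - apply: measurable_funM; first by case: Ig.
    by have [+ _] := L2loc_test tF.
have bound n x y : (forall z, x <= z <= y -> 0 <= F n z <= e) ->
    `|ii x y (fun z => g z * F n z)| <= e * ii x y (fun z => `|g z|).
  move=> H; apply: (le_trans (le_norm_ii _ _ (IgF n))).
  rewrite -iiZ//; apply: le_ii; first exact: L1loc_norm.
    exact: L1locZ.
  move=> z /H /andP[z1 z2]; rewrite normrM mulrC ler_wpM2r//.
  by rewrite ger0_norm.
have step n : `| ii p (q + e) (fun x => f x * psi n x) + c n * ii (p + e) q g | <=
    e * ii p (p + e) (fun x => `|g x|) + e * ii q (q + e) (fun x => `|g x|).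
  rewrite key (@ii_cat _ (p + e) p)//.
  rewrite (@ii_cat _ q (p + e))//; last exact: ltW.
  have -> : ii (p + e) q (fun x => g x * F n x) = c n * ii (p + e) q g.
    by rewrite -iiZ//; apply: eq_ii => x /F2 ->; rewrite mulrC.
  have := bound n p (p + e) (F1 n); have := bound n q (q + e) (F3 n).
  rewrite !ler_norml => /andP[? ?] /andP[? ?]; apply/andP; split; lra.
have C1 : c n @[n --> \oo] --> e.
  have -> : c = (fun n => ii p (p + e) (fun x => 1 * b n x)).
    by apply/funext => n; apply: eq_ii => x _; rewrite mul1r.
  have := @ii_bump_cvg R p (p + e) (fun=> 1) (L1loc_cst 1).
  by rewrite ii_cst//; have -> : 1 * (p + e - p) = e by ring.
have fb n : L1loc (fun x => f x * b n x).
  apply: (L1loc_dom _ (L1loc_norm If)).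
    by apply: measurable_funM; [case: If|case: (Ib n)].
  by move=> x; rewrite normrM ler_piMr// ger0_norm ?bump_ge0 ?bump_le1.
have fb' n : L1loc (fun x => f x * b' n x).
  apply: (L1loc_dom _ (L1loc_norm If)).
    by apply: measurable_funM; [case: If|case: (Ib' n)].
  by move=> x; rewrite normrM ler_piMr// ger0_norm ?bump_ge0 ?bump_le1.
have C2 : ii p (q + e) (fun x => f x * psi n x) @[n --> \oo] -->
    ii p (p + e) f - ii q (q + e) f.
  have -> : (fun n => ii p (q + e) (fun x => f x * psi n x)) =
    (fun n => ii p (p + e) (fun x => f x * b n x) - ii q (q + e) (fun x => f x * b' n x)).
    apply/funext => n.
    rewrite -(@ii_support R p (q + e) p (p + e))//; last by move=> x /b0 ->; rewrite mulr0.
    rewrite -(@ii_support R p (q + e) q (q + e))//; last 2 first.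
    - exact: ltW.
    - by move=> x /b0' ->; rewrite mulr0.
    by rewrite -iiB//; apply: eq_ii => x _; rewrite /psi mulrBr.
  exact: (cvgB (@ii_bump_cvg R p (p + e) f If) (@ii_bump_cvg R q (q + e) f If)).
have C3 : `| ii p (p + e) f - ii q (q + e) f + e * ii (p + e) q g | <=
    e * ii p (p + e) (fun x => `|g x|) + e * ii q (q + e) (fun x => `|g x|).
  have C : ii p (q + e) (fun x => f x * psi n x) + c n * ii (p + e) q g @[n --> \oo] -->
      ii p (p + e) f - ii q (q + e) f + e * ii (p + e) q g.
    by apply: cvgD => //; apply: cvgM => //; exact: cvg_cst.
  have C' : `|ii p (q + e) (fun x => f x * psi n x) + c n * ii (p + e) q g| @[n --> \oo] -->
      `|ii p (p + e) f - ii q (q + e) f + e * ii (p + e) q g| by exact: cvg_norm.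
  rewrite -(cvg_lim _ C') //; apply: limr_le; first by apply/cvg_ex; eexists; exact: C'.
  exact: nearW.
rewrite (@ii_cat _ (p + e) p q)//; last exact: ltW.
have := le_norm_ii p (p + e) Ig.
move: C3; rewrite !ler_norml => /andP[a1 a2] /andP[b1 b2].
have b1' : - (e * ii p (p + e) (fun x => `|g x|)) <= e * ii p (p + e) g.
  by rewrite -mulrN ler_pM2l.
have b2' : e * ii p (p + e) g <= e * ii p (p + e) (fun x => `|g x|).
  by rewrite ler_pM2l.
by apply/andP; split; lra.
Qed.

End weak_derivatives.

Section representative.
Context {R : realType}.
Implicit Types (f g h phi psi : R -> R) (p q r c : R).

Local Notation mu := (@lebesgue_measure R).

Lemma ae_exists (P : R -> Prop) : {ae mu, forall x, P x} -> exists x, P x.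
Proof.
move=> [A [mA A0 PA]]; apply/not_existsP => nP.
have AT : A = setT by apply/seteqP; split => // x _; apply: PA => /=; exact: nP.
have : (mu `[0%R, 1%R]%classic <= mu A)%E by rewrite le_measure ?inE// AT.
by rewrite A0 lebesgue_measure_itv/= lte_fin ltr01 oppr0 adde0 leNgt lte_fin ltr01.
Qed.

(** Divide [weak_derivative_average] by [e] and let [e] tend to 0. Between points where the averages
    of [f] and of |g| converge, the increment of [f] is the integral of [g]; integrating from one
    such point [x0] defines [F] everywhere. *)
Lemma weak_derivative_primitive f g : is_weak_derivative f g ->
  exists F, primitive F g /\ {ae mu, forall x, F x = f x}.
Proof.
move=> fg; have [/L1loc_locally_integrable If /L1loc_locally_integrable Ig _] := fg.
pose e (n : nat) : R := n.+1%:R^-1.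
have e0 n : 0 < e n by rewrite invr_gt0.
have ecvg : e n @[n --> \oo] --> 0 by exact: cvg_harmonic.
have lo x n : x <= x <= x + e n by rewrite lexx lerDl ltW.
pose L x := (e n)^-1 * ii x (x + e n) f @[n --> \oo] --> f x /\
  (e n)^-1 * ii x (x + e n) (fun x => `|g x|) @[n --> \oo] --> `|g x|.
have aeL : {ae mu, forall x, L x}.
  apply: ae_and; first exact: (@ae_average_cvg R (fun x _ => x) e).
  apply: (@ae_average_cvg R (fun x _ => x) e) => //; exact: L1loc_norm.
have g0 x : L x -> ii x (x + e n) (fun x => `|g x|) @[n --> \oo] --> 0.
  move=> [_ C]; rewrite -(mul0r `|g x|).
  have -> : (fun n => ii x (x + e n) (fun x => `|g x|)) =
      (fun n => e n * ((e n)^-1 * ii x (x + e n) (fun x => `|g x|))).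
    by apply/funext => n; rewrite mulVKf ?gt_eqF.
  exact: cvgM.
have key p q : L p -> L q -> p < q -> f q - f p = ii p q g.
  move=> Lp Lq pq; have [Cp _] := Lp; have [Cq _] := Lq.
  have C : `|(e n)^-1 * ii p (p + e n) f - (e n)^-1 * ii q (q + e n) f + ii p q g|
      @[n --> \oo] --> `|f p - f q + ii p q g|.
    by apply: cvg_norm; apply: cvgD; [exact: cvgB|exact: cvg_cst].
  have C' : 2 * ii p (p + e n) (fun x => `|g x|) + ii q (q + e n) (fun x => `|g x|)
      @[n --> \oo] --> 2 * 0 + (0 : R).
    by apply: cvgD; [apply: cvgM; [exact: cvg_cst|exact: g0]|exact: g0].
  have : `|f p - f q + ii p q g| <= 2 * 0 + 0.
    apply: (ler_cvg_to C C'); near=> n.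
    have en : p + e n < q.
      rewrite -ltrBrDl; near: n; apply: (cvgr_lt _ ecvg).
      by rewrite subr_gt0.
    have := weak_derivative_average fg (e0 n) en.
    set A := ii p (p + e n) f; set B := ii q (q + e n) f; set G := ii p q g.
    set C1 := ii p (p + e n) _; set C2 := ii q (q + e n) _.
    have en0 : e n != 0 by rewrite gt_eqF.
    have -> : A - B + e n * G = e n * ((e n)^-1 * A - (e n)^-1 * B + G).
      by field.
    have -> : 2 * e n * C1 + e n * C2 = e n * (2 * C1 + C2) by ring.
    by rewrite normrM gtr0_norm// ler_pM2l.
  rewrite mulr0 addr0 normr_le0 => /eqP; lra.
have [x0 Lx0] := ae_exists aeL.
(* One of the two integrals is always 0, so their difference is the signed integral from [x0] to
   [x]. *)
pose F x := f x0 + (ii x0 x g - ii x x0 g).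
exists F; split.
  move=> x y xy; rewrite /F.
  have [x0x|/ltW xx0] := leP x0 x.
    rewrite (ii_empty _ x0x) (ii_empty _ (le_trans x0x xy)).
    by rewrite (ii_cat Ig x0x xy); ring.
  have [x0y|/ltW yx0] := leP x0 y.
    by rewrite (ii_empty _ xx0) (ii_empty _ x0y) (ii_cat Ig xx0 x0y); ring.
  by rewrite (ii_empty _ xx0) (ii_empty _ yx0) (ii_cat Ig xy yx0); ring.
apply: ae_mono aeL => x Lx; rewrite /F.
have [lt|lt|->] := ltgtP x0 x.
- by rewrite (ii_empty _ (ltW lt)) -(key _ _ Lx0 Lx lt); ring.
- by rewrite (ii_empty _ (ltW lt)) -(key _ _ Lx Lx0 lt); ring.
- by rewrite subrr addr0.
Unshelve. all: by end_near. Qed.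

Lemma derive1_support p q phi : (forall x, ~~ (p <= x <= q) -> phi x = 0) ->
  forall x, ~~ (p <= x <= q) -> derive1 phi x = 0.
Proof.
move=> phi0 x H.
have C : \near x, cst 0 x = phi x.
  move: H; rewrite negb_and -!ltNge => /orP[xp|qx].
    near=> y; rewrite phi0// negb_and -!ltNge; apply/orP; left.
    by near: y; exact: lt_nbhsl.
  near=> y; rewrite phi0// negb_and -!ltNge; apply/orP; right.
  by near: y; exact: lt_nbhsr.
have D := @near_eq_is_derive R R R (cst 0) phi x 1 0 C (@is_derive_cst R R R 0 x 1).
by rewrite derive1E; case: D.
Unshelve. all: by end_near. Qed.

Lemma weak_derivative_test p q f g phi : is_weak_derivative f g ->
  test_function phi -> (forall x, ~~ (p <= x <= q) -> phi x = 0) ->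
  ii p q (fun x => f x * derive1 phi x) = - ii p q (fun x => g x * phi x).
Proof.
move=> [_ _ fg] tphi phi0; have := fg _ tphi.
by rewrite (Rintegral_support f (derive1_support phi0)) (Rintegral_support g phi0).
Qed.

(** [weak_derivative] selects an arbitrary representative, so the derivative [h] of a difference is
    not literally [g1 - g2]. Both have the same pairings with test functions, and duality transfers
    the norm. *)
Lemma weak_derivativeB_sqr_le f1 f2 g1 g2 h p q : p < q ->
  is_weak_derivative f1 g1 -> is_weak_derivative f2 g2 ->
  is_weak_derivative (fun x => f1 x - f2 x) h ->
  L2loc g1 -> L2loc g2 -> L2loc h ->
  ii p q (fun x => (g1 x - g2 x) ^+ 2) <= ii p q (fun x => h x ^+ 2).
Proof.
move=> pq w1 w2 w3 I1 I2 Ih.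
have [/L1loc_locally_integrable If1 _ _] := w1.
have [/L1loc_locally_integrable If2 _ _] := w2.
apply: ii_sqr_le_test => //; first exact: L2locB.
move=> phi tphi phi0'; have Iphi := L2loc_test tphi.
have phi0 x : ~~ (p <= x <= q) -> phi x = 0.
  by move=> H; apply: phi0'; apply: contra H => /andP[H1 H2]; rewrite !ltW.
have cdphi : continuous (derive1 phi).
  by apply: smooth_continuous; apply: smooth_derive1; case: tphi.
have Ifd f : L1loc f -> L1loc (fun x => f x * derive1 phi x).
  move=> If; have [K HK] : exists K, forall x, `|derive1 phi x| <= K.
    have [pq' |qp] := leP p q; last first.
      exists 0 => x; rewrite (derive1_support phi0) ?normr0//.
      by apply/negP => /andP[H1 H2]; have := le_trans H1 H2; rewrite leNgt qp.
    have cn : {within `[p, q], continuous (fun x => `|derive1 phi x|)}.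
      by apply: continuous_subspaceT => x; apply: cvg_norm; exact: cdphi.
    have [c _ Hc] := EVT_max pq' cn.
    exists `|derive1 phi c| => x.
    have [xI|xI] := boolP (p <= x <= q); first by apply: Hc; rewrite in_itv.
    by rewrite (derive1_support phi0)// normr0.
  apply: (L1loc_dom _ (L1locZ K (L1loc_norm If))).
    by apply: measurable_funM; [case: If|exact: continuous_measurable_fun].
  by move=> x; rewrite normrM mulrC ler_wpM2r.
have E1 := weak_derivative_test w1 tphi phi0.
have E2 := weak_derivative_test w2 tphi phi0.
have E3 := weak_derivative_test w3 tphi phi0.
have -> : ii p q (fun x => (g1 x - g2 x) * phi x) = ii p q (fun x => h x * phi x).
  rewrite -[RHS]opprK -E3.
  have -> : ii p q (fun x => (f1 x - f2 x) * derive1 phi x) =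
      ii p q (fun x => f1 x * derive1 phi x) - ii p q (fun x => f2 x * derive1 phi x).
    by rewrite -iiB//; [apply: eq_ii => x _; ring|exact: Ifd..].
  have -> : ii p q (fun x => (g1 x - g2 x) * phi x) =
      ii p q (fun x => g1 x * phi x) - ii p q (fun x => g2 x * phi x).
    by rewrite -iiB//; [apply: eq_ii => x _; ring|exact: L2loc_mul..].
  by rewrite E1 E2; ring.
have := ii_amgm p q ltr01 Ih Iphi.
by rewrite mulr1 mul1r; lra.
Qed.

End representative.

(** * Lemmas on functions of one real variable *)

Section real_analysis.
Context {R : realType}.
Implicit Types (f g : R -> R).

Lemma is_deriveP f (x d : R) : is_derive x 1 f d <->
  forall e, 0 < e -> exists2 r, 0 < r &
    forall h, `|h| < r -> `|f (x + h) - f x - h * d| <= e * `|h|.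
Proof.
split=> [[df dfE] e e0|H].
  have C : h^-1 *: (f (h *: 1 + x) - f x) @[h --> 0^'] --> d by rewrite -dfE; exact: df.
  have /cvgrPdist_le/(_ _ e0) := C.
  rewrite near_withinE => -[r /= r0 Hr]; exists r => // h hr.
  have [->|h0] := eqVneq h 0; first by rewrite addr0 subrr mul0r subr0 normr0 mulr0.
  have := Hr h; rewrite /ball/= sub0r normrN => /(_ hr h0).
  rewrite distrC /GRing.scale /= mulr1 => H.
  have -> : f (x + h) - f x - h * d = (h^-1 * (f (h + x) - f x) - d) * h.
    by rewrite mulrBl mulrAC mulVf// mul1r (addrC h) (mulrC h).
  by rewrite normrM ler_wpM2r.
have C : h^-1 *: (f (h *: 1 + x) - f x) @[h --> 0^'] --> d.
  apply/cvgrPdist_le => e e0; have [r r0 Hr] := H e e0.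
  near=> h.
  have h0 : h != 0 by near: h; exact: nbhs_dnbhs_neq.
  rewrite distrC /GRing.scale /= mulr1.
  have -> : h^-1 * (f (h + x) - f x) - d = h^-1 * (f (x + h) - f x - h * d).
    by rewrite [RHS]mulrBr mulKf// (addrC h).
  rewrite normrM normfV mulrC ler_pdivrMr ?normr_gt0//.
  by apply: Hr; near: h; exact: dnbhs0_lt.
split; first by apply/cvg_ex; exists d.
exact/cvg_lim.
Unshelve. all: by end_near. Qed.

Lemma mean_value_le f g (a b K : R) : (forall x : R, is_derive x 1 f (g x)) ->
  (forall x, a <= x <= b -> `|g x| <= K) ->
  forall x y, a <= x <= b -> a <= y <= b -> `|f y - f x| <= K * `|y - x|.
Proof.
move=> df gK x y; wlog xy : x y / x <= y => [hw xI yI|/andP[ax xb] /andP[ay yb]].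
  have [xy|/ltW yx] := leP x y; first exact: hw.
  by rewrite distrC (distrC y); apply: hw.
have [c] : exists2 c, c \in `[x, y]%R & f y - f x = g c * (y - x).
  apply: (@MVT_segment _ f g) => //.
  by apply: continuous_subspaceT; apply: derivable_continuous => z; case: (df z).
rewrite in_itv/= => /andP[xc cy] ->.
by rewrite normrM ler_wpM2r// gK// (le_trans ax xc) (le_trans cy yb).
Qed.

(** The mean value inequality is applied to f(z) - g(x) z, whose derivative g(z) - g(x) is bounded
    by the same inequality; the factor 1/2 of Taylor's formula is given up. *)
Lemma taylor1_le f g h (a b K : R) : (forall x : R, is_derive x 1 f (g x)) ->
  (forall x : R, is_derive x 1 g (h x)) ->
  (forall x, a <= x <= b -> `|h x| <= K) ->
  forall x y, a <= x <= b -> a <= y <= b ->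
  `|f y - f x - g x * (y - x)| <= K * (y - x) ^+ 2.
Proof.
move=> df dg hK x y /andP[ax xb] /andP[ay yb].
pose k z := f z - g x * z.
have dk (z : R) : is_derive z 1 k (g z - g x).
  have dl : is_derive z 1 (fun z : R => g x * z) (g x).
    have H := @is_derive_mulr R (fun=> g x) (fun z => z) z 0 1 (is_derive_cst (g x) z 1) (is_derive_id z 1).
    apply: (is_derive_val_eq H).
    by rewrite mulr1 mul0r addr0.
  exact: (is_deriveB (df z) dl).
have -> : f y - f x - g x * (y - x) = k y - k x by rewrite /k; ring.
pose lo := Num.min x y; pose hi := Num.max x y.
have xI : lo <= x <= hi by rewrite ge_min le_max lexx.
have yI : lo <= y <= hi by rewrite ge_min le_max lexx !orbT.
have loa : a <= lo by rewrite le_min ax.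
have hib : hi <= b by rewrite ge_max xb.
have K0 : 0 <= K by rewrite (le_trans _ (hK x _)) ?ax.
apply: (le_trans (mean_value_le (a := lo) (b := hi) (K := K * `|y - x|) dk _ xI yI)).
  move=> z /andP[z1 z2].
  apply: (le_trans (mean_value_le dg hK _ _)).
  - by rewrite ax.
  - by rewrite (le_trans loa z1) (le_trans z2 hib).
  - rewrite ler_wpM2l//; move: z1 z2; rewrite /lo /hi.
    have [xy|yx] := leP x y => z1 z2.
      by rewrite !ger0_norm ?subr_ge0// lerD2r.
    by rewrite !ler0_norm ?subr_le0// ?(ltW yx)// lerN2 lerD2r.
by rewrite -mulrA -expr2 real_normK// num_real.
Qed.

Lemma continuous_bounded_segment f (a b : R) : continuous f ->
  exists2 K, 0 <= K & forall x, a <= x <= b -> `|f x| <= K.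
Proof.
move=> cf; have [ab|ba] := leP a b; last first.
  exists 0 => // x /andP[H1 H2]; have := le_trans H1 H2.
  by rewrite leNgt ba.
have cn : {within `[a, b], continuous (fun x => `|f x|)}.
  by apply: continuous_subspaceT => x; apply: cvg_norm; exact: cf.
have [c _ Hc] := EVT_max ab cn.
by exists `|f c| => // x xI; apply: Hc; rewrite in_itv.
Qed.

(** Continuous induction: the times t with f(t) <= f(0) + e t contain their supremum by the second
    hypothesis, and the first pushes a supremum below [T] further. The second hypothesis is
    one-sided and tolerates downward jumps, so that for the energy in a shrinking interval a single
    inequality has to be shown. *)
Lemma dini_nonincreasing (f : R -> R) (T : R) : 0 <= T ->
  (forall t, 0 <= t < T -> forall e, 0 < e -> exists2 r, 0 < r &
     forall h, 0 < h < r -> f (t + h) <= f t + e * h) ->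
  (forall t, 0 < t <= T -> forall e, 0 < e -> exists2 r, 0 < r &
     forall u, 0 <= u <= t -> t - r < u -> f t <= f u + e) ->
  f T <= f 0.
Proof.
move=> T0 Hr Hl; apply/ler_addgt0Pr => e' e'0.
(* The [+ 1] keeps the divisor positive when T = 0; the accumulated loss e T is at most e'. *)
pose e := e' / (T + 1).
have e0 : 0 < e by rewrite divr_gt0// ltr_wpDl.
suff : f T <= f 0 + e * T.
  move/le_trans; apply; rewrite lerD2l /e mulrAC ler_pdivrMr ?ltr_wpDl//.
  by rewrite ler_pM2l// lerDl.
pose A := [set t | 0 <= t <= T /\ f t <= f 0 + e * t].
have A0 : A 0 by split; rewrite ?lexx ?mulr0 ?addr0.
have supA : has_sup A.
  by split; [exists 0|exists T => t [/andP[_ ?] _]].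
pose c := sup A.
have c0 : 0 <= c by apply: (@ub_le_sup _ A) => //; case: supA.
have cT : c <= T by apply: ge_sup; [exists 0|move=> t [/andP[_ ?] _]].
have Ac : A c.
  split; first by rewrite c0.
  have [c00|cpos] : c = 0 \/ 0 < c.
    by move: c0; rewrite le_eqVlt => /predU1P[<-|]; [left|right].
    by rewrite c00 mulr0 addr0.
  apply/ler_addgt0Pr => d d0.
  have [r r0 H] := Hl c (introT andP (conj cpos cT)) d d0.
  have [t At ct] := sup_adherent r0 supA.
  have [/andP[t0 tT] ft] := At.
  have tc : t <= c by apply: (@ub_le_sup _ A) => //; case: supA.
  have := H t; rewrite t0 tc => /(_ isT ct) /le_trans; apply.
  by rewrite lerD2r (le_trans ft)// lerD2l ler_pM2l.
have [|cT'] := leP T c.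
  by move=> Tc; have -> : T = c by [apply/le_anti; rewrite Tc cT]; case: Ac.
have [_ fc] := Ac.
have [r r0 H] := Hr c (introT andP (conj c0 cT')) e e0.
pose h := Num.min (r / 2) (T - c).
have h0 : 0 < h by rewrite lt_min divr_gt0//= subr_gt0.
have hr : h < r by rewrite gt_min ltr_pdivrMr// ltr_pMr// ltr1n.
have hT : h <= T - c by rewrite ge_min lexx orbT.
have Ach : A (c + h).
  split; first by rewrite addr_ge0 ?(ltW h0)//= -lerBrDl.
  have := H h; rewrite h0 hr => /(_ isT) /le_trans; apply.
  by rewrite mulrDr addrA lerD2r.
have : c + h <= c by apply: (@ub_le_sup _ A) => //; case: supA.
by rewrite gerDl leNgt h0.
Qed.

End real_analysis.

(** * Pairings with a moving test function *)

Section moving_test.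
Context {R : realType}.
Implicit Types (f g phi psi : R -> R) (W : R -> R -> R) (p q r c : R).

Local Notation mu := (@lebesgue_measure R).

Definition L2cont W := forall t0 p q e, 0 < e -> exists2 r, 0 < r &
  forall t, `|t - t0| < r -> ii p q (fun x => (W t x - W t0 x) ^+ 2) <= e.

Lemma test_function_support phi : test_function phi ->
  exists2 M, 0 <= M & forall x, ~~ (- M <= x <= M) -> phi x = 0.
Proof.
move=> [_ [M HM]]; exists `|M| => // x; rewrite -ler_norml -ltNge => H.
by apply: HM; rewrite (le_lt_trans _ H)// ler_norm.
Qed.

Lemma test_function_derive1 phi : test_function phi -> test_function (derive1 phi).
Proof.
move=> tphi; have [M M0 HM] := test_function_support tphi.
split; first by apply: smooth_derive1; case: tphi.
exists M => x Hx; apply: (derive1_support HM).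
by rewrite -ler_norml -ltNge.
Qed.

Lemma test_function_shift phi c : test_function phi ->
  test_function (fun x => phi (x + c)).
Proof.
move=> tphi; have [M M0 HM] := test_function_support tphi.
split.
  have := @smooth_affine R phi 1 c tphi.1.
  by under eq_fun do rewrite mul1r.
exists (M + `|c|) => x Hx; apply: HM; rewrite -ler_norml -ltNge.
by have := ler_normB (x + c) c; rewrite addrK; lra.
Qed.

Lemma is_derive_shiftr f c (x d : R) : is_derive (x + c) 1 f d ->
  is_derive x 1 (fun x => f (x + c)) d.
Proof.
move=> /is_deriveP H; apply/is_deriveP => e /H[r r0 Hr]; exists r => // h hr.
by rewrite (addrAC x h c); exact: Hr.
Qed.

Lemma is_derive_smooth phi (x : R) : smooth phi -> is_derive x 1 phi (derive1 phi x).
Proof. by move=> sphi; rewrite derive1E; apply: derivableP; exact: smooth_derivable. Qed.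

Lemma derive1_shift phi c : smooth phi ->
  derive1 (fun x => phi (x + c)) = (fun x => derive1 phi (x + c)).
Proof.
move=> sphi; apply/funext => x.
have [_ E] := is_derive_shiftr (@is_derive_smooth phi (x + c) sphi).
by rewrite derive1E E.
Qed.

Lemma test_function_bounded phi : test_function phi ->
  exists2 K, 0 <= K & forall x, `|phi x| <= K.
Proof.
move=> tphi; have [M M0 HM] := test_function_support tphi.
have [K K0 HK] := continuous_bounded_segment (- M) M (smooth_continuous tphi.1).
exists K => // x; have [xM|/HM ->] := boolP (- M <= x <= M); first exact: HK.
by rewrite normr0.
Qed.

(** Chain rule for a pairing in which both factors move. The test function at time t0 + h is phi0 +
    c h phi0' up to O(h^2). The first term is differentiated by hypothesis; for the second it is
    enough that the pairing is continuous in time; the remainder is harmless because [L2cont] bounds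
    the norm of W(t0 + h) near [t0]. *)
Lemma moving_test W (L : R -> (R -> R) -> R) c :
  (forall t, L2loc (W t)) -> L2cont W ->
  (forall phi, test_function phi -> forall t : R,
     is_derive t 1 (fun t => \int[mu]_x (W t x * phi x)) (L t phi)) ->
  forall phi, test_function phi -> forall t0 : R,
  is_derive t0 1 (fun t => \int[mu]_x (W t x * phi (x + c * t)))
    (L t0 (fun x => phi (x + c * t0)) +
     c * \int[mu]_x (W t0 x * derive1 phi (x + c * t0))).
Proof.
move=> IW cW dW phi tphi t0.
pose phi0 x := phi (x + c * t0).
have tphi0 : test_function phi0 by exact: test_function_shift.
have tphi1 := test_function_derive1 tphi0.
have E1 : derive1 phi0 = (fun x => derive1 phi (x + c * t0)).
  exact: (derive1_shift _ tphi.1).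
have -> : (fun x => W t0 x * derive1 phi (x + c * t0)) = (fun x => W t0 x * derive1 phi0 x).
  by apply/funext => x; rewrite E1.
set D0 := L t0 phi0; set D1 := \int[mu]_x _.
have [M M0 HM] := test_function_support tphi0.
(* For |h| <= 1 all the translated test functions vanish outside [-b, b]. *)
pose b := M + `|c|.
have sup (h x : R) : `|h| <= 1 -> ~~ (- b <= x <= b) -> phi0 (x + c * h) = 0.
  move=> h1; rewrite -ler_norml -ltNge => bx; apply: HM.
  rewrite -ler_norml -ltNge.
  have : `|c * h| <= `|c| by rewrite normrM ler_piMr.
  by have := ler_normB (x + c * h) (c * h); rewrite addrK /b in bx *; lra.
have sup0 x : ~~ (- b <= x <= b) -> phi0 x = 0.
  by move=> H; have := sup 0 x; rewrite normr0 mulr0 addr0; apply.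
have sup1 : forall x, ~~ (- b <= x <= b) -> derive1 phi0 x = 0.
  exact: derive1_support.
have [K K0 HK] := test_function_bounded (test_function_derive1 tphi1).
have bb : - b <= b by rewrite /b; have := normr_ge0 c; lra.
pose S := ii (- b) b (fun x => W t0 x ^+ 2).
have S0 : 0 <= S by exact: ii_sqr_ge0.
(* Bounds the integral of |W(t0 + h)| over [-b, b]: |W| <= 1 + W^2, and the square integral is at
   most 2 S + 2 once W(t0 + h) is within distance 1 of W(t0). *)
pose B := 2 * b + 2 * S + 2.
have B0 : 0 < B by rewrite /B; lra.
have [r1 r10 Hr1] := cW t0 (- b) b 1 ltr01.
apply/is_deriveP => e e0.
have e3 : 0 < e / 3 by rewrite divr_gt0.
have [r2 r20 Hr2] := (is_deriveP _ _ _).1 (dW _ tphi0 t0) _ e3.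
pose e4 := e / (3 * (`|c| + 1)).
have e40 : 0 < e4 by rewrite divr_gt0// mulr_gt0// ltr_wpDl.
have [r3 r30 Hr3] : exists2 r, 0 < r & forall h : R, `|h| < r ->
    `|\int[mu]_x (W (t0 + h) x * derive1 phi0 x) - D1| <= e4.
  have [r3 r30 Hr3] := (is_deriveP _ _ _).1 (dW _ tphi1 t0) _ ltr01.
  set D2 := L t0 (derive1 phi0) in Hr3.
  have k0 : 0 < 1 + `|D2| by rewrite ltr_wpDr.
  exists (Num.min r3 (e4 / (1 + `|D2|))); first by rewrite lt_min r30 divr_gt0.
  move=> h; rewrite lt_min => /andP[h1 h2].
  have := Hr3 h h1; rewrite mul1r -/D1 => H.
  move: h2; rewrite ltr_pdivlMr// => h2.
  have : `|h * D2| = `|h| * `|D2| by exact: normrM.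
  set X := _ - D1 in H *.
  have := ler_normD (X - h * D2) (h * D2); rewrite subrK.
  by move: h2; rewrite mulrDr mulr1; lra.
(* Makes the remainder, at most K (c h)^2 B, smaller than a third of e |h|. *)
pose r4 := e / (3 * ((c ^+ 2 * K + 1) * B)).
have cK : 0 < c ^+ 2 * K + 1 by rewrite ltr_wpDl// mulr_ge0// sqr_ge0.
have r40 : 0 < r4 by rewrite divr_gt0// !mulr_gt0.
exists (Num.min (Num.min 1 r1) (Num.min (Num.min r2 r3) r4)).
  by rewrite !lt_min ltr01 r10 r20 r30 r40.
move=> h; rewrite !lt_min => /andP[/andP[h1 hr1] /andP[/andP[hr2 hr3] hr4]].
have IWh := IW (t0 + h).
pose rem x := phi0 (x + c * h) - phi0 x - c * h * derive1 phi0 x.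
have Iphi f : test_function f -> L2loc f := @L2loc_test R f.
have tphih : test_function (fun x => phi0 (x + c * h)) by exact: test_function_shift.
have Irem : L2loc rem.
  by apply: L2locB; [apply: L2locB; exact: Iphi|apply: L2locZ; exact: Iphi].
have phiE x : phi (x + c * (t0 + h)) = phi0 (x + c * h).
  by rewrite /phi0; congr phi; ring.
have -> : (fun x => W (t0 + h) x * phi (x + c * (t0 + h))) =
          (fun x => W (t0 + h) x * phi0 (x + c * h)).
  by apply/funext => x; rewrite phiE.
have I1 : \int[mu]_x (W (t0 + h) x * phi0 (x + c * h)) =
   \int[mu]_x (W (t0 + h) x * phi0 x) +
   c * h * \int[mu]_x (W (t0 + h) x * derive1 phi0 x) +
   ii (- b) b (fun x => W (t0 + h) x * rem x).
  rewrite (Rintegral_support _ (fun x => sup h x (ltW h1))).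
  rewrite (Rintegral_support _ sup0) (Rintegral_support _ sup1).
  have Ia : L1loc (fun x => W (t0 + h) x * phi0 x) by apply: L2loc_mul => //; exact: Iphi.
  have Ib : L1loc (fun x => W (t0 + h) x * derive1 phi0 x) by apply: L2loc_mul => //; exact: Iphi.
  have Ic : L1loc (fun x => W (t0 + h) x * rem x) by exact: L2loc_mul.
  rewrite -iiZ// -iiD//; last exact: L1locZ.
  rewrite -iiD//; last by apply: L1locD => //; exact: L1locZ.
  by apply: eq_ii => x _; rewrite /rem; ring.
have remb x : `|rem x| <= K * (c * h) ^+ 2.
  have := @taylor1_le R phi0 (derive1 phi0) (derive1 (derive1 phi0))
     (Num.min x (x + c * h)) (Num.max x (x + c * h)) K
     (fun y => is_derive_smooth y tphi0.1) (fun y => is_derive_smooth y tphi1.1)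
     (fun y _ => HK y) x (x + c * h).
  rewrite !ge_min !le_max !lexx !orbT => /(_ isT isT).
  by rewrite (addrC x (c * h)) addrK /rem (addrC x) (mulrC (derive1 phi0 x)).
have WB : ii (- b) b (fun x => `|W (t0 + h) x|) <= B.
  have H1 : ii (- b) b (fun x => (W (t0 + h) x - W t0 x) ^+ 2) <= 1.
    by apply: Hr1; rewrite addrAC subrr add0r.
  have Id : L2loc (fun x => W (t0 + h) x - W t0 x) by exact: L2locB.
  have H2 := ii_sqrD (- b) b Id (IW t0).
  have H2' : ii (- b) b (fun x => W (t0 + h) x ^+ 2) <= 2 + 2 * S.
    apply: le_trans (_ : _ <= _) _; last first.
      apply: (le_trans H2); rewrite lerD2r; lra.
    by apply: le_ii; [exact: L2loc_sqr|exact: (L2loc_sqr (L2locD Id (IW t0)))|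
       move=> x _; rewrite subrK].
  have : ii (- b) b (fun x => `|W (t0 + h) x|) <=
      ii (- b) b (fun x => 1 + W (t0 + h) x ^+ 2).
    apply: le_ii.
    - by apply: L1loc_norm; exact: L2loc_L1loc.
    - by apply: L1locD; [exact: L1loc_cst|exact: L2loc_sqr].
    - move=> x _; have := sqr_ge0 (`|W (t0 + h) x| - 1).
      by rewrite -(real_normK (num_real (W (t0 + h) x))); have := normr_ge0 (W (t0 + h) x); nra.
  rewrite iiD; [|exact: L1loc_cst|exact: L2loc_sqr].
  by rewrite ii_cst//; rewrite /B; lra.
have H3 : `|ii (- b) b (fun x => W (t0 + h) x * rem x)| <= e / 3 * `|h|.
  apply: le_trans (le_norm_ii _ _ (L2loc_mul IWh Irem)) _.
  apply: (@le_trans _ _ (ii (- b) b (fun x => K * (c * h) ^+ 2 * `|W (t0 + h) x|))).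
    apply: le_ii.
    - exact: (L1loc_norm (L2loc_mul IWh Irem)).
    - by apply: L1locZ; apply: L1loc_norm; exact: L2loc_L1loc.
    - by move=> x _; rewrite normrM mulrC ler_wpM2r.
  rewrite iiZ; last by apply: L1loc_norm; exact: L2loc_L1loc.
  apply: (@le_trans _ _ (K * (c * h) ^+ 2 * B)).
    by rewrite ler_wpM2l// mulr_ge0// sqr_ge0.
  have -> : K * (c * h) ^+ 2 * B = `|h| * (`|h| * ((c ^+ 2 * K) * B)).
    by rewrite mulrA -expr2 real_normK ?num_real//; ring.
  rewrite mulrC ler_wpM2r//.
  move: hr4; rewrite /r4 ltr_pdivlMr ?mulr_gt0// => hr4.
  have : `|h| * (c ^+ 2 * K * B) <= `|h| * ((c ^+ 2 * K + 1) * B).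
    by rewrite ler_wpM2l// ler_wpM2r ?(ltW B0)// lerDl.
  have E : `|h| * (3 * ((c ^+ 2 * K + 1) * B)) = 3 * (`|h| * ((c ^+ 2 * K + 1) * B)) by ring.
  rewrite E in hr4; lra.
have H4 := Hr3 h hr3.
have H5 := Hr2 h hr2.
rewrite I1 -/D0.
set X1 := \int[mu]_x (W (t0 + h) x * phi0 x) in H5 *.
set X2 := \int[mu]_x (W (t0 + h) x * derive1 phi0 x) in H4 *.
set X3 := ii _ _ _ in H3 *.
set X0 := \int[mu]_x (W t0 x * phi0 x) in H5 *.
have -> : X1 + c * h * X2 + X3 - X0 - h * (D0 + c * D1) =
  (X1 - X0 - h * D0) + (c * h) * (X2 - D1) + X3 by ring.
have H6 : `|c * h * (X2 - D1)| <= e / 3 * `|h|.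
  rewrite !normrM mulrAC ler_wpM2r//.
  apply: (@le_trans _ _ ((`|c| + 1) * e4)).
    by apply: ler_pM => //; rewrite lerDl.
  rewrite /e4 le_eqVlt; apply/orP; left; apply/eqP; field.
  by rewrite gt_eqF// ltr_wpDl.
apply: le_trans (ler_normD _ _) _.
have := ler_normD (X1 - X0 - h * D0) (c * h * (X2 - D1)).
lra.
Qed.

End moving_test.

(** * Weak solutions of the field equation *)

Section field.
Context {R : realType}.
Implicit Types (f g phi : R -> R) (p q : R).

Local Notation mu := (@lebesgue_measure R).

(* [d t] is the spatial derivative of [psi t], [pi t] its time derivative. *)
Record field_solution (V : R -> R) (psi d pi : R -> R -> R) : Prop := {
  field_primitive : forall t, primitive (psi t) (d t);
  field_weak : forall t, is_weak_derivative (psi t) (d t);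
  field_L2_d : forall t, L2loc (d t);
  field_L2_pi : forall t, L2loc (pi t);
  field_cont_psi : L2cont psi;
  field_cont_d : L2cont d;
  field_cont_pi : L2cont pi;
  field_eq_psi : forall phi, test_function phi -> forall t : R,
    is_derive t 1 (fun t => \int[mu]_x (psi t x * phi x)) (\int[mu]_x (pi t x * phi x));
  field_eq_pi : forall phi, test_function phi -> forall t : R,
    is_derive t 1 (fun t => \int[mu]_x (pi t x * phi x))
      (- (\int[mu]_x (d t x * derive1 phi x)) - \int[mu]_x (V (psi t x) * phi x)) }.

Lemma L2contD (W1 W2 : R -> R -> R) c : (forall t, L2loc (W1 t)) ->
  (forall t, L2loc (W2 t)) -> L2cont W1 -> L2cont W2 ->
  L2cont (fun t x => W1 t x + c * W2 t x).
Proof.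
move=> I1 I2 c1 c2 t0 p q e e0.
have e4 : 0 < e / 4 by rewrite divr_gt0.
have k0 : 0 < 4 * (c ^+ 2 + 1) by rewrite mulr_gt0// ltr_wpDl// sqr_ge0.
have e4' : 0 < e / (4 * (c ^+ 2 + 1)) by rewrite divr_gt0.
have [r1 r10 H1] := c1 t0 p q _ e4.
have [r2 r20 H2] := c2 t0 p q _ e4'.
exists (Num.min r1 r2); first by rewrite lt_min r10.
move=> t; rewrite lt_min => /andP[/H1 {}H1 /H2 {}H2].
have Ia : L2loc (fun x => W1 t x - W1 t0 x) by exact: L2locB.
have Ib : L2loc (fun x => W2 t x - W2 t0 x) by exact: L2locB.
have -> : ii p q (fun x => (W1 t x + c * W2 t x - (W1 t0 x + c * W2 t0 x)) ^+ 2) =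
  ii p q (fun x => ((W1 t x - W1 t0 x) + c * (W2 t x - W2 t0 x)) ^+ 2).
  by apply: eq_ii => x _; ring.
apply: (le_trans (ii_sqrD p q Ia (L2locZ c Ib))).
have -> : ii p q (fun x => (c * (W2 t x - W2 t0 x)) ^+ 2) =
    c ^+ 2 * ii p q (fun x => (W2 t x - W2 t0 x) ^+ 2).
  rewrite -iiZ; last exact: L2loc_sqr.
  by apply: eq_ii => x _; ring.
set X := ii p q _ in H1 *; set Y := ii p q _ in H2 *.
have Y0 : 0 <= Y by exact: ii_sqr_ge0.
move: H2; rewrite ler_pdivlMr// => H2.
have : c ^+ 2 * Y <= (c ^+ 2 + 1) * Y by rewrite ler_wpM2r// lerDl.
lra.
Qed.

Context (V DV : R -> R) (psi d pi : R -> R -> R).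
Context (VD : forall x : R, is_derive x 1 V (DV x)) (cDV : continuous DV).
Context (sol : field_solution V psi d pi).

Let pri t : primitive (psi t) (d t). Proof. exact: field_primitive sol t. Qed.
Let Id t : L2loc (d t). Proof. exact: field_L2_d sol t. Qed.
Let Ipi t : L2loc (pi t). Proof. exact: field_L2_pi sol t. Qed.
Let cpsi t : continuous (psi t).
Proof. exact: primitive_continuous (Id t) (pri t). Qed.
Let Ipsi t : L2loc (psi t). Proof. exact: L2loc_continuous. Qed.
Let cV : continuous V.
Proof. by apply: derivable_continuous => x; case: (VD x). Qed.
Let cVpsi t : continuous (fun x => V (psi t x)).
Proof. by move=> x; apply: continuous_comp; [exact: cpsi|exact: cV]. Qed.
Let IV t : L2loc (fun x => V (psi t x)). Proof. exact: L2loc_continuous. Qed.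

(** [primitive_sup] is applied to psi(t) - psi(t0), whose derivative is d(t) - d(t0). It looks one
    unit to the right, hence [q + 1], and twice e^2/4 from each of its two terms adds up to e^2. *)
Lemma field_sup_cont t0 p q e : 0 < e -> exists2 r, 0 < r & forall t, `|t - t0| < r ->
  forall x, p <= x <= q -> `|psi t x - psi t0 x| <= e.
Proof.
move=> e0; have e4 : 0 < e ^+ 2 / 4 by rewrite divr_gt0// exprn_gt0.
have [r1 r10 H1] := field_cont_psi sol t0 p (q + 1) e4.
have [r2 r20 H2] := field_cont_d sol t0 p (q + 1) e4.
exists (Num.min r1 r2); first by rewrite lt_min r10.
move=> t; rewrite lt_min => /andP[/H1 {}H1 /H2 {}H2] x /andP[px xq].
have Idd : L2loc (fun x => d t x - d t0 x) by exact: L2locB.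
have prid : primitive (fun x => psi t x - psi t0 x) (fun x => d t x - d t0 x).
  move=> u v uv; rewrite iiB; [|exact: L2loc_L1loc..].
  by rewrite -!pri//; ring.
rewrite -(@ler_pXn2r _ 2)// ?nnegrE ?(ltW e0)// real_normK ?num_real//.
have := primitive_sup x Idd prid.
have xq1 : x + 1 <= q + 1 by rewrite lerD2r.
have S1 := @ii_subset R x (x + 1) p (q + 1) (fun z => (psi t z - psi t0 z) ^+ 2)
  (L2loc_sqr (L2locB (Ipsi t) (Ipsi t0))) (fun z => sqr_ge0 _) px xq1.
have S2 := @ii_subset R x (x + 1) p (q + 1) (fun z => (d t z - d t0 z) ^+ 2)
  (L2loc_sqr Idd) (fun z => sqr_ge0 _) px xq1.
by move=> S3; lra.
Qed.

(** Time and space are separated: at the moved point the field is compared with time [t0] by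
    [field_sup_cont], and at time [t0] it is Hoelder continuous in space, which fixes [r2]. The
    bounds on [c] and [h] keep the moved point within one unit of [p, q]. *)
Lemma field_shift_cont t0 c p q e : `|c| <= 1 -> 0 < e ->
  exists2 r, 0 < r & forall h, `|h| < r ->
  forall x, p <= x <= q -> `|psi (t0 + h) (x + c * h) - psi t0 x| <= e.
Proof.
move=> c1 e0; have e2 : 0 < e / 2 by rewrite divr_gt0.
have [r1 r10 H1] := field_sup_cont t0 (p - 1) (q + 1) e2.
pose K := ii (p - 1) (q + 1) (fun z => d t0 z ^+ 2) + 1.
have K0 : 0 < K by rewrite ltr_wpDl// ii_sqr_ge0.
pose r2 := (e / 2) ^+ 2 / K.
have r20 : 0 < r2 by rewrite divr_gt0// exprn_gt0.
exists (Num.min 1 (Num.min r1 r2)); first by rewrite !lt_min ltr01 r10.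
move=> h; rewrite !lt_min => /andP[h1 /andP[hr1 hr2]] x /andP[px xq].
have ch : `|c * h| <= `|h| by rewrite normrM ler_piMl.
have [ch1 ch2] : - 1 <= c * h /\ c * h <= 1.
  by have : `|c * h| <= 1 by [exact: le_trans ch (ltW h1)]; rewrite ler_norml => /andP[].
have xI : p - 1 <= x <= q + 1 by apply/andP; split; lra.
have yI : p - 1 <= x + c * h <= q + 1 by apply/andP; split; lra.
have t1 : `|t0 + h - t0| < r1 by rewrite addrAC subrr add0r.
have A1 := H1 _ t1 _ yI.
have A2 : `|psi t0 (x + c * h) - psi t0 x| <= e / 2.
  rewrite -(@ler_pXn2r _ 2)// ?nnegrE ?(ltW e2)// real_normK ?num_real//.
  apply: (le_trans (primitive_hoelder (Id t0) (@pri t0) xI yI)).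
  rewrite (addrC x) addrK.
  apply: (@le_trans _ _ (`|h| * K)).
    by apply: ler_pM => //; [exact: ii_sqr_ge0|rewrite lerDl].
  by rewrite -ler_pdivlMr// ltW.
have := ler_normD (psi (t0 + h) (x + c * h) - psi t0 (x + c * h))
  (psi t0 (x + c * h) - psi t0 x).
have -> : psi (t0 + h) (x + c * h) - psi t0 (x + c * h) +
  (psi t0 (x + c * h) - psi t0 x) = psi (t0 + h) (x + c * h) - psi t0 x by ring.
lra.
Qed.

(** Used for [V] along characteristics and, with c = 0, for the potential at a fixed point. The
    range [M + 1] contains the field at nearby times because the deviation is kept at most 1. *)
Lemma field_comp_cont (G DG : R -> R) t0 c p q e :
  (forall x : R, is_derive x 1 G (DG x)) -> continuous DG ->
  `|c| <= 1 -> 0 < e ->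
  exists2 r, 0 < r & forall h, `|h| < r ->
  forall x, p <= x <= q -> `|G (psi (t0 + h) (x + c * h)) - G (psi t0 x)| <= e.
Proof.
move=> GD cDG c1 e0; have [M M0 HM] := continuous_bounded_segment p q (@cpsi t0).
have [K K0 HK] := continuous_bounded_segment (- (M + 1)) (M + 1) cDG.
have k0 : 0 < K + 1 by rewrite ltr_wpDl.
have e1 : 0 < Num.min 1 (e / (K + 1)) by rewrite lt_min ltr01 divr_gt0.
have [r r0 Hr] := field_shift_cont t0 p q c1 e1.
exists r => // h hr x xI; have := Hr h hr x xI; rewrite le_min => /andP[H1 H2].
have xM := HM x xI; set y := psi (t0 + h) _ in H1 H2 *; set z := psi t0 x in H1 H2 xM *.
have zI : - (M + 1) <= z <= M + 1.
  by move: xM; rewrite ler_norml => /andP[? ?]; apply/andP; split; lra.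
have yI : - (M + 1) <= y <= M + 1.
  move: xM H1; rewrite !ler_norml => /andP[? ?] /andP[? ?]; apply/andP; split; lra.
apply: (le_trans (mean_value_le GD HK zI yI)).
move: H2; rewrite ler_pdivlMr//; apply: le_trans.
by rewrite mulrC ler_wpM2l// lerDl.
Qed.

(** [d] has no evolution equation of its own: its pairing is moved onto [psi] by the weak
    derivative, where the equation of [psi] applies. The hypothesis on [c] recombines the two
    resulting terms into one space derivative of pi + c d. *)
Lemma field_transport_weak c : c ^+ 2 = 1 ->
  forall phi, test_function phi -> forall t : R,
  is_derive t 1 (fun t => \int[mu]_x ((pi t x + c * d t x) * phi x))
    (- c * (\int[mu]_x ((pi t x + c * d t x) * derive1 phi x)) - \int[mu]_x (V (psi t x) * phi x)).
Proof.
move=> c1 phi tphi t; have tphi' := test_function_derive1 tphi.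
have [M M0 HM] := test_function_support tphi.
have HM' := derive1_support HM.
have Iphi := L2loc_test tphi; have Iphi' := L2loc_test tphi'.
have E (g : R -> R) : L2loc g -> (forall x, ~~ (- M <= x <= M) -> g x = 0) ->
    forall t, \int[mu]_x ((pi t x + c * d t x) * g x) =
    \int[mu]_x (pi t x * g x) + c * \int[mu]_x (d t x * g x).
  move=> Ig g0 u; rewrite !(Rintegral_support _ g0) -iiZ; last exact: L2loc_mul.
  rewrite -iiD; [|exact: L2loc_mul|by apply: L1locZ; exact: L2loc_mul].
  by apply: eq_ii => x _; ring.
have E2 u : \int[mu]_x (d u x * phi x) = - \int[mu]_x (psi u x * derive1 phi x).
  by have [_ _ ->//] := field_weak sol u; rewrite opprK.
have -> : (fun t => \int[mu]_x ((pi t x + c * d t x) * phi x)) =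
    (fun t => \int[mu]_x (pi t x * phi x) + (- c) * \int[mu]_x (psi t x * derive1 phi x)).
  by apply/funext => u; rewrite (E _ Iphi HM) E2; ring.
have D1 := field_eq_pi sol tphi t.
have D2 := @is_derive_mulr R (fun=> - c) _ t 0 _ (is_derive_cst (- c) t 1) (field_eq_psi sol tphi' t).
apply: (is_derive_val_eq (is_deriveD D1 D2)).
rewrite (E _ Iphi' HM') mul0r addr0.
set A := Rintegral _ _ _; set B := Rintegral _ _ _; set C := Rintegral _ _ _.
have -> : - c * (C + c * A) = - c * C - c ^+ 2 * A by ring.
by rewrite c1; ring.
Qed.

End field.

(** * First-order expansions of integrals *)

Section expansions.
Context {R : realType}.
Implicit Types (f g v phi : R -> R) (p q : R).

Local Notation mu := (@lebesgue_measure R).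

(** The hypothesis says g(h) = f - h v + o(h) in L2. With [rem] for the o(h) term, the product of f
    - h v and [rem] is treated by Young's inequality with weight [k * h], which multiplies the
    bounded square by h and divides the square of size o(h^2) by h. *)
Lemma ii_sqr_expand p q (g : R -> R -> R) f v :
  L2loc f -> L2loc v -> (forall h, L2loc (g h)) ->
  (forall e, 0 < e -> exists2 r, 0 < r & forall h, 0 < h < r ->
     ii p q (fun x => (g h x - f x + h * v x) ^+ 2) <= e * h ^+ 2) ->
  forall e, 0 < e -> exists2 r, 0 < r & forall h, 0 < h < r ->
     ii p q (fun x => g h x ^+ 2) <=
     ii p q (fun x => f x ^+ 2) - 2 * h * ii p q (fun x => f x * v x) + e * h.
Proof.
move=> If Iv Ig H e e0.
set F := ii p q (fun x => f x ^+ 2); set B := ii p q (fun x => f x * v x).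
pose C := ii p q (fun x => v x ^+ 2).
have F0 : 0 <= F by exact: ii_sqr_ge0.
have C0 : 0 <= C by exact: ii_sqr_ge0.
(* Since Q, the square integral of f - h v, is at most 2 (F + C + 1) for h <= 1, this [k] gives k Q
   <= e/4; then [b] is chosen so that b / k and b are at most e/4. *)
pose k := e / (8 * (F + C + 1)).
have FC : 0 < 8 * (F + C + 1) by lra.
have k0 : 0 < k by rewrite divr_gt0.
pose b := e / 4 * Num.min k 1.
have b0 : 0 < b by rewrite mulr_gt0 ?divr_gt0// lt_min k0 ltr01.
have [r r0 Hr] := H b b0.
have C1 : 0 < 4 * (C + 1) by lra.
exists (Num.min 1 (Num.min r (e / (4 * (C + 1))))).
  by rewrite !lt_min ltr01 r0 divr_gt0.
move=> h /andP[h0]; rewrite !lt_min => /andP[h1 /andP[hr hC]].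
have {Hr}Hr : ii p q (fun x => (g h x - f x + h * v x) ^+ 2) <= b * h ^+ 2.
  by apply: Hr; rewrite h0.
pose rem x := g h x - f x + h * v x.
have Irem : L2loc rem by apply: L2locD; [exact: L2locB|exact: L2locZ].
have Ia : L2loc (fun x => f x - h * v x) by apply: L2locB => //; exact: L2locZ.
pose S := ii p q (fun x => rem x ^+ 2).
have {}Hr : S <= b * h ^+ 2 by exact: Hr.
have S0 : 0 <= S by exact: ii_sqr_ge0.
have kh0 : 0 < k * h by rewrite mulr_gt0.
have X1 := ii_amgm p q kh0 Ia Irem.
set T := ii p q (fun x => (f x - h * v x) * rem x) in X1.
set Q := ii p q (fun x => (f x - h * v x) ^+ 2) in X1.
have QE : Q = F - 2 * h * B + h ^+ 2 * C.
  have Jf := L2loc_sqr If; have Jv := L2loc_sqr Iv; have Jfv := L2loc_mul If Iv.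
  have JA := L1locZ (2 * h) Jfv; have JB := L1locZ (h ^+ 2) Jv.
  rewrite /F /B /C -(iiZ p q (2 * h) Jfv) -(iiZ p q (h ^+ 2) Jv).
  rewrite -(iiB p q Jf JA) -(iiD p q (L1locB Jf JA) JB).
  by apply: eq_ii => x _; ring.
have gE : ii p q (fun x => g h x ^+ 2) = Q + 2 * T + S.
  have Ja := L2loc_sqr Ia; have Jr := L2loc_sqr Irem; have Jar := L2loc_mul Ia Irem.
  have JA := L1locZ 2 Jar.
  rewrite /Q /T /S -(iiZ p q 2 Jar) -(iiD p q Ja JA) -(iiD p q (L1locD Ja JA) Jr).
  by apply: eq_ii => x _; rewrite /rem; ring.
have Q2 : Q <= 2 * F + 2 * (h ^+ 2 * C).
  have := ii_sqrD p q If (L2locZ (- h) Iv).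
  have -> : ii p q (fun x => (- h * v x) ^+ 2) = h ^+ 2 * C.
    by rewrite /C -iiZ; [apply: eq_ii => x _; ring|exact: L2loc_sqr].
  have -> : ii p q (fun x => (f x + - h * v x) ^+ 2) = Q.
    by apply: eq_ii => x _; ring.
  by [].
have h2 : h ^+ 2 <= h by rewrite expr2 ler_piMl// ltW.
have h21 : h ^+ 2 <= 1 by rewrite (le_trans h2)// ltW.
have Q3 : Q <= 2 * (F + C + 1).
  have : h ^+ 2 * C <= C by rewrite ler_piMl.
  lra.
have K1 : k * Q <= e / 4.
  apply: (@le_trans _ _ (k * (2 * (F + C + 1)))); first by rewrite ler_pM2l.
  rewrite /k le_eqVlt; apply/orP; left; apply/eqP; field.
  by rewrite gt_eqF//; lra.
have K2 : k^-1 * b <= e / 4.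
  rewrite /b mulrCA ler_piMr ?divr_ge0 ?(ltW e0)//.
  by rewrite ler_pdivrMl// mulr1 ge_min lexx.
have K3 : b <= e / 4.
  by rewrite /b ler_piMr ?divr_ge0 ?(ltW e0)// ge_min lexx orbT.
have K4 : h * C <= e / 4.
  move: hC; rewrite ltr_pdivlMr// => hC.
  have : h * (4 * (C + 1)) = 4 * (h * C) + 4 * h by ring.
  lra.
rewrite gE QE in Q3 *.
have T2 : 2 * T <= h * (e / 4) + h * (e / 4).
  apply: (@le_trans _ _ (h * (k * Q) + h * (k^-1 * b))).
    have E1 : 2 * (k * h / 2 * Q) = h * (k * Q) by field.
    have E2 : 2 * ((2 * (k * h))^-1 * S) = (k * h)^-1 * S.
      by field; rewrite !gt_eqF.
    have E3 : (k * h)^-1 * S <= h * (k^-1 * b).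
      rewrite ler_pdivrMl//.
      by have -> : k * h * (h * (k^-1 * b)) = b * h ^+ 2 by [field; rewrite gt_eqF].
    have X2 : 2 * T <= 2 * (k * h / 2 * Q) + 2 * ((2 * (k * h))^-1 * S).
      by rewrite -mulrDr ler_pM2l.
    by apply: (le_trans X2); rewrite E1 E2 lerD2l.
  by rewrite lerD// ler_pM2l.
have S2 : S <= h * (e / 4).
  apply: (le_trans Hr); apply: (@le_trans _ _ (b * h)); first by rewrite ler_pM2l.
  by rewrite mulrC ler_pM2l.
have K5 : h ^+ 2 * C <= h * (e / 4) by rewrite expr2 -mulrA ler_pM2l.
lra.
Qed.

(** Here g(h) = z + h w + o(h) in L2: the linear Taylor term produces the derivative, and the
    quadratic one is O(h^2), hence absorbed in e h. The Taylor inequality is a hypothesis because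
    its constant depends on the range of the field. *)
Lemma ii_taylor_step p q (U V : R -> R) K (g : R -> R -> R) z w :
  L2loc z -> L2loc w -> (forall h, L2loc (g h)) -> 0 <= K ->
  (forall h, L1loc (fun x => U (g h x))) -> L1loc (fun x => U (z x)) ->
  L2loc (fun x => V (z x)) ->
  (exists2 r, 0 < r & forall h, 0 < h < r -> forall x, p <= x <= q ->
     U (g h x) <= U (z x) + V (z x) * (g h x - z x) + K * (g h x - z x) ^+ 2) ->
  (forall e, 0 < e -> exists2 r, 0 < r & forall h, 0 < h < r ->
     ii p q (fun x => (g h x - z x - h * w x) ^+ 2) <= e * h ^+ 2) ->
  forall e, 0 < e -> exists2 r, 0 < r & forall h, 0 < h < r ->
     ii p q (fun x => U (g h x)) <=
     ii p q (fun x => U (z x)) + h * ii p q (fun x => V (z x) * w x) + e * h.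
Proof.
move=> Iz Iw Ig K0 IUg IUz IVz [r1 r10 Hr1] H e e0.
set A := ii p q (fun x => U (z x)); set B := ii p q (fun x => V (z x) * w x).
pose C := ii p q (fun x => V (z x) ^+ 2).
pose P := ii p q (fun x => w x ^+ 2).
have C0 : 0 <= C by exact: ii_sqr_ge0.
have P0 : 0 <= P by exact: ii_sqr_ge0.
pose k := e / (2 * (C + 1)).
have C1 : 0 < 2 * (C + 1) by lra.
have k0 : 0 < k by rewrite divr_gt0.
pose b := Num.min 1 (k * e / 2).
have b0 : 0 < b by rewrite lt_min ltr01 divr_gt0// mulr_gt0.
have [r2 r20 Hr2] := H b b0.
have KP : 0 < 2 * K * (P + 1) + 1.
  by rewrite ltr_wpDl// mulr_ge0// ?mulr_ge0//; lra.
exists (Num.min r1 (Num.min r2 (e / 2 / (2 * K * (P + 1) + 1)))).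
  by rewrite !lt_min r10 r20 !divr_gt0.
move=> h /andP[h0]; rewrite !lt_min => /andP[hr1 /andP[hr2 hK]].
have {Hr2}Hr2 : ii p q (fun x => (g h x - z x - h * w x) ^+ 2) <= b * h ^+ 2.
  by apply: Hr2; rewrite h0.
have {}Hr1 : forall x, p <= x <= q ->
     U (g h x) <= U (z x) + V (z x) * (g h x - z x) + K * (g h x - z x) ^+ 2.
  by apply: Hr1; rewrite h0.
pose rem x := g h x - z x - h * w x.
have IhW : L2loc (fun x => h * w x) by exact: L2locZ.
have Irem : L2loc rem by apply: L2locB => //; exact: L2locB.
have Idif : L2loc (fun x => g h x - z x) by exact: L2locB.
pose S := ii p q (fun x => rem x ^+ 2).
have {}Hr2 : S <= b * h ^+ 2 by exact: Hr2.
have S0 : 0 <= S by exact: ii_sqr_ge0.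
have I1 : L1loc (fun x => V (z x) * (g h x - z x)) by exact: L2loc_mul.
have I2 : L1loc (fun x => K * (g h x - z x) ^+ 2) by apply: L1locZ; exact: L2loc_sqr.
have H1 : ii p q (fun x => U (g h x)) <=
    A + ii p q (fun x => V (z x) * (g h x - z x)) +
    K * ii p q (fun x => (g h x - z x) ^+ 2).
  rewrite -iiZ; last exact: L2loc_sqr.
  rewrite -iiD// -iiD//; last exact: L1locD.
  by apply: le_ii => //; apply: L1locD => //; exact: L1locD.
have H2 : ii p q (fun x => V (z x) * (g h x - z x)) =
    h * B + ii p q (fun x => V (z x) * rem x).
  rewrite -iiZ; last exact: L2loc_mul.
  rewrite -iiD; [|by apply: L1locZ; exact: L2loc_mul|exact: L2loc_mul].
  by apply: eq_ii => x _; rewrite /rem; ring.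
have H3 : ii p q (fun x => (g h x - z x) ^+ 2) <= 2 * h ^+ 2 * P + 2 * S.
  have := ii_sqrD p q IhW Irem.
  have -> : ii p q (fun x => (h * w x) ^+ 2) = h ^+ 2 * P.
    by rewrite /P -iiZ; [apply: eq_ii => x _; ring|exact: L2loc_sqr].
  have -> : ii p q (fun x => (h * w x + rem x) ^+ 2) = ii p q (fun x => (g h x - z x) ^+ 2).
    by apply: eq_ii => x _; rewrite /rem; ring.
  by rewrite -/S; lra.
have kh0 : 0 < k * h by rewrite mulr_gt0.
have H4 := ii_amgm p q kh0 IVz Irem; rewrite -/C -/S in H4.
have b1 : b <= 1 by rewrite /b ge_min lexx.
have b2 : b <= k * e / 2 by rewrite /b ge_min lexx orbT.
have h2 : 0 < h ^+ 2 by rewrite exprn_gt0.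
have S1 : S <= h ^+ 2.
  by apply: (le_trans Hr2); rewrite ler_piMl// ltW.
have S2 : (2 * (k * h))^-1 * S <= h * (e / 4).
  have kh2 : 0 < 2 * (k * h) by rewrite (mulr_gt0 _ kh0).
  rewrite ler_pdivrMl//; apply: (le_trans Hr2).
  apply: (@le_trans _ _ (k * e / 2 * h ^+ 2)); first by rewrite ler_pM2r.
  by rewrite le_eqVlt; apply/orP; left; apply/eqP; field.
have S3 : k * h / 2 * C <= h * (e / 4).
  have : k * (C + 1) = e / 2 by rewrite /k; field; rewrite gt_eqF//; lra.
  have : k * h / 2 * C = h * (k * (C + 1)) / 2 - h * k / 2 by field.
  move=> -> ->; have : 0 < h * k by rewrite mulr_gt0.
  lra.
have S4 : K * ii p q (fun x => (g h x - z x) ^+ 2) <= h * (e / 2).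
  apply: (@le_trans _ _ (K * (2 * h ^+ 2 * P + 2 * h ^+ 2))).
    by rewrite ler_wpM2l//; lra.
  have -> : K * (2 * h ^+ 2 * P + 2 * h ^+ 2) = h * (h * (2 * K * (P + 1))) by ring.
  rewrite ler_pM2l//; move: hK; rewrite ltr_pdivlMr// => hK.
  have : h * (2 * K * (P + 1) + 1) = h * (2 * K * (P + 1)) + h by ring.
  lra.
lra.
Qed.

End expansions.

(** * Energy inequality and finite propagation *)

Section energy.
Context {R : realType}.
Implicit Types (f g phi : R -> R) (p q : R).

Local Notation mu := (@lebesgue_measure R).

Context (U V DV : R -> R) (psi d pi : R -> R -> R).
Context (UV : forall x : R, is_derive x 1 U (V x)) (U0 : forall x, 0 <= U x).
Context (VD : forall x : R, is_derive x 1 V (DV x)) (cDV : continuous DV).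
Context (sol : field_solution V psi d pi).

Let pri t : primitive (psi t) (d t). Proof. exact: field_primitive sol t. Qed.
Let Id t : L2loc (d t). Proof. exact: field_L2_d sol t. Qed.
Let Ipi t : L2loc (pi t). Proof. exact: field_L2_pi sol t. Qed.
Let cpsi t : continuous (psi t).
Proof. exact: primitive_continuous (Id t) (@pri t). Qed.
Let Ipsi t : L2loc (psi t). Proof. exact: L2loc_continuous. Qed.
Let cV : continuous V.
Proof. by apply: derivable_continuous => x; case: (VD x). Qed.
Let cU : continuous U.
Proof. by apply: derivable_continuous => x; case: (UV x). Qed.
Let IV t : L2loc (fun x => V (psi t x)).
Proof.
by apply: L2loc_continuous => x; apply: continuous_comp; [exact: cpsi|exact: cV].
Qed.
Let IU t : L1loc (fun x => U (psi t x)).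
Proof.
by apply: L1loc_continuous => x; apply: continuous_comp; [exact: cpsi|exact: cU].
Qed.
Let u (c t x : R) := pi t x + c * d t x.
Let Iu c t : L2loc (u c t). Proof. by apply: L2locD => //; exact: L2locZ. Qed.

(** Adding s V(psi(t0, x)) to [u] transported along its characteristic cancels the source at s = 0.
    The remaining derivative V(psi(t0, x)) - V(psi(t0 + s, x - c s)) is uniformly small by
    continuity, and [weak_mean_value] turns this into an o(h) bound in L2. *)
Lemma field_transport_strong c t0 p q : c ^+ 2 = 1 -> p < q ->
  forall e, 0 < e -> exists2 r, 0 < r & forall h, 0 < h < r ->
  ii p q (fun x => (u c (t0 + h) (x + - c * h) - u c t0 x + h * V (psi t0 x)) ^+ 2)
    <= e * h ^+ 2.
Proof.
move=> c1 pq e e0.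
have cN1 : `|- c| <= 1.
  rewrite normrN -(@ler_pXn2r _ 2)// ?nnegrE// real_normK ?num_real//.
  by rewrite c1 expr1n.
(* e1^2 (q - p) <= e, because e1 <= 1 and e1 (q - p) <= e. *)
pose e1 := Num.min 1 (e / (q - p)).
have qp : 0 < q - p by rewrite subr_gt0.
have e10 : 0 < e1 by rewrite lt_min ltr01 divr_gt0.
have [r r0 Hr] := field_comp_cont sol t0 p q VD cDV cN1 e10.
exists r => // h /andP[h0 hr].
pose W s x := u c (t0 + s) (x + - c * s) + s * V (psi t0 x).
pose G s x := V (psi t0 x) - V (psi (t0 + s) (x + - c * s)).
have IW s : L2loc (W s).
  by apply: L2locD; [exact: (L2loc_shift _ (Iu c (t0 + s)))|exact: L2locZ].
have IG s : L2loc (G s).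
  by apply: L2locB => //; exact: (L2loc_shift _ (IV (t0 + s))).
have -> : ii p q (fun x => (u c (t0 + h) (x + - c * h) - u c t0 x + h * V (psi t0 x)) ^+ 2) =
    ii p q (fun x => (W h x - W 0 x) ^+ 2).
  apply: eq_ii => x _; rewrite /W addr0 mulr0 addr0 mul0r addr0; ring.
rewrite mulrC; apply: (@weak_mean_value R W G) => //; last first.
  move=> s /andP[s0 sh].
  apply: (@le_trans _ _ (ii p q (fun=> e1 ^+ 2))).
    apply: le_ii; [exact: L2loc_sqr|exact: L1loc_cst|] => x xI.
    have sr : `|s| < r by rewrite ger0_norm// (le_lt_trans sh).
    have := Hr s sr x xI; rewrite distrC -/(G s x) => H.
    by rewrite -(real_normK (num_real (G s x))) ler_pXn2r ?nnegrE// ltW.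
  rewrite ii_cst ?(ltW pq)// -ler_pdivlMr//.
  have e11 : e1 <= 1 by rewrite /e1 ge_min lexx.
  apply: (@le_trans _ _ e1); last by rewrite /e1 ge_min lexx orbT.
  by rewrite expr2 ler_piMl// ltW.
move=> phi tphi phi0 s _.
have Iphi := L2loc_test tphi.
have shiftE (f : R -> R) (k : R) : L2loc f -> ii p q (fun x => f (x + - c * k) * phi x) =
    \int[mu]_x (f x * phi (x + c * k)).
  move=> If.
  have Is : L2loc (fun x => phi (x + c * k)) by exact: L2loc_shift.
  have -> : ii p q (fun x => f (x + - c * k) * phi x) =
      ii p q (fun x => f (x + - c * k) * phi ((x + - c * k) + c * k)).
    by apply: eq_ii => x _; congr (_ * phi _); ring.
  rewrite (@ii_shift R p q (- c * k) (fun y => f y * phi (y + c * k))); last exact: L2loc_mul.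
  rewrite (@Rintegral_test R (p + - c * k) (q + - c * k))// => x H.
  apply: phi0; apply: contra H => /andP[? ?]; apply/andP; split; lra.
(* [moving_test] translates by c times the absolute time; this shift recentres the test function at
   [t0]. *)
pose phi1 y := phi (y + - c * t0).
have tphi1 : test_function phi1 by exact: test_function_shift.
have cu : L2cont (u c).
  by apply: L2contD => //; [exact: field_cont_pi sol|exact: field_cont_d sol].
have phi1E (x k : R) : phi1 (x + c * (t0 + k)) = phi (x + c * k).
  by rewrite /phi1; congr phi; ring.
pose L t (f : R -> R) := - c * (\int[mu]_x (u c t x * derive1 f x)) - \int[mu]_x (V (psi t x) * f x).
have := @moving_test R (u c) L c (Iu c) cu (field_transport_weak sol c1) phi1 tphi1 (t0 + s).
rewrite /L derive1_shift; last by case: tphi1.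
set A := \int[mu]_x (u c (t0 + s) x * _); set B := \int[mu]_x (V _ * _).
(* The motion of the test function cancels the transport term of the equation; only the source is
   left. *)
have -> : - c * A - B + c * A = - B by ring.
have -> : B = ii p q (fun x => V (psi (t0 + s) (x + - c * s)) * phi x).
  rewrite (shiftE (fun x => V (psi (t0 + s) x)))// /B; congr Rintegral.
  by apply/funext => x; rewrite phi1E.
rewrite addrC => /is_derive_shiftr D1.
have D2 := @is_derive_mulr R (fun s => s) (fun=> ii p q (fun x => V (psi t0 x) * phi x)) s 1 0
  (is_derive_id s 1) (is_derive_cst _ s 1).
have := is_deriveD D1 D2.
rewrite mulr0 add0r mul1r => D.
have -> : ii p q (fun x => G s x * phi x) =
    - ii p q (fun x => V (psi (s + t0) (x + - c * s)) * phi x)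
    + ii p q (fun x => V (psi t0 x) * phi x).
  have I1 : L1loc (fun x => V (psi (s + t0) (x + - c * s)) * phi x).
    apply: L2loc_mul => //; exact: (L2loc_shift _ (IV (s + t0))).
  have I2 : L1loc (fun x => V (psi t0 x) * phi x) by exact: L2loc_mul.
  rewrite addrC -iiB//; apply: eq_ii => x _.
  by rewrite /G (addrC t0); ring.
have -> : (fun t => ii p q (fun x => W t x * phi x)) =
  ((fun x => \int[mu]_x0 (u c (x + t0) x0 * phi1 (x0 + c * (x + t0)))) +
      (fun y => y * ii p q (fun x => V (psi t0 x) * phi x)))%R.
  apply/funext => k /=.
  have I1 : L1loc (fun x => u c (t0 + k) (x + - c * k) * phi x).
    apply: L2loc_mul => //; exact: (L2loc_shift _ (Iu c (t0 + k))).
  have I2 : L1loc (fun x => k * (V (psi t0 x) * phi x)).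
    by apply: L1locZ; exact: L2loc_mul.
  have -> : ii p q (fun x => W k x * phi x) =
    ii p q (fun x => u c (t0 + k) (x + - c * k) * phi x) +
    ii p q (fun x => k * (V (psi t0 x) * phi x)).
    by rewrite -iiD//; apply: eq_ii => x _; rewrite /W; ring.
  rewrite shiftE// iiZ; last exact: L2loc_mul.
  rewrite fctE; congr (_ + _); rewrite (addrC k); congr Rintegral.
  by apply/funext => x; rewrite phi1E.
exact: D.
Qed.

(** The scheme of [field_transport_strong] without motion: the derivative of psi(t0 + s) - s pi(t0)
    is pi(t0 + s) - pi(t0), small by [field_cont_pi]. *)
Lemma field_psi_strong t0 p q : p < q ->
  forall e, 0 < e -> exists2 r, 0 < r & forall h, 0 < h < r ->
  ii p q (fun x => (psi (t0 + h) x - psi t0 x - h * pi t0 x) ^+ 2) <= e * h ^+ 2.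
Proof.
move=> pq e e0; have [r r0 Hr] := field_cont_pi sol t0 p q e0.
exists r => // h /andP[h0 hr].
pose W s x := psi (t0 + s) x - s * pi t0 x.
pose G s x := pi (t0 + s) x - pi t0 x.
have IW s : L2loc (W s) by apply: L2locB => //; exact: L2locZ.
have IG s : L2loc (G s) by exact: L2locB.
have -> : ii p q (fun x => (psi (t0 + h) x - psi t0 x - h * pi t0 x) ^+ 2) =
    ii p q (fun x => (W h x - W 0 x) ^+ 2).
  by apply: eq_ii => x _; rewrite /W addr0 mul0r subr0; ring.
rewrite mulrC; apply: (@weak_mean_value R W G) => //; last first.
  move=> s /andP[s0 sh]; apply: Hr.
  by rewrite addrAC subrr add0r ger0_norm// (le_lt_trans sh).
move=> phi tphi phi0 s _; have Iphi := L2loc_test tphi.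
have D1 := field_eq_psi sol tphi (s + t0).
move/is_derive_shiftr : D1 => D1.
have D2 := @is_derive_mulr R (fun s => s) (fun=> ii p q (fun x => pi t0 x * phi x)) s 1 0
  (is_derive_id s 1) (is_derive_cst _ s 1).
have := is_deriveB D1 D2.
rewrite mulr0 add0r mul1r (Rintegral_test _ phi0) => D.
have -> : ii p q (fun x => G s x * phi x) =
    ii p q (fun x => pi (s + t0) x * phi x) - ii p q (fun x => pi t0 x * phi x).
  rewrite -iiB; [|exact: L2loc_mul..].
  by apply: eq_ii => x _; rewrite /G (addrC t0); ring.
have -> : (fun t => ii p q (fun x => W t x * phi x)) =
  ((fun x => \int[mu]_x0 (psi (x + t0) x0 * phi x0)) -
      (fun y => y * ii p q (fun x => pi t0 x * phi x)))%R.
  apply/funext => k /=.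
  rewrite !fctE -iiZ; last exact: L2loc_mul.
  rewrite (Rintegral_test _ phi0) -iiB; last 2 first.
  - exact: L2loc_mul.
  - by apply: L1locZ; exact: L2loc_mul.
  by apply: eq_ii => x _; rewrite /W (addrC k); ring.
exact: D.
Qed.

Definition energy_density t x := (pi t x ^+ 2 + d t x ^+ 2) / 2 + U (psi t x).

Lemma L1loc_energy t : L1loc (energy_density t).
Proof.
have := L1locD (L1locZ (1 / 2) (L1locD (L2loc_sqr (Ipi t)) (L2loc_sqr (Id t)))) (IU t).
by apply: eq_L1loc => x; rewrite /energy_density mulrC mul1r.
Qed.

Lemma energy_density_ge0 t x : 0 <= energy_density t x.
Proof. by rewrite addr_ge0// divr_ge0// addr_ge0// sqr_ge0. Qed.

Lemma ii_energyE t p q : ii p q (energy_density t) =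
  (ii p q (fun x => pi t x ^+ 2) + ii p q (fun x => d t x ^+ 2)) / 2 +
  ii p q (fun x => U (psi t x)).
Proof.
have J1 := L2loc_sqr (Ipi t); have J2 := L2loc_sqr (Id t).
rewrite -iiD// mulrC -iiZ; last exact: L1locD.
rewrite -iiD//; last by apply: L1locZ; exact: L1locD.
by apply: eq_ii => x _; rewrite /energy_density mulrC.
Qed.

Lemma ii_charE t p q : ii p q (fun x => u 1 t x ^+ 2) + ii p q (fun x => u (-1) t x ^+ 2) =
  2 * (ii p q (fun x => pi t x ^+ 2) + ii p q (fun x => d t x ^+ 2)).
Proof.
have J1 := L2loc_sqr (Ipi t); have J2 := L2loc_sqr (Id t).
have J3 := L2loc_sqr (Iu 1 t); have J4 := L2loc_sqr (Iu (-1) t).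
rewrite -!iiD// -iiZ; last exact: L1locD.
by apply: eq_ii => x _; rewrite /u; ring.
Qed.

(** Up to the potential, the energy is a quarter of the squares of pi + d and pi - d, each expanded
    along its own characteristic; the translates of [p, q] by h and by -h both contain
    [p + h, q - h]. The first-order terms cancel: the squares contribute -h times the integral of
    V(psi) pi, the potential +h times it. *)
Lemma energy_step t0 p q : p < q ->
  forall e, 0 < e -> exists2 r, 0 < r & forall h, 0 < h < r ->
  ii (p + h) (q - h) (energy_density (t0 + h)) <= ii p q (energy_density t0) + e * h.
Proof.
move=> pq e e0; have e1 : 0 < e by [].
have sq1 : (1 : R) ^+ 2 = 1 by rewrite expr1n.
have sqN1 : (-1 : R) ^+ 2 = 1 by rewrite sqrrN expr1n.
have Ish c h : L2loc (fun x => u c (t0 + h) (x + - c * h)) by exact: (L2loc_shift _ (Iu c (t0 + h))).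
have [r1 r10 H1] := ii_sqr_expand (Iu 1 t0) (IV t0) (Ish 1) (field_transport_strong t0 sq1 pq) e1.
have [r2 r20 H2] := ii_sqr_expand (Iu (-1) t0) (IV t0) (Ish (-1)) (field_transport_strong t0 sqN1 pq) e1.
have [M M0 HM] := continuous_bounded_segment p q (@cpsi t0).
have [K K0 HK] := continuous_bounded_segment (- (M + 1)) (M + 1) cDV.
(* Error budget: e/4 from each of the two squares, after the factor 1/4, and e/2 from the
   potential. *)
have e2 : 0 < e / 2 by rewrite divr_gt0.
have taylor : exists2 r, 0 < r & forall h, 0 < h < r -> forall x, p <= x <= q ->
    U (psi (t0 + h) x) <= U (psi t0 x) + V (psi t0 x) * (psi (t0 + h) x - psi t0 x) +
      K * (psi (t0 + h) x - psi t0 x) ^+ 2.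
  have [r r0 Hr] := field_sup_cont sol t0 p q ltr01.
  exists r => // h /andP[h0 hr] x xI.
  have hr' : `|t0 + h - t0| < r by rewrite addrAC subrr add0r gtr0_norm.
  have := Hr _ hr' x xI; have := HM x xI.
  rewrite !ler_norml => /andP[a1 a2] /andP[b1 b2].
  have zI : - (M + 1) <= psi t0 x <= M + 1 by apply/andP; split; lra.
  have yI : - (M + 1) <= psi (t0 + h) x <= M + 1 by apply/andP; split; lra.
  have := taylor1_le UV VD HK zI yI.
  by rewrite ler_norml => /andP[_]; lra.
have [r3 r30 H3] := ii_taylor_step (Ipsi t0) (Ipi t0) (fun h => Ipsi (t0 + h)) K0
  (fun h => IU (t0 + h)) (IU t0) (IV t0) taylor (field_psi_strong t0 pq) e2.
exists (Num.min r1 (Num.min r2 r3)); first by rewrite !lt_min r10 r20.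
move=> h /andP[h0]; rewrite !lt_min => /andP[hr1 /andP[hr2 hr3]].
have {}H1 := H1 h (introT andP (conj h0 hr1)).
have {}H2 := H2 h (introT andP (conj h0 hr2)).
have {}H3 := H3 h (introT andP (conj h0 hr3)).
rewrite !ii_energyE.
have E0 := ii_charE t0 p q.
have E1 := ii_charE (t0 + h) (p + h) (q - h).
have S1 : ii (p + h) (q - h) (fun x => u 1 (t0 + h) x ^+ 2) <=
    ii p q (fun x => u 1 (t0 + h) (x + - 1 * h) ^+ 2).
  rewrite (@ii_shift R p q (- 1 * h) (fun x => u 1 (t0 + h) x ^+ 2)); last exact: L2loc_sqr.
  apply: ii_subset; [exact: L2loc_sqr|by move=> x; exact: sqr_ge0| |]; lra.
have S2 : ii (p + h) (q - h) (fun x => u (-1) (t0 + h) x ^+ 2) <=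
    ii p q (fun x => u (-1) (t0 + h) (x + - - 1 * h) ^+ 2).
  rewrite (@ii_shift R p q (- - 1 * h) (fun x => u (-1) (t0 + h) x ^+ 2)); last exact: L2loc_sqr.
  apply: ii_subset; [exact: L2loc_sqr|by move=> x; exact: sqr_ge0| |]; lra.
have S3 : ii (p + h) (q - h) (fun x => U (psi (t0 + h) x)) <= ii p q (fun x => U (psi (t0 + h) x)).
  apply: ii_subset; [exact: IU|by []| |]; lra.
have F : ii p q (fun x => u 1 t0 x * V (psi t0 x)) + ii p q (fun x => u (-1) t0 x * V (psi t0 x)) =
    2 * ii p q (fun x => V (psi t0 x) * pi t0 x).
  have J1 : L1loc (fun x => u 1 t0 x * V (psi t0 x)) by exact: L2loc_mul.
  have J2 : L1loc (fun x => u (-1) t0 x * V (psi t0 x)) by exact: L2loc_mul.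
  have J3 : L1loc (fun x => V (psi t0 x) * pi t0 x) by exact: L2loc_mul.
  by rewrite -iiD// -iiZ//; apply: eq_ii => x _; rewrite /u; ring.
set A1 := ii p q (fun x => u 1 t0 x * _) in F H1.
set A2 := ii p q (fun x => u (-1) t0 x * _) in F H2.
set A3 := ii p q (fun x => V (psi t0 x) * _) in F H3.
have Fh : h * A1 + h * A2 = 2 * (h * A3) by rewrite -mulrDr F; ring.
have G1 : 2 * h * A1 = 2 * (h * A1) by rewrite mulrA.
have G2 : 2 * h * A2 = 2 * (h * A2) by rewrite mulrA.
rewrite G1 in H1; rewrite G2 in H2.
lra.
Qed.

(** For the squares, W(t)^2 <= W(s)^2 + 2 W(t) (W(t) - W(s)), so that only the norm at the fixed
    time [t] enters the weight [k]; the potential at time [s] is uniformly close on the segment. *)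
Lemma energy_left_cont t p q e : 0 < e -> exists2 r, 0 < r & forall s, `|s - t| < r ->
  ii p q (energy_density t) <= ii p q (energy_density s) + e.
Proof.
move=> e0.
have sq (W : R -> R -> R) : (forall t, L2loc (W t)) -> L2cont W ->
    exists2 r, 0 < r & forall s, `|s - t| < r ->
    ii p q (fun x => W t x ^+ 2) <= ii p q (fun x => W s x ^+ 2) + e / 2.
  move=> IW cW; set S := ii p q (fun x => W t x ^+ 2).
  have S0 : 0 <= S by exact: ii_sqr_ge0.
  pose k := e / (4 * (S + 1)).
  have S1 : 0 < 4 * (S + 1) by lra.
  have k0 : 0 < k by rewrite divr_gt0.
  have ke : 0 < k * (e / 4) by rewrite mulr_gt0// divr_gt0.
  have [r r0 Hr] := cW t p q _ ke.
  exists r => // s /Hr; set D := ii p q _ => HD.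
  have Idf : L2loc (fun x => W s x - W t x) by exact: L2locB.
  have A := ii_amgm p q k0 (IW t) (L2locN Idf).
  have E : ii p q (fun x => (- (W s x - W t x)) ^+ 2) = D.
    by apply: eq_ii => x _; ring.
  rewrite E -/S in A.
  have J1 := L2loc_sqr (IW s); have J2 := L2loc_mul (IW t) (L2locN Idf).
  have J3 := L2loc_sqr (IW t).
  have B : S <= ii p q (fun x => W s x ^+ 2) + 2 * ii p q (fun x => W t x * - (W s x - W t x)).
    rewrite -iiZ// -iiD//; last exact: L1locZ.
    apply: le_ii => //; first by apply: L1locD => //; exact: L1locZ.
    by move=> x _; have := sqr_ge0 (W s x - W t x); nra.
  have C : k * S <= e / 4.
    rewrite /k mulrAC ler_pdivrMr// ; have : e * S <= e * (S + 1) by rewrite ler_pM2l// lerDl.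
    lra.
  have D1 : (2 * k)^-1 * D <= e / 8.
    have k2 : 0 < 2 * k by lra.
    rewrite ler_pdivrMl//; apply: (le_trans HD); lra.
  lra.
have [r1 r10 H1] := sq pi Ipi (field_cont_pi sol).
have [r2 r20 H2] := sq d Id (field_cont_d sol).
have c0 : `|0 : R| <= 1 by rewrite normr0.
pose L := `|q - p| + 1.
have L0 : 0 < L by rewrite ltr_wpDl.
have e2 : 0 < e / 2 / L by rewrite !divr_gt0.
have [r3 r30 H3] := field_comp_cont sol t p q UV cV c0 e2.
exists (Num.min r1 (Num.min r2 r3)); first by rewrite !lt_min r10 r20.
move=> s; rewrite !lt_min => /andP[/H1 {}H1 /andP[/H2 {}H2 hs]].
have H4 : ii p q (fun x => U (psi t x)) <= ii p q (fun x => U (psi s x)) + e / 2.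
  have [pq|/ltW qp] := leP p q; last by rewrite !(ii_empty _ qp) add0r divr_ge0// ltW.
  apply: (@le_trans _ _ (ii p q (fun x => U (psi s x) + e / 2 / L))).
    apply: le_ii => //; first by apply: L1locD => //; exact: L1loc_cst.
    move=> x xI; have := H3 _ hs x xI.
    rewrite mul0r addr0 (_ : t + (s - t) = s); last by ring.
    by rewrite ler_norml => /andP[+ _]; lra.
  rewrite iiD//; last exact: L1loc_cst.
  rewrite ii_cst// lerD2l mulrAC ler_pdivrMr// ler_pM2l ?divr_gt0//.
  by rewrite /L (le_trans (ler_norm _))// lerDl.
rewrite !ii_energyE; lra.
Qed.

(** [energy_step] is the Dini condition for the energy over [p + t, q - t]; the second condition of
    [dini_nonincreasing] combines [energy_left_cont] on a fixed interval with the inclusion of this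
    interval in the earlier ones. Once the interval has closed, the left side is 0. *)
Lemma energy_cone T p q : 0 <= T ->
  ii (p + T) (q - T) (energy_density T) <= ii p q (energy_density 0).
Proof.
move=> T0; have [qp|pq] := leP (q - T) (p + T).
  by rewrite (ii_empty _ qp) ii_ge0// => x _; exact: energy_density_ge0.
pose f t := ii (p + t) (q - t) (energy_density t).
have -> : ii p q (energy_density 0) = f 0 by rewrite /f addr0 subr0.
apply: (@dini_nonincreasing R f T T0).
- move=> t /andP[t0 tT] e e0.
  have pqt : p + t < q - t by lra.
  have [r r0 Hr] := energy_step t pqt e0.
  exists r => // h /Hr; rewrite /f.
  have -> : p + t + h = p + (t + h) by ring.
  by have -> : q - t - h = q - (t + h) by ring.
- move=> t /andP[t0 tT] e e0.
  have [r r0 Hr] := energy_left_cont t (p + t) (q - t) e0.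
  exists r => // s /andP[s0 st] str.
  have sr : `|s - t| < r by rewrite ler0_norm ?subr_le0// opprB; lra.
  apply: (le_trans (Hr s sr)); rewrite lerD2r.
  apply: ii_subset; [exact: L1loc_energy|exact: energy_density_ge0| |]; lra.
Qed.

(* The energy in the backward cone controls the momentum, and the field moves
   at speed [pi]. *)
Lemma field_displacement T p q : 0 < T -> p < q ->
  ii p q (fun x => (psi T x - psi 0 x) ^+ 2) <=
  T ^+ 2 * (2 * ii (p - T) (q + T) (energy_density 0)).
Proof.
move=> T0 pq; apply: (@weak_mean_value R psi pi) => //.
- move=> phi tphi phi0 t _; have := field_eq_psi sol tphi t.
  rewrite (Rintegral_test _ phi0).
  by under [X in is_derive _ _ X _ -> _]eq_fun do rewrite (Rintegral_test _ phi0).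
- move=> t /andP[t0 tT].
  have := @energy_cone t (p - t) (q + t) t0.
  rewrite subrK addrK => H.
  apply: (@le_trans _ _ (2 * ii p q (energy_density t))).
    rewrite -iiZ; last exact: L1loc_energy.
    apply: le_ii; [exact: L2loc_sqr|by apply: L1locZ; exact: L1loc_energy|].
    move=> x _; rewrite /energy_density; have := U0 (psi t x); have := sqr_ge0 (d t x).
    lra.
  rewrite ler_pM2l//; apply: (le_trans H).
  apply: ii_subset; [exact: L1loc_energy|exact: energy_density_ge0| |]; lra.
Qed.

End energy.

(** * The potential near its wells and the decay of the kink *)

Section two_well.
Context {R : realType}.
Context (U : R -> R) (a m : R).
Context (U_smooth : smooth U) (U_even : forall x, U (- x) = U x).
Context (U_two_well : two_well 7 U a m).

Local Notation mu := (@lebesgue_measure R).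

(** The radius makes the remainder k |z - a|^14 at most (m^2/4) (z - a)^2, which leaves half of the
    coefficient m^2/2 in the lower bound. *)
Lemma two_well_near : exists2 r, 0 < r & exists2 K, 0 <= K & forall z, `|z - a| < r ->
  m ^+ 2 / 4 * (z - a) ^+ 2 <= U z <= K * (z - a) ^+ 2.
Proof.
have [a0 m0 _ /eqO_exP[k k0 Hk] _] := U_two_well.
have /nbhs_ballP[r /= r0 Hr] := Hk.
have m2 : 0 < m ^+ 2 by rewrite exprn_gt0.
pose r' := Num.min r (Num.min 1 (m ^+ 2 / (4 * k))).
have k4 : 0 < 4 * k by rewrite mulr_gt0.
exists r'; first by rewrite !lt_min r0 ltr01 divr_gt0.
exists (m ^+ 2 / 2 + k); first by rewrite addr_ge0 ?(ltW k0)// divr_ge0// ltW.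
move=> z; rewrite !lt_min => /andP[zr /andP[z1 zk]].
have := Hr z; rewrite /ball/= distrC => /(_ zr).
rewrite normrX normr_id.
set t := `|z - a| in z1 zk *.
have t0 : 0 <= t by exact: normr_ge0.
have tE : (z - a) ^+ 2 = t ^+ 2 by rewrite /t real_normK ?num_real.
have t2 : 0 <= t ^+ 2 by exact: sqr_ge0.
have t14 : t ^+ (2 * 7) <= t ^+ 2 * t.
  rewrite (_ : (2 * 7)%N = (2 + (1 + 11))%N)// !exprD expr1 ler_wpM2l//.
  by rewrite ler_piMr// exprn_ile1// ltW.
rewrite tE ler_norml => /andP[H1 H2].
have kt : k * t <= m ^+ 2 / 4.
  by move: zk; rewrite ltr_pdivlMr// => zk; rewrite -(ler_pM2l (ltr0n R 4)) /=; lra.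
have H3 : k * t ^+ (2 * 7) <= t ^+ 2 * (k * t).
  by rewrite [leRHS]mulrCA ler_pM2l.
have H4 : t ^+ 2 * (k * t) <= t ^+ 2 * (m ^+ 2 / 4) by rewrite ler_wpM2l.
have H5 : t ^+ 2 * (k * t) <= k * t ^+ 2.
  by rewrite mulrC -mulrA ler_pM2l// mulrC ler_piMr// ltW.
by apply/andP; split; lra.
Qed.

Lemma two_well_U0 : U a = 0.
Proof.
have [r r0 [K K0 H]] := two_well_near.
have := H a; rewrite subrr normr0 expr0n /= !mulr0 => /(_ r0).
by rewrite -eq_le => /eqP.
Qed.

Lemma two_well_ge0 x : 0 <= U x.
Proof.
have [_ _ Upos _ _] := U_two_well.
have [->|xa] := eqVneq x a; first by rewrite two_well_U0.
have [->|xa'] := eqVneq x (- a); first by rewrite U_even two_well_U0.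
exact/ltW/Upos.
Qed.

(** Where [two_well_near] does not apply, (z - a)^2 >= r^2, so the bound [B] of [U] on the segment
    is at most (B / r^2) (z - a)^2. Evenness transfers the estimate to the other well. *)
Lemma two_well_le M : exists2 K, 0 <= K & forall z, `|z| <= M ->
  U z <= K * (z - a) ^+ 2 /\ U z <= K * (z + a) ^+ 2.
Proof.
have [r r0 [K K0 H]] := two_well_near.
have [B B0 HB] := continuous_bounded_segment (- M) M (smooth_continuous U_smooth).
have r2 : 0 < r ^+ 2 by rewrite exprn_gt0.
have Br : 0 <= B / r ^+ 2 by rewrite divr_ge0// ltW.
exists (K + B / r ^+ 2); first by rewrite addr_ge0.
have key z : `|z| <= M -> U z <= (K + B / r ^+ 2) * (z - a) ^+ 2.
  move=> zM; have z2 : 0 <= (z - a) ^+ 2 by exact: sqr_ge0.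
  have [zr|zr] := ltP `|z - a| r.
    have /andP[_ H1] := H z zr; apply: (le_trans H1).
    by rewrite ler_wpM2r// lerDl.
  have Uz : U z <= B.
    by rewrite (le_trans (ler_norm _))// HB// -ler_norml.
  have H1 : B <= B / r ^+ 2 * (z - a) ^+ 2.
    rewrite mulrAC ler_pdivlMr// ler_wpM2l//.
    by rewrite -(real_normK (num_real (z - a))) ler_pXn2r ?nnegrE// ltW.
  apply: (le_trans Uz); apply: (le_trans H1).
  by rewrite mulrDl lerDr mulr_ge0.
move=> z zM; split; first exact: key.
rewrite -U_even; have -> : (z + a) ^+ 2 = (- z - a) ^+ 2 by ring.
by apply: key; rewrite normrN.
Qed.

Context (s : R -> R) (s_kink : kink U a s).

Let ds := derive1 s.

Lemma kink_derive (x : R) : is_derive x 1 s (ds x).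
Proof.
have [H _ _ _ _] := s_kink; have [H1 _] := H x.
by rewrite /ds derive1E; exact: (derivableP H1).
Qed.

Lemma kink_derive2 (x : R) : is_derive x 1 ds (derive1 U (s x)).
Proof.
have [H E _ _ _] := s_kink.
have := E x; rewrite /derive1n /= => /eqP; rewrite subr_eq0 => /eqP <-.
have [_ H2] := H x; rewrite derive1E; exact: (derivableP H2).
Qed.

Let sE (f df : R -> R) (x : R) : (forall y : R, is_derive y 1 f (df y)) ->
  is_derive x 1 (fun x => f (s x)) (df (s x) * ds x).
Proof. by move=> H; exact: (@is_derive1_comp R f s x _ _ (H (s x)) (kink_derive x)). Qed.

Lemma kink_continuous : continuous s.
Proof. by apply: derivable_continuous => x; case: (kink_derive x). Qed.

Lemma kink_derive1_continuous : continuous ds.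
Proof. by apply: derivable_continuous => x; case: (kink_derive2 x). Qed.

(** s'^2 - 2 U(s) is a constant [E]. If E > 0, the energy density is at least E/2 everywhere and the
    energy is infinite; if E < 0, the limit 0 of U(s) would make s'^2 negative far out. *)
Lemma kink_first_integral x : ds x ^+ 2 = 2 * U (s x).
Proof.
pose H x := ds x ^+ 2 + (-2) * U (s x).
have dH (y : R) : is_derive y 1 H 0.
  have D1 : is_derive y 1 (fun x => ds x ^+ 2) (2 * ds y ^+ 1 * derive1 U (s y)).
    exact: (is_derive_powr 2 (kink_derive2 y)).
  have D2 := sE y (fun z => is_derive_smooth z U_smooth).
  have D3 := @is_derive_mulr R (fun=> -2) _ y 0 _ (is_derive_cst (-2 : R) y 1) D2.
  apply: (is_derive_val_eq (is_deriveD D1 D3)).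
  by rewrite /= expr1; ring.
pose E := H 0.
have HE y : ds y ^+ 2 = E + 2 * U (s y).
  by rewrite /E (is_derive_0_is_cst 0 y dH) /H; ring.
suff E0 : E = 0 by rewrite HE E0 add0r.
have [_ _ fin _ [_ slim _]] := s_kink.
have Ulim : U (s x) @[x --> +oo] --> 0.
  rewrite -two_well_U0; apply: continuous_cvg => //.
  exact: smooth_continuous U_smooth a.
apply/eqP; rewrite eq_le; apply/andP; split.
  rewrite leNgt; apply/negP => Epos.
  move: fin; apply/negP; rewrite -leNgt leye_eq; apply/eqP.
  have : (\int[mu]_x (E / 2)%:E <= \int[mu]_x (derive1 s x ^+ 2 / 2 + U (s x))%:E)%E.
    apply: ge0_le_integral => //.
    - by move=> y _; rewrite lee_fin divr_ge0// ltW.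
    - apply/measurable_EFinP; apply: measurable_funD.
        apply: measurable_funM; last exact: measurable_cst.
        apply: (@measurable_funX _ _ _ setT ds 2).
        exact: continuous_measurable_fun kink_derive1_continuous.
      apply: continuous_measurable_fun => y.
      by apply: continuous_comp; [exact: kink_continuous|exact: smooth_continuous U_smooth _].
    - move=> y _; rewrite lee_fin -/(ds y) HE; have := two_well_ge0 (s y); lra.
  rewrite integral_cst//= -set_itvNyy lebesgue_measure_itv/= gt0_muley ?lte_fin ?divr_gt0//.
  by rewrite leye_eq => /eqP.
rewrite leNgt; apply/negP => Eneg.
have /(@cvgrPdist_lt _ _ _ _ _ _ _) /(_ (- E / 2)) := Ulim.
rewrite divr_gt0 ?oppr_gt0// => /(_ isT) [M [_ HM]].
have := HM (M + 1); rewrite ltrDl ltr01 => /(_ isT).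
rewrite sub0r normrN ger0_norm ?two_well_ge0// => H1.
have := sqr_ge0 (ds (M + 1)); rewrite HE; lra.
Qed.

(** For q = (s - a)^2, the first integral and the lower bound of [U] at the well give |q'| >= m q
    beyond [x0]. If q' > -m q at some point, then q' > 0 there; since [q] tends to 0, it has a
    positive interior maximum further on, where q' = 0 contradicts |q'| >= m q. So q' <= -m q, and q
    exp(m x) does not increase. *)
Lemma kink_sqr_decay : exists x0, forall x, x0 <= x ->
  (s x - a) ^+ 2 <= (s x0 - a) ^+ 2 * expR (m * x0) * expR (- (m * x)).
Proof.
have [_ m0 _ _ _] := U_two_well.
have [_ _ _ _ [_ slim _]] := s_kink.
have [r r0 [K K0 HK]] := two_well_near.
have /(@cvgrPdist_lt _ _ _ _ _ _ _) /(_ r r0) [M [_ HM]] := slim.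
pose x0 := M + 1.
have near0 x : x0 <= x -> `|s x - a| < r.
  by move=> x0x; rewrite distrC; apply: HM; rewrite (lt_le_trans _ x0x)// ltrDl.
pose q x := (s x - a) ^+ 2.
pose dq x := 2 * (s x - a) * ds x.
have q0 x : 0 <= q x by exact: sqr_ge0.
have qd (x : R) : is_derive x 1 q (dq x).
  have D1 : is_derive x 1 (fun x => s x - a) (ds x).
    have := is_deriveB (kink_derive x) (is_derive_cst a x 1).
    by rewrite subr0.
  by apply: (is_derive_val_eq (is_derive_powr 2 D1)); rewrite /dq /= expr1.
have cq : continuous q by apply: derivable_continuous => x; case: (qd x).
have dq_ge x : x0 <= x -> m * q x <= `|dq x|.
  move=> x0x; have mq0 : 0 <= m * q x by rewrite mulr_ge0// ltW.
  rewrite -(@ler_pXn2r _ 2)// ?nnegrE//.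
  rewrite real_normK ?num_real// /dq [leRHS]exprMn kink_first_integral.
  have /andP[H1 _] := HK _ (near0 x x0x).
  have : (m * q x) ^+ 2 <= (2 * (s x - a)) ^+ 2 * (2 * (m ^+ 2 / 4 * (s x - a) ^+ 2)).
    have -> : (2 * (s x - a)) ^+ 2 * (2 * (m ^+ 2 / 4 * (s x - a) ^+ 2)) =
      (m * q x) ^+ 2 + (m * q x) ^+ 2 by rewrite /q; field.
    by rewrite lerDl sqr_ge0.
  move/le_trans; apply; rewrite ler_wpM2l ?sqr_ge0//.
  by rewrite ler_pM2l.
have qlim : q x @[x --> +oo] --> 0.
  rewrite -(mulr0 0) -[X in X * _](subrr a) -[X in _ * X](subrr a).
  by apply: cvgM; apply: cvgB => //; exact: cvg_cst.
have dq_le x1 : x0 <= x1 -> dq x1 <= - m * q x1.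
  move=> x01; rewrite leNgt; apply/negP => H.
  have q1 : 0 < q x1.
    rewrite lt_neqAle q0 andbT; apply/negP => /eqP q1.
    move: H; rewrite -q1 mulr0 /dq; have : s x1 - a = 0.
      by apply/eqP; rewrite -sqrf_eq0 -/(q x1) -q1.
    by move=> ->; rewrite mulr0 mul0r ltxx.
  have mq1 : 0 < m * q x1 by rewrite mulr_gt0.
  have dq1 : 0 < dq x1.
    have := dq_ge x1 x01; have [dn|//] := leP (dq x1) 0.
    by rewrite ler0_norm// => H1; move: H; rewrite mulNr ltNge => /negP; case; lra.
  have /(@cvgrPdist_lt _ _ _ _ _ _ _) /(_ _ q1) [M' [_ HM']] := qlim.
  pose x3 := Num.max x1 M' + 1.
  have x13 : x1 < x3 by rewrite /x3 (@le_lt_trans _ _ (Num.max x1 M'))// ?ltrDl// le_max lexx.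
  have q3 : q x3 < q x1.
    have := HM' x3; rewrite sub0r normrN ger0_norm//; apply.
    by rewrite /x3 (@le_lt_trans _ _ (Num.max x1 M'))// ?ltrDl// le_max lexx orbT.
  have cw : {within `[x1, x3], continuous q} by exact: continuous_subspaceT.
  have [x2 x2I x2max] := EVT_max (ltW x13) cw.
  move: x2I; rewrite in_itv/= => /andP[x12 x23].
  have q2 : q x1 <= q x2 by apply: x2max; rewrite in_itv/= lexx ltW.
  have x2x3 : x2 < x3.
    by rewrite lt_neqAle x23 andbT; apply: contraTneq q3 => <-; rewrite -leNgt.
  (* The maximum is not at the left end, because q' > 0 at [x1]. *)
  have x1x2 : x1 < x2.
    rewrite lt_neqAle x12 andbT; apply/eqP => E.
    have [r' r'0 Hr'] := (is_deriveP _ _ _).1 (qd x1) (dq x1 / 2) (divr_gt0 dq1 (ltr0n R 2)).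
    pose h := Num.min (r' / 2) (x3 - x1).
    have h0 : 0 < h by rewrite lt_min divr_gt0//= subr_gt0.
    have hr : `|h| < r' by rewrite gtr0_norm// gt_min ltr_pdivrMr// ltr_pMr// ltr1n.
    have hx : x1 + h <= x3 by rewrite -lerBrDl ge_min lexx orbT.
    have := Hr' h hr; rewrite ler_norml (gtr0_norm h0) => /andP[H1 _].
    have : q (x1 + h) <= q x2 by apply: x2max; rewrite in_itv/= lerDl (ltW h0).
    have : 0 < h * dq x1 by rewrite mulr_gt0.
    rewrite -E; lra.
  have [_ dq2] : is_derive x2 1 q 0.
    apply: (@derive1_at_max R q x1 x3 x2 (ltW x13)).
    - by move=> t _; case: (qd t).
    - by rewrite in_itv/= x1x2.
    - by move=> t; rewrite in_itv/= => /andP[t1 t3]; apply: x2max; rewrite in_itv/= !ltW.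
  have := dq_ge x2 (le_trans x01 x12).
  have [_ <-] := qd x2; rewrite dq2 normr0 leNgt => /negP; apply.
  by rewrite mulr_gt0// (lt_le_trans q1).
exists x0 => x x0x.
pose g x := q x * expR (m * x).
have ed (y : R) : is_derive y 1 (fun y => expR (m * y)) (expR (m * y) * m).
  have D1 : is_derive y 1 (fun y : R => m * y) m.
    have H := @is_derive_mulr R (fun=> m) (fun z => z) y 0 1 (is_derive_cst m y 1) (is_derive_id y 1).
    by apply: (is_derive_val_eq H); rewrite mulr1 mul0r addr0.
  exact: (@is_derive1_comp R expR (fun y : R => m * y) y _ _ (is_derive_expR _) D1).
have gd (y : R) : is_derive y 1 g (q y * (expR (m * y) * m) + dq y * expR (m * y)).
  exact: is_derive_mulr.
have gle : g x <= g x0.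
  apply: (@ler0_derive1_nincr R g x0 x _ _ _ x0 x (lexx _) x0x (lexx _)).
  - by move=> y _; have [] := gd y.
  - move=> y; rewrite in_itv/= => /andP[y0 _]; rewrite derive1E; have [_ ->] := gd y.
    have -> : q y * (expR (m * y) * m) + dq y * expR (m * y) = (dq y - - m * q y) * expR (m * y) by ring.
    by rewrite mulr_le0_ge0 ?expR_ge0// subr_le0 dq_le// ltW.
  - by apply: continuous_subspaceT; apply: derivable_continuous => y; have [] := gd y.
by rewrite expRN -/(q x) -/(q x0) ler_pdivlMr ?expR_gt0.
Qed.

(** Between 0 and [x0] the exponential is bounded below, so a larger constant suffices there;
    oddness of the kink gives the left half-line. *)
Lemma kink_decay : exists2 C, 0 <= C & forall x,
  (0 <= x -> (s x - a) ^+ 2 <= C * expR (- (m * `|x|))) /\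
  (x <= 0 -> (s x + a) ^+ 2 <= C * expR (- (m * `|x|))).
Proof.
have [x0 H] := kink_sqr_decay.
have [_ m0 _ _ _] := U_two_well.
have [B B0 HB] := continuous_bounded_segment 0 x0 kink_continuous.
pose C1 := (s x0 - a) ^+ 2 * expR (m * x0).
pose C2 := (B + `|a|) ^+ 2 * expR (m * x0).
have C10 : 0 <= C1 by rewrite mulr_ge0 ?sqr_ge0 ?expR_ge0.
have C20 : 0 <= C2 by rewrite mulr_ge0 ?sqr_ge0 ?expR_ge0.
have key x : 0 <= x -> (s x - a) ^+ 2 <= (C1 + C2) * expR (- (m * `|x|)).
  move=> xge; rewrite (ger0_norm xge).
  have [x0x|/ltW xx0] := leP x0 x.
    by apply: (le_trans (H x x0x)); rewrite ler_wpM2r ?expR_ge0// lerDl.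
  apply: (@le_trans _ _ (C2 * expR (- (m * x)))); last first.
    by rewrite ler_wpM2r ?expR_ge0// lerDr.
  rewrite /C2 -mulrA -expRD.
  apply: (@le_trans _ _ ((B + `|a|) ^+ 2)).
    rewrite -(real_normK (num_real (s x - a))) ler_pXn2r ?nnegrE ?addr_ge0//.
    by rewrite (le_trans (ler_normB _ _))// lerD2r HB// xge.
  by rewrite ler_peMr ?sqr_ge0// -expR0 ler_expR -mulrBr mulr_ge0 ?(ltW m0)// subr_ge0.
exists (C1 + C2); first by rewrite addr_ge0.
move=> x; split; first exact: key.
move=> xle; have [_ _ _ [sodd _] _] := s_kink.
have := key (- x); rewrite sodd normrN oppr_ge0 => /(_ xle).
by have -> : (- s x - a) ^+ 2 = (s x + a) ^+ 2 by ring.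
Qed.

Lemma kink_bounded : exists2 B, 0 <= B & forall x, `|s x| <= B.
Proof.
have [C C0 H] := kink_decay; have [_ m0 _ _ _] := U_two_well.
have e1 (x : R) : C * expR (- (m * `|x|)) <= C.
  by rewrite ler_piMr// -expR0 ler_expR oppr_le0 mulr_ge0// ltW.
have key (z c : R) : (z + c) ^+ 2 <= C -> `|z| <= `|c| + C + 1.
  move=> zc; have := ler_normB (z + c) c; rewrite addrK => H1.
  have : `|z + c| <= C + 1.
    have [le1|/ltW z1] := leP `|z + c| 1; first by rewrite (le_trans le1)// lerDr.
    move: zc; rewrite -(real_normK (num_real (z + c))) => zc.
    have : `|z + c| * 1 <= `|z + c| ^+ 2 by rewrite expr2 ler_wpM2l.
    rewrite mulr1; lra.
  lra.
exists (`|a| + C + 1); first by rewrite !addr_ge0.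
move=> x; have [H1 H2] := H x; have [xge|/ltW xle] := leP 0 x.
  have := key (s x) (- a) (le_trans (H1 xge) (e1 x)).
  by rewrite normrN.
exact: (key (s x) a (le_trans (H2 xle) (e1 x))).
Qed.

(* Near a well [U] is quadratic, so the perturbed kink has an energy density
   controlled by the kink's own decay and by the square of the perturbation. *)
Lemma kink_potential_le M : exists2 K, 0 <= K & forall x y, `|y| <= M ->
  U (s x + y) <= K * (expR (- (m * `|x|)) + y ^+ 2).
Proof.
have [C C0 HC] := kink_decay; have [B B0 HB] := kink_bounded.
have [K K0 HK] := two_well_le (B + M).
exists (2 * K * (C + 1)); first by rewrite !mulr_ge0// addr_ge0.
move=> x y yM; have zM : `|s x + y| <= B + M by rewrite (le_trans (ler_normD _ _))// lerD.
have [U1 U2] := HK _ zM.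
set e := expR _; have e0 : 0 <= e by exact: expR_ge0.
have y0 : 0 <= y ^+ 2 by exact: sqr_ge0.
have key c : (s x + c) ^+ 2 <= C * e -> U (s x + y) <= K * (s x + y + c) ^+ 2 ->
    U (s x + y) <= 2 * K * (C + 1) * (e + y ^+ 2).
  move=> Hc /le_trans; apply.
  have -> : 2 * K * (C + 1) * (e + y ^+ 2) = K * (2 * ((C + 1) * (e + y ^+ 2))) by ring.
  rewrite ler_wpM2l//.
  have Cy : 0 <= C * y ^+ 2 by rewrite mulr_ge0.
  have := sqr_ge0 (s x + c - y); nra.
have [H1 H2] := HC x; have [xge|/ltW xle] := leP 0 x.
  by apply: (key (- a)); [exact: H1|exact: U1].
by apply: (key a); [exact: H2|exact: U2].
Qed.

End two_well.

(** * Integrals and L2 norms over the whole line *)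

Section global_integrals.
Context {R : realType}.
Implicit Types (f g : R -> R) (p q c : R).

Local Notation mu := (@lebesgue_measure R).

Lemma integral_le_ii f (B : R) : L1loc f -> (forall x, 0 <= f x) ->
  (forall N : nat, ii (- N%:R) N%:R f <= B) -> (\int[mu]_x (f x)%:E <= B%:E)%E.
Proof.
move=> If f0 HB.
pose F (n : nat) : set R := `[- n%:R, n%:R]%classic.
have FT : \bigcup_n F n = setT.
  apply/seteqP; split => // x _; exists (Num.truncn `|x|).+1 => //.
  rewrite /F /= in_itv/= -ler_norml.
  by have /truncn_itv/andP[_ /ltW] := normr_ge0 x.
have mf : measurable_fun setT (EFin \o f) by apply/measurable_EFinP; case: If.
have C : (\int[mu]_(x in F n) (EFin \o f) x)%E @[n --> \oo] --> (\int[mu]_x (EFin \o f) x)%E.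
  rewrite -FT; apply: ge0_nondecreasing_set_cvg_integral.
  - move=> n n' nn'; apply/subsetPset => x; rewrite /F /= !in_itv/= => /andP[x1 x2].
    have : n%:R <= n'%:R :> R by rewrite ler_nat.
    by move=> ?; apply/andP; split; lra.
  - by move=> n; exact: measurable_itv.
  - by move=> n; exact: measurable_funTS.
  - by move=> n x _; rewrite lee_fin.
rewrite -(cvg_lim _ C)//; apply: lime_le; first by apply/cvg_ex; eexists; exact: C.
by apply: nearW => n; rewrite -EFin_ii// lee_fin; exact: HB.
Qed.

Lemma ii_le_integral f (B : R) p q : measurable_fun setT f -> (forall x, 0 <= f x) ->
  (\int[mu]_x (f x)%:E <= B%:E)%E -> ii p q f <= B.
Proof.
move=> mf f0 HB.
have H : (\int[mu]_(x in `[p, q]) (f x)%:E <= B%:E)%E.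
  apply: le_trans HB; apply: ge0_subset_integral => //.
    by apply/measurable_EFinP.
  by move=> x _; rewrite lee_fin.
have H0 : (0 <= \int[mu]_(x in `[p, q]) (f x)%:E)%E.
  by apply: integral_ge0 => x _; rewrite lee_fin.
have fin : (\int[mu]_(x in `[p, q]) (f x)%:E)%E \is a fin_num.
  by rewrite ge0_fin_numE// (le_lt_trans H)// ltry.
by rewrite /ii /Rintegral -lee_fin fineK.
Qed.

Lemma integral_lty_L1loc f : measurable_fun setT f -> (forall x, 0 <= f x) ->
  (\int[mu]_x (f x)%:E < +oo)%E -> L1loc f.
Proof.
move=> mf f0 Hf; split => // p q; apply/integrableP; split.
  by apply/measurable_EFinP; exact: measurable_funTS.
apply: le_lt_trans Hf.
under eq_integral do rewrite /= ger0_norm//.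
apply: ge0_subset_integral => //; first exact/measurable_EFinP.
by move=> x _; rewrite lee_fin.
Qed.

(** Exchanges norm bounds for bounds on the integral of the square, so that later estimates are free
    of square roots; an infinite norm is covered as well. *)
Lemma Lnorm2_le f (B : R) : 0 <= B ->
  (Lnorm mu 2%:E (fun x => (f x)%:E) <= B%:E)%E <->
  (\int[mu]_x (f x ^+ 2)%:E <= (B ^+ 2)%:E)%E.
Proof.
move=> B0.
have E : (\int[mu]_x (f x ^+ 2)%:E = (Lnorm mu 2%:E (fun x => (f x)%:E)) `^ 2)%E.
  rewrite poweR_Lnorm//; apply: eq_integral => x _ /=.
  by rewrite -(real_normK (num_real (f x))) -powR_mulrn.
rewrite E; set L := Lnorm _ _ _.
have L0 : (0 <= L)%E by exact: Lnorm_ge0.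
have -> : ((B ^+ 2)%:E = B%:E `^ 2)%E by rewrite -powR_mulrn// poweR_EFin.
case: L L0 => [r r0|_|//].
- rewrite !poweR_EFin !lee_fin; rewrite lee_fin in r0.
  rewrite !powR_mulrn//; split => H; first by rewrite lerXn2r ?nnegrE.
  by rewrite -(@ler_pXn2r _ 2).
- split; first by rewrite leye_eq.
  by rewrite poweRyr// leye_eq.
Qed.

End global_integrals.

(** * Polynomial weights against exponentials and coverings *)

Section weights.
Context {R : realType}.
Implicit Types (f g : R -> R) (p q c : R).

Local Notation mu := (@lebesgue_measure R).

Lemma L1loc_continuousM g f : continuous g -> L1loc f -> L1loc (fun x => g x * f x).
Proof.
move=> cg If; split.
  by apply: measurable_funM; [exact: continuous_measurable_fun|case: If].
move=> p q; have [K K0 HK] := continuous_bounded_segment p q cg.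
apply: (@le_integrable _ _ _ mu _ _ _ (EFin \o (fun x => K * f x))) => //.
- apply/measurable_EFinP; apply: measurable_funTS; apply: measurable_funM.
    exact: continuous_measurable_fun.
  by case: If.
- move=> x /=; rewrite in_itv/= => xI; rewrite lee_fin !normrM ler_wpM2r//.
  by rewrite (le_trans (HK x xI))// ler_norm.
- by have [_ H] := L1locZ K If; exact: H.
Qed.

Lemma ii_FTC2 f F p q : p < q -> continuous f -> (forall x : R, is_derive x 1 F (f x)) ->
  ii p q f = F q - F p.
Proof.
move=> pq cf dF.
have cF : continuous F by apply: derivable_continuous => x; have [] := dF x.
have := @continuous_FTC2 R f F p q pq (continuous_subspaceT cf).
rewrite /ii /Rintegral => -> //.
- split.
  + by move=> x _; have [] := dF x.
  + by apply: cvg_at_right_filter; exact: cF.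
  + by apply: cvg_at_left_filter; exact: cF.
- by move=> x _; rewrite derive1E; have [_ ->] := dF x.
Qed.

Lemma is_derive_expR_linear c (x : R) :
  is_derive x 1 (fun x => expR (c * x)) (c * expR (c * x)).
Proof.
have D1 : is_derive x 1 (fun y : R => c * y) c.
  have H := @is_derive_mulr R (fun=> c) (fun z => z) x 0 1 (is_derive_cst c x 1) (is_derive_id x 1).
  by apply: (is_derive_val_eq H); rewrite mulr1 mul0r addr0.
have D2 := @is_derive1_comp R expR (fun y : R => c * y) x _ _ (is_derive_expR _) D1.
by apply: (is_derive_val_eq D2); rewrite mulrC.
Qed.

Lemma ii_expR c p q : c != 0 -> p < q ->
  ii p q (fun x => expR (c * x)) = c^-1 * (expR (c * q) - expR (c * p)).
Proof.
move=> c0 pq.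
have dF (x : R) : is_derive x 1 (fun x => c^-1 * expR (c * x)) (expR (c * x)).
  have H := @is_derive_mulr R (fun=> c^-1) _ x 0 _ (is_derive_cst (c^-1) x 1) (is_derive_expR_linear c x).
  by apply: (is_derive_val_eq H); rewrite mul0r addr0 mulKf.
rewrite (ii_FTC2 pq _ dF); first by rewrite mulrBr.
by apply: derivable_continuous => x; have [] := is_derive_expR_linear c x.
Qed.

Lemma continuous_expR_norm c : continuous (fun x : R => expR (- (c * `|x|))).
Proof.
move=> x; apply: continuous_comp; last exact: continuous_expR.
by apply: cvgN; apply: cvgM; [exact: cvg_cst|apply: cvg_norm; exact: cvg_id].
Qed.

Lemma ii_expR_norm_le c p q : 0 < c -> ii p q (fun x => expR (- (c * `|x|))) <= 2 / c.
Proof.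
move=> c0; pose L := `|p| + `|q| + 1.
have L0 : 0 < L by rewrite ltr_wpDl// addr_ge0.
have If := L1loc_continuous (@continuous_expR_norm c).
have pL : - L <= p by rewrite /L; have := ler_norm (- p); have := normr_ge0 q; rewrite normrN; lra.
have qL : q <= L by rewrite /L; have := ler_norm q; have := normr_ge0 p; lra.
have LN : - L < 0 by rewrite oppr_lt0.
apply: (le_trans (ii_subset If (fun x => expR_ge0 _) pL qL)).
rewrite (ii_cat If (ltW LN) (ltW L0)).
have -> : ii (- L) 0 (fun x => expR (- (c * `|x|))) = ii (- L) 0 (fun x => expR (c * x)).
  by apply: eq_ii => x /andP[_ x0]; rewrite ler0_norm// mulrN opprK.
have -> : ii 0 L (fun x => expR (- (c * `|x|))) = ii 0 L (fun x => expR (- c * x)).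
  by apply: eq_ii => x /andP[x0 _]; rewrite ger0_norm// mulNr.
rewrite !ii_expR// ?oppr_eq0 ?gt_eqF//.
rewrite !mulr0 expR0 invrN mulNr -mulrN opprB.
have e1 : 0 < expR (c * - L) by exact: expR_gt0.
have e2 : 0 < expR (- c * L) by exact: expR_gt0.
have ci : 0 < c^-1 by rewrite invr_gt0.
have := mulr_gt0 ci e1; have := mulr_gt0 ci e2; lra.
Qed.

Definition weight (sg x : R) := (1 + `|x|) `^ sg.

Lemma weight_gt0 sg x : 0 < weight sg x.
Proof. by rewrite powR_gt0// ltr_wpDr. Qed.

Lemma weight_ge1 sg x : 0 <= sg -> 1 <= weight sg x.
Proof.
by move=> s0; rewrite -(powRr0 (1 + `|x|)) ler_powR// lerDl.
Qed.

Lemma weight_continuous sg : continuous (weight sg).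
Proof.
have -> : weight sg = (fun x => expR (sg * ln (1 + `|x|))).
  by apply/funext => x; rewrite /weight /powR gt_eqF// ltr_wpDr.
move=> x; apply: continuous_comp; last exact: continuous_expR.
apply: cvgM; first exact: cvg_cst.
have x1 : 0 < 1 + `|x| by rewrite ltr_wpDr.
have C : (1 + `|y|) @[y --> x] --> 1 + `|x|.
  by apply: cvgD; [exact: cvg_cst|apply: cvg_norm; exact: cvg_id].
exact: (continuous_cvg _ (continuous_ln x1) C).
Qed.

Lemma weight_sqr sg x : weight sg x ^+ 2 = (1 + `|x|) `^ (2 * sg).
Proof. by rewrite mulrC powRrM powR_mulrn// powR_ge0. Qed.

(** From 1 + |x| <= 1 + k + |y| <= (1 + k) (1 + |y|): the loss depends on the distance only, not on
    the position. *)
Lemma weight_le sg (k x y : R) : 0 <= sg -> 0 <= k -> `|x - y| <= k ->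
  weight sg x <= (1 + k) `^ sg * weight sg y.
Proof.
move=> s0 k0 xy; rewrite /weight -powRM ?addr_ge0//.
apply: ge0_ler_powR => //; rewrite ?nnegrE ?mulr_ge0 ?addr_ge0//.
have := ler_normD (x - y) y; rewrite subrK => H.
have : 0 <= k * `|y| by rewrite mulr_ge0.
lra.
Qed.

(** 1 + |x| <= K (1 + d |x|) <= K exp(d |x|), and the rate d = c / (2 sg) becomes [c] after raising
    to the power 2 sg. *)
Lemma weight_expR_le sg c : 0 < sg -> 0 < c -> exists2 C, 0 <= C &
  forall x, weight sg x ^+ 2 <= C * expR (c * `|x|).
Proof.
move=> s0 c0; pose d := c / (2 * sg).
have s20 : 0 < 2 * sg by rewrite mulr_gt0.
have d0 : 0 < d by rewrite divr_gt0.
pose K := 1 + d^-1.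
have K0 : 0 <= K by rewrite addr_ge0// invr_ge0 ltW.
exists (K `^ (2 * sg)); first exact: powR_ge0.
move=> x; rewrite weight_sqr.
have -> : expR (c * `|x|) = expR (d * `|x|) `^ (2 * sg).
  rewrite -expRM; congr expR; rewrite /d mulrAC -mulrA mulrC.
  by field; rewrite gt_eqF.
have A0 : 0 <= 1 + `|x| by rewrite addr_ge0.
have B0 : 0 <= K * expR (d * `|x|) by rewrite mulr_ge0// expR_ge0.
rewrite -powRM ?expR_ge0//.
apply: ge0_ler_powR; [exact: ltW|by rewrite nnegrE|by rewrite nnegrE|].
apply: (@le_trans _ _ (K * (1 + d * `|x|))); last by rewrite ler_wpM2l// expR_ge1Dx.
rewrite /K mulrDl mul1r mulrDr mulr1 mulKf ?gt_eqF//.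
have : 0 <= d * `|x| by rewrite mulr_ge0// ltW.
have : 0 < d^-1 by rewrite invr_gt0.
lra.
Qed.

(** Half of the exponential absorbs the squared weight, and the other half is integrable. *)
Lemma weight_expR_integral sg m : 0 < sg -> 0 < m -> exists2 J, 0 <= J &
  forall p q, ii p q (fun x => weight sg x ^+ 2 * expR (- (m * `|x|))) <= J.
Proof.
move=> s0 m0; have m2 : 0 < m / 2 by rewrite divr_gt0.
have [C C0 HC] := weight_expR_le s0 m2.
exists (C * (2 / (m / 2))); first by rewrite mulr_ge0// divr_ge0// ltW.
move=> p q.
have I1 := L1loc_continuous (@continuous_expR_norm (m / 2)).
apply: (@le_trans _ _ (ii p q (fun x => C * expR (- (m / 2 * `|x|))))).
  apply: le_ii; last first.
  - move=> x _; have -> : expR (- (m * `|x|)) = expR (- (m / 2 * `|x|)) * expR (- (m / 2 * `|x|)).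
      by rewrite -expRD; congr expR; field.
    rewrite mulrA ler_wpM2r ?expR_ge0//.
    by rewrite expRN ler_pdivrMr ?expR_gt0.
  - exact: L1locZ.
  - apply: L1loc_continuousM; last exact: (L1loc_continuous (@continuous_expR_norm m)).
    by move=> x; apply: (cvgM (@weight_continuous sg x) (@weight_continuous sg x)).
by rewrite iiZ// ler_wpM2l// ii_expR_norm_le.
Qed.

(** Each enlarged interval splits into 2 K + 1 unit cells. After exchanging the sums, the cells with
    a fixed offset j tile one interval, so each offset contributes at most [J]: the bounded overlap
    of the covering. *)
Lemma ii_sum_le p (N K : nat) f (J : R) : L1loc f -> (forall x, 0 <= f x) ->
  (forall u v, ii u v f <= J) ->
  \sum_(i < N) ii (p + i%:R - K%:R) (p + i.+1%:R + K%:R) f <= (2 * K).+1%:R * J.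
Proof.
move=> If f0 HJ.
have E (i : nat) : ii (p + i%:R - K%:R) (p + i.+1%:R + K%:R) f =
    \sum_(j < (2 * K).+1) ii (p - K%:R + j%:R + i%:R * 1) (p - K%:R + j%:R + i.+1%:R * 1) f.
  have := @ii_partition R (p + i%:R - K%:R) 1 (2 * K).+1 f If ler01.
  have -> : p + i%:R - K%:R + (2 * K).+1%:R * 1 = p + i.+1%:R + K%:R.
    by rewrite -!natr1 natrM; ring.
  move=> ->; apply: eq_bigr => j _.
  have -> : p - K%:R + j%:R + i%:R * 1 = p + i%:R - K%:R + j%:R * 1 by ring.
  by have -> : p - K%:R + j%:R + i.+1%:R * 1 = p + i%:R - K%:R + j.+1%:R * 1
    by rewrite -!natr1; ring.
under eq_bigr do rewrite E.
rewrite exchange_big /=.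
apply: (@le_trans _ _ (\sum_(j < (2 * K).+1) J)); last first.
  by rewrite sumr_const card_ord mulr_natl.
apply: ler_sum => j _.
by rewrite -(@ii_partition R (p - K%:R + j%:R) 1 N f If ler01).
Qed.

End weights.

(** * The Sobolev norms and the chosen weak derivative *)

Section sobolev.
Context {R : realType}.
Implicit Types (f g : R -> R) (p q c sg : R).

Local Notation mu := (@lebesgue_measure R).

Lemma Hnorm0E sg f :
  Hnorm 0 sg f = Lnorm mu 2%:E (fun x => (weight sg x * f x)%:E).
Proof. by rewrite /Hnorm big_ord_recl big_ord0 adde0. Qed.

Lemma Hnorm1E sg f : Hnorm 1 sg f =
  (Lnorm mu 2%:E (fun x => (weight sg x * f x)%:E) +
   Lnorm mu 2%:E (fun x => (weight sg x * weak_derivative f x)%:E))%E.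
Proof. by rewrite /Hnorm !big_ord_recl big_ord0 adde0. Qed.

Lemma weak_derivativeP f : (exists g, is_weak_derivative f g) ->
  is_weak_derivative f (weak_derivative f).
Proof. by move=> H; rewrite /weak_derivative; exact: (xgetPex _ H). Qed.

Lemma L2_weighted sg f (B : R) : 0 <= sg -> 0 <= B -> measurable_fun setT f ->
  (Lnorm mu 2%:E (fun x => (weight sg x * f x)%:E) <= B%:E)%E ->
  [/\ L2loc f, L1loc (fun x => weight sg x ^+ 2 * f x ^+ 2) &
      forall p q, ii p q (fun x => weight sg x ^+ 2 * f x ^+ 2) <= B ^+ 2].
Proof.
move=> sg0 B0 mf /(Lnorm2_le _ B0).
have -> : (fun x => ((weight sg x * f x) ^+ 2)%:E) =
          (fun x => (weight sg x ^+ 2 * f x ^+ 2)%:E).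
  by apply/funext => x; rewrite exprMn.
move=> HB; have mw : measurable_fun setT (weight sg).
  exact: continuous_measurable_fun (@weight_continuous _ sg).
have mwf : measurable_fun setT (fun x => weight sg x ^+ 2 * f x ^+ 2).
  by apply: measurable_funM; exact: measurable_funX.
have wf0 x : 0 <= weight sg x ^+ 2 * f x ^+ 2 by rewrite mulr_ge0 ?sqr_ge0.
have I1 : L1loc (fun x => weight sg x ^+ 2 * f x ^+ 2).
  by apply: integral_lty_L1loc => //; rewrite (le_lt_trans HB)// ltry.
split => //; last by move=> p q; exact: ii_le_integral.
split => //; apply: (L1loc_dom _ I1); first exact: measurable_funX.
move=> x; rewrite ger0_norm ?sqr_ge0// ler_peMl ?sqr_ge0//.
by rewrite expr_ge1 ?weight_ge1// (le_trans ler01)// weight_ge1.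
Qed.

Lemma Lnorm_finite f : (Lnorm mu 2%:E (fun x => (f x)%:E) < +oo)%E ->
  exists2 B, 0 <= B & (Lnorm mu 2%:E (fun x => (f x)%:E) <= B%:E)%E.
Proof.
set L := Lnorm _ _ _ => H; have L0 : (0 <= L)%E by exact: Lnorm_ge0.
exists (fine L); first exact: fine_ge0.
by rewrite fineK// ge0_fin_numE.
Qed.

Lemma weight0 (x : R) : weight 0 x = 1. Proof. exact: powRr0. Qed.

Lemma in_H1_facts sg f : 0 <= sg -> in_H 1 sg f ->
  [/\ L2loc f, L2loc (weak_derivative f) & is_weak_derivative f (weak_derivative f)].
Proof.
move=> sg0 [mf _ wf]; rewrite Hnorm1E => Hf.
have wd : is_weak_derivative f (weak_derivative f).
  by apply: weak_derivativeP; have := wf 0%N isT.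
have [_ [md _ _] _] := wd.
have N0 : (0 <= Lnorm mu 2%:E (fun x => (weight sg x * f x)%:E))%E by exact: Lnorm_ge0.
have N1 : (0 <= Lnorm mu 2%:E (fun x => (weight sg x * weak_derivative f x)%:E))%E by exact: Lnorm_ge0.
have [|B B0 HB] := @Lnorm_finite (fun x => weight sg x * f x).
  by apply: le_lt_trans Hf; rewrite leeDl.
have [|B' B'0 HB'] := @Lnorm_finite (fun x => weight sg x * weak_derivative f x).
  by apply: le_lt_trans Hf; rewrite leeDr.
split => //.
  by have [] := L2_weighted sg0 B0 mf HB.
by have [] := L2_weighted sg0 B'0 md HB'.
Qed.

Lemma in_H0_facts sg f : 0 <= sg -> in_H 0 sg f -> L2loc f.
Proof.
move=> sg0 [mf _ _]; rewrite Hnorm0E => Hf.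
have [B B0 HB] := Lnorm_finite Hf.
by have [] := L2_weighted sg0 B0 mf HB.
Qed.

Lemma is_weak_derivativeD f1 f2 g1 g2 c : is_weak_derivative f1 g1 ->
  is_weak_derivative f2 g2 ->
  is_weak_derivative (fun x => f1 x + c * f2 x) (fun x => g1 x + c * g2 x).
Proof.
move=> w1 w2; have [/L1loc_locally_integrable If1 /L1loc_locally_integrable Ig1 _] := w1.
have [/L1loc_locally_integrable If2 /L1loc_locally_integrable Ig2 _] := w2.
split.
- by apply/L1loc_locally_integrable; apply: L1locD => //; exact: L1locZ.
- by apply/L1loc_locally_integrable; apply: L1locD => //; exact: L1locZ.
move=> phi tphi; have [M M0 HM] := test_function_support tphi.
rewrite (Rintegral_support _ (derive1_support HM)) (Rintegral_support _ HM).
have E1 := weak_derivative_test w1 tphi HM.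
have E2 := weak_derivative_test w2 tphi HM.
have cp := smooth_continuous tphi.1.
have cdp := smooth_continuous (smooth_derive1 tphi.1).
have J f (h : R -> R) : continuous h -> L1loc f -> L1loc (fun x => f x * h x).
  move=> ch If; have := L1loc_continuousM ch If.
  by apply: eq_L1loc => x; rewrite mulrC.
have A f1' f2' (h : R -> R) : continuous h -> L1loc f1' -> L1loc f2' ->
    ii (- M) M (fun x => (f1' x + c * f2' x) * h x) =
    ii (- M) M (fun x => f1' x * h x) + c * ii (- M) M (fun x => f2' x * h x).
  move=> ch I1 I2; have J1 := J _ _ ch I1; have J2 := J _ _ ch I2.
  rewrite -(iiZ _ _ c J2) -(iiD _ _ J1 (L1locZ c J2)).
  by apply: eq_ii => x _; ring.
by rewrite !A// E1 E2; ring.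
Qed.

Lemma is_weak_derivative_derive1 f g : (forall x : R, is_derive x 1 f (g x)) ->
  continuous g -> is_weak_derivative f g.
Proof.
move=> df cg; have cf : continuous f by apply: derivable_continuous => x; have [] := df x.
split; [exact/L1loc_locally_integrable/L1loc_continuous..|].
move=> phi tphi; have [M M0 HM] := test_function_support tphi.
(* [HM] says nothing at -M and M themselves; at the ends of the larger interval [phi] vanishes, and
   with it the boundary terms of the integration by parts. *)
pose L := M + 1.
have HL x : ~~ (- L <= x <= L) -> phi x = 0.
  by move=> H; apply: HM; apply: contra H => /andP[? ?]; rewrite /L; apply/andP; split; lra.
rewrite (Rintegral_support _ (derive1_support HL)) (Rintegral_support _ HL).
have cp := smooth_continuous tphi.1.
have cdp := smooth_continuous (smooth_derive1 tphi.1).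
have C1 : continuous (fun x => f x * derive1 phi x).
  by move=> x; exact: (cvgM (cf x) (cdp x)).
have C2 : continuous (fun x => g x * phi x).
  by move=> x; exact: (cvgM (cg x) (cp x)).
have C3 : continuous (fun x => f x * derive1 phi x + g x * phi x).
  by move=> x; exact: (cvgD (C1 x) (C2 x)).
have dF (x : R) : is_derive x 1 (fun x => f x * phi x) (f x * derive1 phi x + g x * phi x).
  exact: (is_derive_mulr (df x) (is_derive_smooth x tphi.1)).
have LL : - L < L by rewrite /L; lra.
have := ii_FTC2 LL C3 dF.
rewrite iiD; [|exact: L1loc_continuous..].
rewrite !HM; last 2 first.
- by rewrite negb_and -!ltNge; apply/orP; left; rewrite /L; lra.
- by rewrite negb_and -!ltNge; apply/orP; right; rewrite /L; lra.
by rewrite !mulr0 subrr => /eqP; rewrite addr_eq0 => /eqP.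
Qed.

Lemma is_weak_derivative_ae f f' g : measurable_fun setT f' -> L1loc f' ->
  {ae mu, forall x, f' x = f x} -> is_weak_derivative f g -> is_weak_derivative f' g.
Proof.
move=> mf' If' ff' w; have [/L1loc_locally_integrable If /L1loc_locally_integrable Ig _] := w.
split; [exact/L1loc_locally_integrable|exact/L1loc_locally_integrable|].
move=> phi tphi; have [M M0 HM] := test_function_support tphi.
rewrite (Rintegral_support _ (derive1_support HM)) (Rintegral_support _ HM).
rewrite -(weak_derivative_test w tphi HM).
have mdp : measurable_fun setT (derive1 phi).
  by apply: continuous_measurable_fun; apply: smooth_continuous; exact: smooth_derive1 tphi.1.
apply: ae_eq_ii_in.
- exact: measurable_funM.
- by apply: measurable_funM => //; case: If.
- by apply: ae_mono ff' => x -> .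
Qed.

(** Functions equal almost everywhere have the same set of weak derivatives, so [xget] returns the
    same function, not merely an equivalent one. *)
Lemma weak_derivative_ae f f' : L1loc f -> L1loc f' ->
  {ae mu, forall x, f' x = f x} -> weak_derivative f' = weak_derivative f.
Proof.
move=> If If' ff'; rewrite /weak_derivative; congr xget.
apply/seteqP; split => g /= w.
  by apply: (is_weak_derivative_ae _ If _ w); [case: If|apply: ae_mono ff' => x ->].
by apply: (is_weak_derivative_ae _ If' _ w); [case: If'|].
Qed.

End sobolev.

(** * A distributional solution as a field with a continuous representative *)

Section solutions.
Context {R : realType}.
Context (U : R -> R) (a m : R) (s : R -> R).
Context (U_smooth : smooth U) (U_even : forall x, U (- x) = U x).
Context (U_two_well : two_well 7 U a m) (s_kink : kink U a s).
Context (X0 : state R) (X : R -> state R).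
Context (X_sol : is_solution U s (fun t => kink_state s + X t) (kink_state s + X0)).

Local Notation mu := (@lebesgue_measure R).

Let Psi t := (X t).1.
Let Pi t := (X t).2.

Lemma solution_E t : in_E 0 (X t).
Proof.
have [H _ _ _] := X_sol; have := H t.
by rewrite addrAC subrr add0r.
Qed.

Let PsiF t : [/\ L2loc (Psi t), L2loc (weak_derivative (Psi t)) &
  is_weak_derivative (Psi t) (weak_derivative (Psi t))].
Proof. by have [H _] := solution_E t; exact: in_H1_facts H. Qed.

Let PiF t : L2loc (Pi t).
Proof. by have [_ H] := solution_E t; exact: in_H0_facts H. Qed.

Let cs : continuous s. Proof. exact: kink_continuous s_kink. Qed.
Let cds : continuous (derive1 s). Proof. exact: kink_derive1_continuous s_kink. Qed.

Lemma solution_cont (t0 e : R) : 0 < e -> exists2 r, 0 < r & forall t, `|t - t0| < r ->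
  (Enorm 0 (X t - X t0)%R <= e%:E)%E.
Proof.
move=> e0; have [_ H _ _] := X_sol.
have := H t0 => /fine_cvgP[Hfin /cvgrPdist_le/(_ _ e0) Hc].
have [r /= r0 Hr] := Hfin; have [r' /= r'0 Hr'] := Hc.
exists (Num.min r r'); first by rewrite lt_min r0.
move=> t; rewrite lt_min => /andP[h1 h2].
have E : kink_state s + X t - (kink_state s + X t0) = X t - X t0.
  by rewrite opprD addrACA subrr add0r.
have := Hr t; rewrite /ball/= distrC => /(_ h1); rewrite E => fin.
have := Hr' t; rewrite /ball/= (distrC t0) => /(_ h2); rewrite E sub0r normrN => H2.
by rewrite -(fineK fin) lee_fin (le_trans (ler_norm _)).
Qed.

(** The norm of X(t) - X(t0) involves the weak derivative of a difference; [weak_derivativeB_sqr_le]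
    passes to the difference of the weak derivatives. *)
Lemma solution_L2cont : [/\ L2cont Psi, L2cont (fun t => weak_derivative (Psi t)) & L2cont Pi].
Proof.
suff key t0 p q e : 0 < e -> exists2 r, 0 < r & forall t, `|t - t0| < r ->
    [/\ ii p q (fun x => (Psi t x - Psi t0 x) ^+ 2) <= e,
      ii p q (fun x => (weak_derivative (Psi t) x - weak_derivative (Psi t0) x) ^+ 2) <= e &
      ii p q (fun x => (Pi t x - Pi t0 x) ^+ 2) <= e].
  by split => t0 p q e e0; have [r r0 Hr] := key t0 p q e e0; exists r => // t /Hr[].
move=> e0; pose e1 := Num.min 1 e.
have e10 : 0 < e1 by rewrite lt_min ltr01.
have e12 : e1 ^+ 2 <= e.
  apply: (@le_trans _ _ e1); last by rewrite ge_min lexx orbT.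
  by rewrite expr2 ler_piMl// ?(ltW e10)// ge_min lexx.
have [r r0 Hr] := solution_cont t0 e10.
exists r => // t tr; have := Hr t tr.
have [J1 J2 W1] := PsiF t; have [J3 J4 W2] := PsiF t0.
pose D := fun x => Psi t x - Psi t0 x.
pose D' := fun x => Pi t x - Pi t0 x.
have -> : Enorm 0 (X t - X t0) = (Hnorm 1 0 D + Hnorm 0 0 D')%E by [].
rewrite Hnorm1E Hnorm0E => HE.
set N1 := Lnorm mu _ _ in HE; set N2 := Lnorm mu _ _ in HE; set N3 := Lnorm mu _ _ in HE.
have N10 : (0 <= N1)%E by exact: Lnorm_ge0.
have N20 : (0 <= N2)%E by exact: Lnorm_ge0.
have N30 : (0 <= N3)%E by exact: Lnorm_ge0.
have H1 : (N1 <= e1%:E)%E by apply: le_trans HE; rewrite -addeA leeDl// adde_ge0.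
have H2 : (N2 <= e1%:E)%E.
  by apply: le_trans HE; rewrite addeAC leeDr// adde_ge0.
have H3 : (N3 <= e1%:E)%E by apply: le_trans HE; rewrite leeDr// adde_ge0.
have WD : is_weak_derivative D (weak_derivative D).
  apply: weak_derivativeP; eexists.
  have := is_weak_derivativeD (-1) W1 W2.
  have -> : (fun x => Psi t x + -1 * Psi t0 x) = D.
    by apply/funext => x; rewrite mulN1r.
  by move=> w; exact: w.
have LE f p' q' : ii p' q' (fun x => weight 0 x ^+ 2 * f x ^+ 2) = ii p' q' (fun x => f x ^+ 2).
  by apply: eq_ii => x _; rewrite weight0 expr1n mul1r.
split; apply: le_trans e12.
- have [_ _ H] := L2_weighted (lexx 0) (ltW e10) (L2loc_meas (L2locB J1 J3)) H1.
  by rewrite -LE; exact: H.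
- have [_ [mD _ _] _] := WD.
  have [JD _ H] := L2_weighted (lexx 0) (ltW e10) mD H2.
  have [pq|qp] := ltP p q; last by rewrite (ii_empty _ qp) sqr_ge0.
  apply: (le_trans (weak_derivativeB_sqr_le pq W1 W2 WD J2 J4 JD)).
  by rewrite -LE; exact: H.
- have [_ _ H] := L2_weighted (lexx 0) (ltW e10) (L2loc_meas (L2locB (PiF t) (PiF t0))) H3.
  by rewrite -LE; exact: H.
Qed.

(** At each time s + Psi(t) is replaced by its continuous representative. The pairings in the
    equations do not change, including the nonlinear one, since compositions with equivalent
    functions are equivalent; the second derivative on the test function is brought back to one by
    the weak derivative. *)
Lemma solution_field : exists psi,
  field_solution (derive1 U) psi
    (fun t x => derive1 s x + 1 * weak_derivative (Psi t) x) Pi /\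
  forall t, {ae mu, forall x, psi t x = s x + Psi t x}.
Proof.
have ws : is_weak_derivative s (derive1 s).
  by apply: is_weak_derivative_derive1 => // x; exact: kink_derive s_kink x.
pose d t x := derive1 s x + 1 * weak_derivative (Psi t) x.
have wY t : is_weak_derivative (fun x => s x + 1 * Psi t x) (d t).
  by have [_ _ W] := PsiF t; exact: is_weak_derivativeD.
have Hpsi t : exists F, primitive F (d t) /\ {ae mu, forall x, F x = s x + Psi t x}.
  have [F [pF aF]] := weak_derivative_primitive (wY t).
  by exists F; split => //; apply: ae_mono aF => x ->; rewrite mul1r.
pose psi t := sval (cid (Hpsi t)).
have Ppsi t : primitive (psi t) (d t) by rewrite /psi; case: cid => F [].
have apsi t : {ae mu, forall x, psi t x = s x + Psi t x} by rewrite /psi; case: cid => F [].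
have Id t : L2loc (d t).
  have [_ J _] := PsiF t; apply: L2locD; first exact: L2loc_continuous.
  exact: L2locZ.
have cpsi t : continuous (psi t) := primitive_continuous (Id t) (Ppsi t).
have IsPsi t : L2loc (fun x => s x + Psi t x).
  by have [J _ _] := PsiF t; apply: L2locD => //; exact: L2loc_continuous.
have [C1 C2 C3] := solution_L2cont.
have cV : continuous (derive1 U).
  by apply: smooth_continuous; exact: smooth_derive1.
have [_ _ _ Heq] := X_sol.
have wpsi t : is_weak_derivative (psi t) (d t).
  apply: (is_weak_derivative_ae _ _ _ (wY t)).
  - exact: continuous_measurable_fun.
  - exact: L1loc_continuous.
  - by apply: ae_mono (apsi t) => x ->; rewrite mul1r.
have swap (G : R -> R) (t : R) (phi : R -> R) : continuous G -> continuous phi ->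
    (exists M : R, forall x : R, ~~ (- M <= x <= M) -> phi x = 0) ->
    \int[mu]_x (G ((kink_state s + X t).1 x) * phi x) = \int[mu]_x (G (psi t x) * phi x).
  move=> cG cphi [M HM]; rewrite !(Rintegral_support _ HM).
  have mphi : measurable_fun setT phi by exact: continuous_measurable_fun.
  have mG : measurable_fun setT G by exact: continuous_measurable_fun.
  apply: ae_eq_ii_in.
  - apply: measurable_funM => //; apply: (measurableT_comp mG).
    exact: (L2loc_meas (IsPsi t)).
  - apply: measurable_funM => //; apply: (measurableT_comp mG).
    exact: continuous_measurable_fun.
  - by apply: ae_mono (apsi t) => x ->.
have swapPi (t : R) (phi : R -> R) : \int[mu]_x ((kink_state s + X t).2 x * phi x) = \int[mu]_x (Pi t x * phi x).
  congr Rintegral; apply/funext => x; congr (_ * _).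
  by rewrite /Pi -[RHS]add0r.
have supp (phi : R -> R) : test_function phi -> exists M : R, forall x : R, ~~ (- M <= x <= M) -> phi x = 0.
  by move=> /test_function_support[M _ HM]; exists M.
have cid' : continuous (@id R) by move=> x; exact: cvg_id.
exists psi; split=> //; split => //.
- move=> t0 p q e e0; have [r r0 Hr] := C1 t0 p q e e0.
  exists r => // t /Hr; apply: le_trans; rewrite le_eqVlt; apply/orP; left; apply/eqP.
  have [J1 _ _] := PsiF t; have [J2 _ _] := PsiF t0.
  apply: ae_eq_ii_in.
  + by apply: measurable_funX; apply: measurable_funB; exact: continuous_measurable_fun.
  + by apply: measurable_funX; apply: measurable_funB; exact: L2loc_meas.
  + by apply: ae_mono (ae_and (apsi t) (apsi t0)) => x [-> ->] _; congr (_ ^+ 2); ring.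
- move=> t0 p q e e0; have [r r0 Hr] := C2 t0 p q e e0.
  exists r => // t /Hr; apply: le_trans; rewrite le_eqVlt; apply/orP; left; apply/eqP.
  by apply: eq_ii => x _; congr (_ ^+ 2); ring.
- move=> phi tphi t; have [D _] := Heq phi tphi t.
  have cphi := smooth_continuous tphi.1.
  have E : (fun t' => \int[mu]_x ((kink_state s + X t').1 x * phi x)) =
      (fun t' => \int[mu]_x (psi t' x * phi x)).
    by apply/funext => t'; exact: (swap id t' phi cid' cphi (supp _ tphi)).
  by rewrite -E -swapPi.
- move=> phi tphi t; have [_ D] := Heq phi tphi t.
  have cphi := smooth_continuous tphi.1.
  have tphi1 := test_function_derive1 tphi.
  have tphi2 := test_function_derive1 tphi1.
  have E : (fun t' => \int[mu]_x ((kink_state s + X t').2 x * phi x)) =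
      (fun t' => \int[mu]_x (Pi t' x * phi x)).
    by apply/funext => t'; exact: swapPi.
  rewrite E in D; apply: (is_derive_val_eq D); congr (_ + _).
    have -> : derive1n 2 phi = derive1 (derive1 phi) by [].
    have -> : \int[mu]_x ((kink_state s + X t).1 x * derive1 (derive1 phi) x) =
        \int[mu]_x (psi t x * derive1 (derive1 phi) x).
      exact: (swap id t _ cid' (smooth_continuous tphi2.1) (supp _ tphi2)).
    by have [_ _ W] := wpsi t; exact: W.
  have cF : continuous (fun x => - derive1 U x).
    by move=> x; apply: cvgN; exact: cV.
  have -> : \int[mu]_x (- derive1 U ((kink_state s + X t).1 x) * phi x) =
      \int[mu]_x (- derive1 U (psi t x) * phi x).
    exact: (swap (fun x => - derive1 U x) t phi cF cphi (supp _ tphi)).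
  have [M M0 HM] := test_function_support tphi.
  rewrite !(Rintegral_support _ HM) -iiN.
    by apply: eq_ii => x _; rewrite mulNr.
  apply: L1loc_continuous => x; apply: cvgM; last exact: cphi.
  by apply: continuous_comp; [exact: cpsi|exact: cV].
Qed.

End solutions.

(** * Finite propagation in weighted norms *)

Section weighted_bounds.
Context {R : realType}.
Implicit Types (f g : R -> R) (p q sg : R).

Local Notation mu := (@lebesgue_measure R).

(** The absolute value is convex, so on a unit interval the weight is largest at the endpoint of
    larger absolute value. *)
Lemma weight_max_endpoint sg k : 0 <= sg -> exists2 z, k <= z <= k + 1 &
  forall x, k <= x <= k + 1 -> weight sg x <= weight sg z.
Proof.
move=> sg0; have [h|h] := lerP `|k| `|k + 1|.
- exists (k + 1); first by rewrite lerDl ler01 lexx.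
  move=> x /andP[x1 x2]; rewrite /weight ge0_ler_powR ?nnegrE ?addr_ge0//.
  rewrite lerD2l ler_norml.
  have := ler_norm (k + 1); have := ler_norm (- k); rewrite normrN => h1 h2.
  by apply/andP; split; lra.
- exists k; first by rewrite lexx lerDl ler01.
  move=> x /andP[x1 x2]; rewrite /weight ge0_ler_powR ?nnegrE ?addr_ge0//.
  rewrite lerD2l ler_norml.
  have := ler_norm (k + 1); have := ler_norm (- k); rewrite normrN => h1 h2.
  by apply/andP; split; lra.
Qed.

(* On unit intervals the weight varies by at most the factor [(n + 2)^sg] over the
   domain of dependence, so that a finite-speed estimate survives the weight. *)
Lemma weighted_displacement sg (T J : R) (f e : R -> R) : 0 <= sg -> 0 < T ->
  L1loc (fun x => f x ^+ 2) -> L1loc e -> (forall x, 0 <= e x) ->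
  (forall p q, p < q -> ii p q (fun x => f x ^+ 2) <=
    T ^+ 2 * (2 * ii (p - T) (q + T) e)) ->
  (forall p q, ii p q (fun x => weight sg x ^+ 2 * e x) <= J) ->
  forall N : nat, ii (- N%:R) N%:R (fun x => weight sg x ^+ 2 * f x ^+ 2) <=
    6 * (3 `^ sg) ^+ 2 * J * ((1 + T) ^+ 3 * ((1 + T) `^ sg) ^+ 2).
Proof.
move=> sg0 T0 If Ie e0 Hf HJ N.
have J0 : 0 <= J by apply: le_trans (HJ 0 0); rewrite (ii_empty _ (lexx 0)).
have cw2 : continuous (fun x => weight sg x ^+ 2).
  by move=> x; apply: cvgM; exact: weight_continuous.
have Iwf : L1loc (fun x => weight sg x ^+ 2 * f x ^+ 2) by exact: L1loc_continuousM.
have Iwe : L1loc (fun x => weight sg x ^+ 2 * e x) by exact: L1loc_continuousM.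
have we0 x : 0 <= weight sg x ^+ 2 * e x by rewrite mulr_ge0// sqr_ge0.
have := truncn_itv (ltW T0); set n0 := Num.truncn T => /andP[n01 n02].
(* [n] is an integer at least [T], so that neighbourhoods consist of whole unit cells; a point of
   the enlarged cell is within n + 1 of [z], which gives the factor [A]. *)
pose n := n0.+1; pose A := (1 + (n%:R + 1)) `^ sg.
have Tn : T <= n%:R :> R by exact: ltW.
have nT : n%:R <= T + 1 :> R by rewrite /n -natr1 lerD2r.
have n0' : 0 <= n%:R :> R by exact: ler0n.
have piece k : ii k (k + 1) (fun x => weight sg x ^+ 2 * f x ^+ 2) <=
    2 * T ^+ 2 * A ^+ 2 * ii (k - n%:R) (k + 1 + n%:R) (fun x => weight sg x ^+ 2 * e x).
  have [z kz Hz] := weight_max_endpoint k sg0.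
  have k1 : k < k + 1 by rewrite ltrDl.
  apply: (@le_trans _ _ (weight sg z ^+ 2 * ii k (k + 1) (fun x => f x ^+ 2))).
    rewrite -(iiZ _ _ _ If); apply: le_ii; [exact: Iwf|exact: L1locZ|].
    move=> x /Hz xz; rewrite ler_wpM2r ?sqr_ge0// lerXn2r// nnegrE ltW// weight_gt0//.
  have step : weight sg z ^+ 2 * ii (k - T) (k + 1 + T) e <=
      A ^+ 2 * ii (k - n%:R) (k + 1 + n%:R) (fun x => weight sg x ^+ 2 * e x).
    rewrite -(iiZ _ _ _ Ie) -(iiZ _ _ _ Iwe).
    apply: (@le_trans _ _ (ii (k - n%:R) (k + 1 + n%:R) (fun x => weight sg z ^+ 2 * e x))).
      apply: ii_subset; [exact: L1locZ| | |].
      + by move=> x; rewrite mulr_ge0// sqr_ge0.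
      + by rewrite lerD2l lerN2.
      + by rewrite lerD2l.
    apply: le_ii; [exact: L1locZ|exact: L1locZ|].
    move=> x xk; rewrite mulrA; apply: ler_wpM2r; first exact: e0.
    have w0 y := ltW (weight_gt0 sg y).
    rewrite -exprMn; apply: lerXn2r; [exact: w0|exact: mulr_ge0 (powR_ge0 _ _) (w0 _)|].
    apply: weight_le; [exact: sg0|exact: addr_ge0|].
    by move/andP: xk kz => [x1 x2] /andP[z1 z2]; rewrite ler_norml; apply/andP; split; lra.
  apply: (@le_trans _ _ (2 * T ^+ 2 * (weight sg z ^+ 2 * ii (k - T) (k + 1 + T) e))).
    have -> : 2 * T ^+ 2 * (weight sg z ^+ 2 * ii (k - T) (k + 1 + T) e) =
      weight sg z ^+ 2 * (T ^+ 2 * (2 * ii (k - T) (k + 1 + T) e)) by ring.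
    by apply: ler_wpM2l; [exact: sqr_ge0|exact: Hf].
  rewrite -(mulrA (2 * T ^+ 2)); apply: ler_wpM2l => //.
  by rewrite mulr_ge0 ?sqr_ge0.
have EN : - N%:R + (2 * N)%:R * 1 = N%:R :> R by rewrite natrM; ring.
rewrite -[X in ii _ X]EN (ii_partition _ _ Iwf ler01).
apply: (@le_trans _ _ (\sum_(i < 2 * N) 2 * T ^+ 2 * A ^+ 2 *
    ii (- N%:R + i%:R - n%:R) (- N%:R + i.+1%:R + n%:R) (fun x => weight sg x ^+ 2 * e x))).
  apply: ler_sum => i _; rewrite !mulr1.
  have -> : - N%:R + i.+1%:R = - N%:R + i%:R + 1 :> R by rewrite -addrA natr1.
  exact: piece.
rewrite -mulr_sumr.
have A0 : 0 <= A by exact: powR_ge0.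
have T2 : 0 <= 2 * T ^+ 2 by rewrite mulr_ge0 ?sqr_ge0.
apply: (le_trans (ler_wpM2l (mulr_ge0 T2 (sqr_ge0 A)) (ii_sum_le _ _ n Iwe we0 HJ))).
have T10 : 0 <= 1 + T by rewrite addr_ge0// ltW.
(* 2 + n <= 3 + T <= 3 (1 + T) gives the factor 3^sg, and 2 n + 1 <= 3 (1 + T) bounds the number of
   overlaps; with the factor 2 of the hypothesis this makes the 6. *)
have HA : A <= 3 `^ sg * (1 + T) `^ sg.
  rewrite -powRM//; apply: ge0_ler_powR => //; rewrite ?nnegrE; try lra.
have HA2 : A ^+ 2 <= (3 `^ sg) ^+ 2 * ((1 + T) `^ sg) ^+ 2.
  by rewrite -exprMn lerXn2r ?nnegrE// mulr_ge0 ?powR_ge0.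
have Hn : (2 * n).+1%:R <= 3 * (1 + T) by rewrite -natr1 natrM; lra.
have HT : T ^+ 2 <= (1 + T) ^+ 2 by rewrite lerXn2r ?nnegrE ?ltW//; lra.
have -> : 6 * (3 `^ sg) ^+ 2 * J * ((1 + T) ^+ 3 * ((1 + T) `^ sg) ^+ 2) =
  2 * (1 + T) ^+ 2 * ((3 `^ sg) ^+ 2 * ((1 + T) `^ sg) ^+ 2) * ((3 * (1 + T)) * J) by ring.
apply: ler_pM.
- by rewrite mulr_ge0// sqr_ge0.
- by rewrite mulr_ge0.
- by apply: ler_pM => //; rewrite ?sqr_ge0// ler_wpM2l.
- exact: ler_wpM2r.
Qed.

(** The weight is at least 1, so [primitive_sup] bounds f(x)^2 by 2 B^2 + 2 B^2 = (2 B)^2. *)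
Lemma primitive_le_weighted sg f g (B x : R) : 0 <= sg -> 0 <= B -> continuous f ->
  L2loc g -> primitive f g -> L1loc (fun z => weight sg z ^+ 2 * g z ^+ 2) ->
  (forall p q, ii p q (fun z => weight sg z ^+ 2 * f z ^+ 2) <= B ^+ 2) ->
  (forall p q, ii p q (fun z => weight sg z ^+ 2 * g z ^+ 2) <= B ^+ 2) ->
  `|f x| <= 2 * B.
Proof.
move=> sg0 B0 cf Ig fg Iwg Hf Hg.
have cw2 : continuous (fun x => weight sg x ^+ 2).
  by move=> y; apply: cvgM; exact: weight_continuous.
have If2 : L1loc (fun z => f z ^+ 2) := L2loc_sqr (L2loc_continuous cf).
have le1 (h : R -> R) : L1loc (fun z => h z ^+ 2) -> ii x (x + 1) (fun z => h z ^+ 2) <=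
    ii x (x + 1) (fun z => weight sg z ^+ 2 * h z ^+ 2).
  move=> Ih; apply: le_ii => //; first exact: L1loc_continuousM.
  move=> z _; rewrite ler_peMl ?sqr_ge0// expr_ge1 ?weight_ge1//.
  by rewrite ltW// weight_gt0.
rewrite -(@ler_pXn2r _ 2) ?nnegrE ?mulr_ge0// real_normK ?num_real//.
apply: (le_trans (primitive_sup x Ig fg)).
have := le_trans (le1 f If2) (Hf _ _).
have := le_trans (le1 g (L2loc_sqr Ig)) (Hg _ _).
have -> : (2 * B) ^+ 2 = 2 * B ^+ 2 + 2 * B ^+ 2 by ring.
by move=> h1 h2; apply: lerD; rewrite ler_wpM2l.
Qed.

End weighted_bounds.

(** * The weighted initial energy and the growth bound *)

Section initial_energy.
Context {R : realType}.
Context (U : R -> R) (a m : R) (s : R -> R).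
Context (U_smooth : smooth U) (U_even : forall x, U (- x) = U x).
Context (U_two_well : two_well 7 U a m) (s_kink : kink U a s).
Context (sg B : R) (sg0 : 0 <= sg) (B0 : 0 <= B).
Context (X0 : state R) (X0_E : in_E sg X0) (X0_le : (Enorm sg X0 <= B%:E)%E).

Local Notation mu := (@lebesgue_measure R).
Local Notation weighted f := (fun x => weight sg x ^+ 2 * f x ^+ 2).

Lemma Enorm_weighted :
  [/\ forall p q, ii p q (weighted X0.1) <= B ^+ 2,
      L1loc (weighted (weak_derivative X0.1)),
      forall p q, ii p q (weighted (weak_derivative X0.1)) <= B ^+ 2 &
      forall p q, ii p q (weighted X0.2) <= B ^+ 2].
Proof.
have [E1 E2] := X0_E; have [J1 J2 _] := in_H1_facts sg0 E1.
have J3 := in_H0_facts sg0 E2.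
move: X0_le; rewrite /Enorm Hnorm1E Hnorm0E.
set N1 := Lnorm mu _ _; set N2 := Lnorm mu _ _; set N3 := Lnorm mu _ _ => HE.
have N10 : (0 <= N1)%E by exact: Lnorm_ge0.
have N20 : (0 <= N2)%E by exact: Lnorm_ge0.
have N30 : (0 <= N3)%E by exact: Lnorm_ge0.
have H1 : (N1 <= B%:E)%E by apply: le_trans HE; rewrite -addeA leeDl// adde_ge0.
have H2 : (N2 <= B%:E)%E by apply: le_trans HE; rewrite addeAC leeDr// adde_ge0.
have H3 : (N3 <= B%:E)%E by apply: le_trans HE; rewrite leeDr// adde_ge0.
have [_ _ W1] := L2_weighted sg0 B0 (L2loc_meas J1) H1.
have [_ I2 W2] := L2_weighted sg0 B0 (L2loc_meas J2) H2.
have [_ _ W3] := L2_weighted sg0 B0 (L2loc_meas J3) H3.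
by split.
Qed.

(** Supplies the range |y| <= 2 B in which the potential near the kink is estimated, and so makes
    the constant of that estimate a function of the norm bound. *)
Lemma Enorm_bounded : {ae mu, forall x, `|X0.1 x| <= 2 * B}.
Proof.
have [E1 E2] := X0_E; have [J1 J2 W] := in_H1_facts sg0 E1.
have [W1 I2 W2 _] := Enorm_weighted.
have [f [pf af]] := weak_derivative_primitive W.
have cf : continuous f := primitive_continuous J2 pf.
have cw2 : continuous (fun x => weight sg x ^+ 2).
  by move=> y; apply: cvgM; exact: weight_continuous.
have Wf p q : ii p q (weighted f) <= B ^+ 2.
  apply: le_trans (W1 p q); rewrite le_eqVlt; apply/orP; left; apply/eqP.
  apply: ae_eq_ii_in.
  - apply: measurable_funM; first exact: continuous_measurable_fun.
    by apply: measurable_funX; exact: continuous_measurable_fun.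
  - apply: measurable_funM; first exact: continuous_measurable_fun.
    by apply: measurable_funX; exact: L2loc_meas.
  - by apply: ae_mono af => x ->.
apply: ae_mono af => x <-.
exact: (primitive_le_weighted x sg0 B0 cf J2 pf I2 Wf W2).
Qed.

Context (X : R -> state R).
Context (X_sol : is_solution U s (fun t => kink_state s + X t) (kink_state s + X0)).

Lemma solution_initial : [/\ {ae mu, forall x, (X 0).1 x = X0.1 x},
  {ae mu, forall x, (X 0).2 x = X0.2 x} &
  weak_derivative (X 0).1 = weak_derivative X0.1].
Proof.
have [_ _ [H1 H2] _] := X_sol.
have A1 : {ae mu, forall x, (X 0).1 x = X0.1 x}.
  apply: ae_mono H1 => x /(_ I) H.
  by apply: (@addrI _ (s x)); exact: H.
split => //.
  apply: ae_mono H2 => x /(_ I) H.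
  by apply: (@addrI _ 0); exact: H.
have [[E1 _] [E2 _]] := (X0_E, solution_E X_sol 0).
have [J1 _ _] := in_H1_facts sg0 E1; have [J2 _ _] := in_H1_facts (lexx 0) E2.
by apply: weak_derivative_ae => //; exact: L2loc_L1loc.
Qed.

Context (psi : R -> R -> R).
Let d t x := derive1 s x + 1 * weak_derivative (X t).1 x.
Context (psi_sol : field_solution (derive1 U) psi d (fun t => (X t).2)).
Context (psiE : forall t, {ae mu, forall x, psi t x = s x + (X t).1 x}).
Context (K J : R) (K0 : 0 <= K).
Context (HK : forall x y, `|y| <= 2 * B -> U (s x + y) <= K * (expR (- (m * `|x|)) + y ^+ 2)).
Context (HJ : forall p q, ii p q (fun x => weight sg x ^+ 2 * expR (- (m * `|x|))) <= J).

Let e x := energy_density U psi d (fun t => (X t).2) 0 x.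

(** Of the 3 K, one comes from U(s + X0) and two from the slope of the kink: (s' + w)^2 / 2 <= s'^2
    + w^2 with s'^2 = 2 U(s), where U(s) <= K exp(-m |x|) is the case y = 0 of [HK]. *)
Lemma initial_energy_le : {ae mu, forall x, e x <=
  X0.2 x ^+ 2 + weak_derivative X0.1 x ^+ 2 + K * X0.1 x ^+ 2 + 3 * K * expR (- (m * `|x|))}.
Proof.
have [A1 A2 A3] := solution_initial.
apply: ae_mono (ae_and (ae_and A1 A2) (ae_and (psiE 0) Enorm_bounded)) => x [[E1 E2] [E3 E4]].
rewrite /e /energy_density /d A3 E3 E1 E2 mul1r.
have h1 := HK x E4.
have := HK x (y := 0); rewrite normr0 addr0 expr0n/= addr0 => /(_ _)/[!mulr_ge0]// => /(_ isT) h2.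
have h3 := kink_first_integral U_smooth U_even U_two_well s_kink x.
have h4 : (derive1 s x + weak_derivative X0.1 x) ^+ 2 <=
  2 * derive1 s x ^+ 2 + 2 * weak_derivative X0.1 x ^+ 2.
  rewrite -subr_ge0 (_ : _ - _ = (derive1 s x - weak_derivative X0.1 x) ^+ 2) ?sqr_ge0//.
  by ring.
have h5 := sqr_ge0 (X0.2 x).
rewrite h3 in h4; move: h1 h2 h4 h5; lra.
Qed.

Lemma initial_energy_weighted p q :
  ii p q (fun x => weight sg x ^+ 2 * e x) <= (2 + K) * B ^+ 2 + 3 * K * J.
Proof.
have [E1 E2] := X0_E; have [J1 J2 W] := in_H1_facts sg0 E1.
have J3 := in_H0_facts sg0 E2.
have [W1 _ W2 W3] := Enorm_weighted.
have cw2 : continuous (fun x => weight sg x ^+ 2).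
  by move=> y; apply: cvgM; exact: weight_continuous.
have I1 : L1loc (weighted X0.1) := L1loc_continuousM cw2 (L2loc_sqr J1).
have I2 : L1loc (weighted (weak_derivative X0.1)) := L1loc_continuousM cw2 (L2loc_sqr J2).
have I3 : L1loc (weighted X0.2) := L1loc_continuousM cw2 (L2loc_sqr J3).
have I4 : L1loc (fun x => weight sg x ^+ 2 * expR (- (m * `|x|))).
  exact: L1loc_continuousM cw2 (L1loc_continuous (@continuous_expR_norm _ m)).
have I12 := L1locD I3 I2; have I123 := L1locD I12 (L1locZ K I1).
have Ie : L1loc (fun x => weight sg x ^+ 2 * e x).
  apply: L1loc_continuousM cw2 _.
  exact: (L1loc_energy (fun x => is_derive_smooth x U_smooth) psi_sol 0).
apply: (@le_trans _ _ (ii p q (fun x => weight sg x ^+ 2 * X0.2 x ^+ 2 +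
    weight sg x ^+ 2 * weak_derivative X0.1 x ^+ 2 +
    K * (weight sg x ^+ 2 * X0.1 x ^+ 2) +
    3 * K * (weight sg x ^+ 2 * expR (- (m * `|x|)))))).
  apply: ae_le_ii; [exact: Ie|exact: L1locD I123 (L1locZ _ I4)|].
  apply: ae_mono initial_energy_le => x H _.
  rewrite (_ : _ + _ = weight sg x ^+ 2 * (X0.2 x ^+ 2 + weak_derivative X0.1 x ^+ 2 +
    K * X0.1 x ^+ 2 + 3 * K * expR (- (m * `|x|)))); last by ring.
  by apply: ler_wpM2l => //; exact: sqr_ge0.
rewrite (iiD _ _ I123 (L1locZ _ I4)) (iiD _ _ I12 (L1locZ K I1)) (iiD _ _ I3 I2).
rewrite (iiZ _ _ _ I1) (iiZ _ _ _ I4).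
have -> : (2 + K) * B ^+ 2 + 3 * K * J = B ^+ 2 + B ^+ 2 + K * B ^+ 2 + 3 * K * J by ring.
apply: lerD; last by apply: ler_wpM2l => //; rewrite mulr_ge0.
by apply: lerD; [apply: lerD|apply: ler_wpM2l].
Qed.

(** Psi(T) is the displacement psi(T) - psi(0) plus the initial perturbation; squaring the sum costs
    a factor 2 and turns the 6 of [weighted_displacement] into 12. The summand 1 makes C >= 1, so
    that C <= C^2 and no root of the constant is taken; Z >= 1 absorbs the initial norm. *)
Lemma solution_weighted_le T : 0 < T ->
  (Hnorm 0 sg (X T).1 <=
    ((12 * (3 `^ sg) ^+ 2 * ((2 + K) * B ^+ 2 + 3 * K * J) + 2 * B ^+ 2 + 1) *
     (1 + T) `^ (sg + 3 / 2))%:E)%E.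
Proof.
move=> T0; set JE := (2 + K) * B ^+ 2 + 3 * K * J.
set C := 12 * _ * JE + _ + 1; set Z := (1 + T) `^ (sg + 3 / 2).
have T10 : 0 < 1 + T by rewrite addr_gt0.
have U0 := two_well_ge0 U_even U_two_well.
have UV (x : R) : is_derive x 1 U (derive1 U x) by exact: is_derive_smooth.
have sdU := smooth_derive1 U_smooth.
have VD (x : R) : is_derive x 1 (derive1 U) (derive1 (derive1 U) x).
  exact: (is_derive_smooth x sdU).
have cDV : continuous (derive1 (derive1 U)).
  exact: smooth_continuous (smooth_derive1 sdU).
have disp p q := @field_displacement _ _ _ _ _ _ _ UV U0 VD cDV psi_sol T p q T0.
have Id t : L2loc (d t) := field_L2_d psi_sol t.
have cpsi t : continuous (psi t) := primitive_continuous (Id t) (field_primitive psi_sol t).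
have ID : L1loc (fun x => (psi T x - psi 0 x) ^+ 2).
  by apply: L2loc_sqr; apply: L2locB; exact: L2loc_continuous.
have Ie : L1loc e := L1loc_energy UV psi_sol 0.
have e0 x : 0 <= e x by exact: energy_density_ge0.
have WD := weighted_displacement sg0 T0 ID Ie e0 disp initial_energy_weighted.
have [E1 E2] := X0_E; have [J1 _ _] := in_H1_facts sg0 E1.
have [E1' _] := solution_E X_sol T; have [J1' _ _] := in_H1_facts (lexx 0) E1'.
have [W1 _ W2 W3] := Enorm_weighted.
have cw2 : continuous (fun x => weight sg x ^+ 2).
  by move=> y; apply: cvgM; exact: weight_continuous.
have I1 : L1loc (weighted X0.1) := L1loc_continuousM cw2 (L2loc_sqr J1).
have I1' : L1loc (weighted (X T).1) := L1loc_continuousM cw2 (L2loc_sqr J1').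
have I2 := L1loc_continuousM cw2 ID.
have [A1 _ _] := solution_initial.
have JE0 : 0 <= JE by apply: le_trans (initial_energy_weighted 0 0); rewrite ii_empty.
have Z1 : 1 <= Z.
  rewrite -(powRr0 (1 + T)) ler_powR ?addr_ge0 ?divr_ge0//.
  by rewrite lerDl ltW.
have Z2 : Z ^+ 2 = (1 + T) ^+ 3 * ((1 + T) `^ sg) ^+ 2.
  rewrite /Z -!powR_mulrn ?powR_ge0 ?(ltW T10)// -!powRrM -powRD; last first.
    by rewrite (gt_eqF T10) implybT.
  by congr (_ `^ _); lra.
have C1 : 1 <= C.
  rewrite /C lerDr addr_ge0//; last by rewrite mulr_ge0 ?sqr_ge0.
  by rewrite !mulr_ge0// sqr_ge0.
have C0 : 0 <= C by exact: le_trans C1.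
have Z0 : 0 <= Z by exact: le_trans Z1.
rewrite Hnorm0E; apply/(Lnorm2_le _ (mulr_ge0 C0 Z0)).
have -> : (fun x => ((weight sg x * (X T).1 x) ^+ 2)%:E) =
          (fun x => (weight sg x ^+ 2 * (X T).1 x ^+ 2)%:E).
  by apply/funext => x; rewrite exprMn.
apply: integral_le_ii; [exact: I1'|by move=> x; rewrite mulr_ge0 ?sqr_ge0|].
move=> N.
apply: (@le_trans _ _ (ii (- N%:R) N%:R (fun x =>
    2 * (weight sg x ^+ 2 * (psi T x - psi 0 x) ^+ 2) + 2 * (weight sg x ^+ 2 * X0.1 x ^+ 2)))).
  apply: ae_le_ii; [exact: I1'|exact: L1locD (L1locZ _ I2) (L1locZ _ I1)|].
  apply: ae_mono (ae_and (ae_and (psiE T) (psiE 0)) A1) => x [[-> ->] ->] _.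
  rewrite !(mulrCA 2) -mulrDr; apply: ler_wpM2l; first exact: sqr_ge0.
  rewrite -subr_ge0 (_ : _ - _ = ((X T).1 x - 2 * X0.1 x) ^+ 2) ?sqr_ge0//.
  by ring.
rewrite (iiD _ _ (L1locZ _ I2) (L1locZ _ I1)) (iiZ _ _ _ I2) (iiZ _ _ _ I1).
rewrite exprMn.
apply: (@le_trans _ _ (C * Z ^+ 2)); last first.
  by rewrite ler_wpM2r ?sqr_ge0// expr2 ler_peMl.
have Z21 : 1 <= Z ^+ 2 by rewrite expr_ge1.
have -> : C * Z ^+ 2 = 2 * (6 * (3 `^ sg) ^+ 2 * JE * Z ^+ 2) + 2 * B ^+ 2 * Z ^+ 2 + Z ^+ 2.
  by rewrite /C; ring.
rewrite -addrA; apply: lerD; first by rewrite ler_wpM2l// Z2; exact: WD.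
apply: ler_wpDr; first exact: sqr_ge0.
rewrite -mulrA ler_wpM2l//; apply: (le_trans (W1 _ _)).
by rewrite ler_peMr ?sqr_ge0.
Qed.

End initial_energy.

Theorem propositionH1 (R : realType) (U : R -> R) (a m : R) (s : R -> R)
    (nu : R)
    (U_smooth : smooth U) (U_even : forall x, U (- x) = U x)
    (U_two_well : two_well 7 U a m)
    (s_kink : kink U a s)
    (nu_gt0 : 0 < nu) :
  exists C : R -> R, forall (d0 : R) (X0 : state R) (X : R -> state R),
    in_E (5 / 2 + nu) X0 ->
    (Enorm (5 / 2 + nu) X0 <= d0%:E)%E ->
    is_solution U s (fun t => kink_state s + X t) (kink_state s + X0) ->
    forall t : R, 0 < t ->
      (Hnorm 0 (5 / 2 + nu) (X t).1 <= (C d0 * (1 + t) `^ (4 + nu))%:E)%E.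
Proof.
have m0 : 0 < m by case: U_two_well.
set sg := 5 / 2 + nu; have sg0 : 0 < sg by rewrite addr_gt0.
have [J J0 HJ] := weight_expR_integral sg0 m0.
have HK M := kink_potential_le U_smooth U_even U_two_well s_kink M.
(* A constant is fixed for every range [M] beforehand, because [C] has to be a function of [d0]; it
   is used at M = 2 d0, the bound of [Enorm_bounded]. *)
pose K M := s2val (cid2 (HK M)).
exists (fun d0 => 12 * (3 `^ sg) ^+ 2 *
  ((2 + K (2 * d0)) * d0 ^+ 2 + 3 * K (2 * d0) * J) + 2 * d0 ^+ 2 + 1).
move=> d0 X0 X X0_E X0_le X_sol t t0.
have d00 : 0 <= d0.
  rewrite -lee_fin; apply: le_trans X0_le.
  rewrite /Enorm Hnorm1E Hnorm0E; apply: adde_ge0; last exact: Lnorm_ge0.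
  by apply: adde_ge0; exact: Lnorm_ge0.
have [psi [psi_sol psiE]] := solution_field U_smooth s_kink X_sol.
have -> : 4 + nu = sg + 3 / 2 by rewrite /sg; lra.
rewrite /K; case: (cid2 _) => K' K0' HK' /=.
exact: (solution_weighted_le U_smooth U_even U_two_well s_kink (ltW sg0) d00
  X0_E X0_le X_sol psi_sol psiE K0' HK' HJ t0).
Qed.
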